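(* Let $n\ge 4$, let $K$ be the Klein bottle, let $\tilde\tau_{3,1}:K\to\mathbb S^4$ be the bipolar surface of Lawson's $\tau_{3,1}$ torus (a minimally embedded Klein bottle), and let $\varphi:\mathbb S^4\setminus\{p\}\to\mathbb R^4$ be a stereographic projection with pole $p\notin\tilde\tau_{3,1}(K)$. Regard $\varphi\circ\tilde\tau_{3,1}$ as an immersion $K\to\mathbb R^4\times\{0\}^{n-4}\subset\mathbb R^n$. Then $\varphi\circ\tilde\tau_{3,1}$ minimizes the Willmore energy in its conformal class: its Willmore energy is $6\pi\,\mathrm E\!\left(\frac{2\sqrt2}{3}\right)$, and for every immersion $f:K\to\mathbb R^n$ that is conformal to $\varphi\circ\tilde\tau_{3,1}$ one has $$\mathcal W(f)\ \ge\ 6\pi\,\mathrm E\!\left(\frac{2\sqrt2}{3}\right).$$ Furthermore, if equality holds for an immersion $f:K\to\mathbb R^n$ conformal to $\varphi\circ\tilde\tau_{3,1}$, then $f$ coincides with $\varphi\circ\tilde\tau_{3,1}$ up to a conformal diffeomorphism of $\mathbb R^n$ (i.e. a Möbius transformation of $\mathbb R^n\cup\{\infty\}$).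
   Context: All maps and metrics are smooth. Willmore energy: for an immersion $f:M\to\mathbb R^n$ of a closed surface, $\mathcal W(f)=\frac14\int_M|H|^2\,d\mu_g$, where $g=f^\sharp\delta_{\mathbb R^n}$ is the pullback of the Euclidean metric, $d\mu_g$ its area measure, and $H$ is the mean curvature vector, i.e. the trace with respect to $g$ of the second fundamental form (so round spheres have $\mathcal W=4\pi$). Conformal: an immersion $f:K\to\mathbb R^n$ is conformal to an immersion $h:K\to\mathbb R^n$ if $f^\sharp\delta_{\mathbb R^n}=e^{2u}\,h^\sharp\delta_{\mathbb R^n}$ for some smooth function $u:K\to\mathbb R$. Elliptic integral: $\mathrm E(k)=\int_0^{\pi/2}\sqrt{1-k^2\sin^2\theta}\,d\theta$ is the complete elliptic integral of the second kind with modulus $k$; $6\pi\,\mathrm E(2\sqrt2/3)\approx 6.682\,\pi$. Lawson's surface $\tau_{3,1}$: the minimal surface in $\mathbb S^3\subset\mathbb R^4$ given by $\Psi:\mathbb R^2\to\mathbb S^3$, $\Psi(x,y)=(\cos 3x\cos y,\ \sin 3x\cos y,\ \cos x\sin y,\ \sin x\sin y)$. It is a torus parametrized over $\mathbb R^2/\Gamma$, where $\Gamma$ is the lattice generated by $(\pi,\pi)$ and $(\pi,-\pi)$. Bipolar surface: for a minimal immersion $\psi:M\to\mathbb S^3\subset\mathbb R^4$ of a surface with Gauss map $\psi^\ast:M\to\mathbb S^3\subset\mathbb R^4$ (the unit normal of $\psi$ in $\mathbb S^3$), the bipolar surface is $\tilde\psi=\psi\wedge\psi^\ast:M\to\mathbb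 S^5\subset\Lambda^2\mathbb R^4\cong\mathbb R^6$, which is a minimal immersion into $\mathbb S^5$. For $\psi=\Psi$ one has, up to sign, $\psi^\ast=(1+8\cos^2y)^{-1/2}\,(\sin 3x\sin y,\ -\cos 3x\sin y,\ -3\sin x\cos y,\ 3\cos x\cos y)$. The image of $\tilde\psi$ for $\psi=\Psi$ lies in the intersection of $\mathbb S^5$ with a hyperplane through the origin, i.e. in a great sphere $\mathbb S^4$, and it is known that this image is a minimally embedded Klein bottle in $\mathbb S^4$; $\tilde\tau_{3,1}:K\to\mathbb S^4$ denotes this minimal embedding of the Klein bottle $K$. *)

(* Defs.v *)
From HB Require Import structures.
From mathcomp Require Import all_boot all_order all_algebra.
From mathcomp Require Import all_classical all_reals all_analysis.
From mathcomp Require Import ring lra.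

Set Implicit Arguments.
Unset Strict Implicit.
Unset Printing Implicit Defensive.

Import Order.TTheory GRing.Theory Num.Theory.
Import numFieldNormedType.Exports.

Local Open Scope classical_set_scope.
Local Open Scope ring_scope.

Section Euclidean.
Variable R : realType.

Definition dot n (u v : 'rV[R]_n) : R := \sum_(i < n) u 0 i * v 0 i.

(* C^k and C^oo maps on the plane, derivatives being taken in all directions. *)
Fixpoint Ck (k : nat) (W : normedModType R) (F : R * R -> W) : Prop :=
  match k with
  | 0 => continuous F
  | k'.+1 => (forall p, differentiable F p) /\ (forall v, Ck k' ('D_v F))
  end.

Definition smooth (W : normedModType R) (F : R * R -> W) := forall k, Ck k F.

(* The Klein bottle is the quotient of the plane by the group generated by the
   glide reflection (x, t) |-> (x + pi/2, - t) and the translation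
   (x, t) |-> (x, t + pi); the elements of this group are the maps
   (x, t) |-> (x + k pi/2, (-1)^k t + l pi), and [0, pi/2[ x [0, pi[ is a
   fundamental domain.  A smooth map on the Klein bottle is a smooth map on the
   plane that is constant on the orbits. *)
Definition klein_equiv (p q : R * R) : Prop :=
  exists k l : int,
    q = (p.1 + k%:~R * (pi / 2), (-1) ^ k * p.2 + l%:~R * pi).

Definition klein_domain : set (R * R) := `[0, pi / 2[ `*` `[0, pi[.

Definition on_klein (W : Type) (F : R * R -> W) : Prop :=
  forall p q, klein_equiv p q -> F p = F q.

(* Local geometry of F : R^2 -> R^n; row vectors throughout, so the rows of
   the Jacobian are the partial derivatives of F. *)
Definition dir (i : 'I_2) : R * R := if i == 0 then (1, 0) else (0, 1).

Definition jacobian n (F : R * R -> 'rV[R]_n) (p : R * R) : 'M[R]_(2, n) :=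
  \matrix_(i, j) ('D_(dir i) F p) 0 j.

(* Matrix of the pullback of the Euclidean metric. *)
Definition metric n (F : R * R -> 'rV[R]_n) (p : R * R) : 'M[R]_2 :=
  jacobian F p *m (jacobian F p)^T.

Definition klein_immersion n (F : R * R -> 'rV[R]_n) : Prop :=
  [/\ smooth F, on_klein F & forall p, \rank (jacobian F p) = 2%N].

Definition conformal_to n m (F : R * R -> 'rV[R]_n) (G : R * R -> 'rV[R]_m) :=
  exists u : R * R -> R,
    [/\ smooth u, on_klein u & forall p, metric F p = expR (2 * u p) *: metric G p].

(* Orthogonal projection onto the normal space, the orthogonal complement of
   the row space of the Jacobian. *)
Definition normal_proj n (F : R * R -> 'rV[R]_n) (p : R * R) (v : 'rV[R]_n) :=
  v - v *m (jacobian F p)^T *m invmx (metric F p) *m jacobian F p.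

Definition second_form n (F : R * R -> 'rV[R]_n) (i j : 'I_2) (p : R * R) :=
  normal_proj F p ('D_(dir i) ('D_(dir j) F) p).

Definition mean_curvature n (F : R * R -> 'rV[R]_n) (p : R * R) : 'rV[R]_n :=
  \sum_(i < 2) \sum_(j < 2) invmx (metric F p) i j *: second_form F i j p.

Definition willmore n (F : R * R -> 'rV[R]_n) : R :=
  4^-1 * \int[(lebesgue_measure \x lebesgue_measure)%E]_(p in klein_domain)
    (dot (mean_curvature F p) (mean_curvature F p)
     * Num.sqrt (\det (metric F p))).

Definition ellipticE (k : R) : R :=
  \int[lebesgue_measure]_(a in `[0, pi / 2])
    Num.sqrt (1 - k ^+ 2 * sin a ^+ 2).

Definition vec n (s : seq R) : 'rV[R]_n := \row_(i < n) s`_i.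

Definition lawson31 (q : R * R) : 'rV[R]_4 :=
  let: (x, y) := q in
  vec 4 [:: cos (3 * x) * cos y; sin (3 * x) * cos y;
            cos x * sin y; sin x * sin y].

Definition lawson31_normal (q : R * R) : 'rV[R]_4 :=
  let: (x, y) := q in
  (Num.sqrt (1 + 8 * cos y ^+ 2))^-1 *:
  vec 4 [:: sin (3 * x) * sin y; - (cos (3 * x) * sin y);
            - (3 * sin x * cos y); 3 * cos x * cos y].

(* Exterior product of two vectors of R^4, in the orthonormal basis
   e12, e13, e14, e23, e24, e34 of Lambda^2 R^4. *)
Definition wedge (u v : 'rV[R]_4) : 'rV[R]_6 :=
  let m i j := u 0 (inord i) * v 0 (inord j) - u 0 (inord j) * v 0 (inord i) in
  vec 6 [:: m 0 1; m 0 2; m 0 3; m 1 2; m 1 3; m 2 3]%N.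

Definition bipolar31 (q : R * R) : 'rV[R]_6 :=
  wedge (lawson31 q) (lawson31_normal q).

(* The diffeomorphism of the line with tan (rho t) = sqrt 3 * tan (t + pi / 4)
   and rho (t + pi) = rho t + pi.  The identifications made by bipolar31 are
   generated by (x, y) ~ (x, y + pi) and (x, y) ~ (x + pi/2, y') where
   tan y * tan y' = 3; in the coordinate t they become those of klein_equiv
   (see tau31_eq). *)
Definition rho (t : R) : R :=
  let w := t + pi / 4 in
  w + atan ((Num.sqrt 3 - 1) * sin w * cos w
            / (cos w ^+ 2 + Num.sqrt 3 * sin w ^+ 2)).

Definition tau31 (q : R * R) : 'rV[R]_6 := bipolar31 (q.1, rho q.2).

(* The great sphere S^4 of S^5 that contains the image of bipolar31: it is cut
   out by the hyperplane of equation 3 * w12 + w34 = 0. *)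
Definition hyperplane_normal : 'rV[R]_6 := vec 6 [:: 3; 0; 0; 0; 0; 1].

Definition sphere4 (v : 'rV[R]_6) : Prop := dot v v = 1 /\ dot hyperplane_normal v = 0.

(* The columns of J are an orthonormal basis of the equatorial hyperplane of
   S^4 orthogonal to p, which identifies that hyperplane with R^4. *)
Definition stereographic (p : 'rV[R]_6) (phi : 'rV[R]_6 -> 'rV[R]_4) : Prop :=
  sphere4 p /\
  exists J : 'M[R]_(6, 4),
    [/\ J^T *m J = 1%:M, hyperplane_normal *m J = 0, p *m J = 0 &
      forall v, sphere4 v -> v != p ->
        phi v = (1 - dot v p)^-1 *: (v *m J)].

(* R^4 x {0} in R^n, for 4 <= n. *)
Definition pad4 n (v : 'rV[R]_4) : 'rV[R]_n := v *m pid_mx 4.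

(* Moebius transformations of R^n with a point at infinity (None), including
   the orientation reversing ones. *)
Definition inversion n (z : option 'rV[R]_n) : option 'rV[R]_n :=
  match z with
  | None => Some 0
  | Some v => if v == 0 then None else Some ((dot v v)^-1 *: v)
  end.

Inductive moebius n : (option 'rV[R]_n -> option 'rV[R]_n) -> Prop :=
| moebius_similarity (a : R) (A : 'M[R]_n) (b : 'rV[R]_n) :
    0 < a -> A *m A^T = 1%:M ->
    moebius (omap (fun v => a *: (v *m A) + b))
| moebius_inversion : moebius (@inversion n)
| moebius_comp m1 m2 : moebius m1 -> moebius m2 -> moebius (m1 \o m2).

End Euclidean.

Section Fibres.
Variable R : realType.
Implicit Types (x y t w : R) (p q : R * R).

Let s3 : R := Num.sqrt 3.
Let s3_gt0 : 0 < s3. Proof. by rewrite sqrtr_gt0; lra. Qed.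
Let s3_sqr : s3 ^+ 2 = 3. Proof. by rewrite sqr_sqrtr //; lra. Qed.

Lemma rho_den_gt0 w : 0 < cos w ^+ 2 + s3 * sin w ^+ 2.
Proof.
have cs := cos2Dsin2 w; have [s0|s0] := eqVneq (sin w) 0.
  by rewrite s0 expr0n mulr0 addr0; move: cs; rewrite s0 expr0n addr0 => ->.
by apply: ltr_wpDl; [exact: sqr_ge0 | rewrite mulr_gt0// exprn_even_gt0].
Qed.

Lemma cos_sin_rho t : let w := t + pi / 4 in
  let r := Num.sqrt (cos w ^+ 2 + 3 * sin w ^+ 2) in
  0 < r /\ (cos (rho t) = cos w / r /\ sin (rho t) = s3 * sin w / r).
Proof.
move=> w r; rewrite /rho -/w -/s3.
set a := cos w ^+ 2 + s3 * sin w ^+ 2; set b := (s3 - 1) * sin w * cos w.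
have cs := cos2Dsin2 w.
have r2 : r ^+ 2 = cos w ^+ 2 + 3 * sin w ^+ 2.
  by rewrite sqr_sqrtr //; nra.
have r_gt0 : 0 < r by rewrite sqrtr_gt0; nra.
have a_gt0 : 0 < a by exact: rho_den_gt0.
have ab : a ^+ 2 + b ^+ 2 = r ^+ 2.
  transitivity ((cos w ^+ 2 + sin w ^+ 2) * (cos w ^+ 2 + s3 ^+ 2 * sin w ^+ 2)).
    by rewrite /a /b; ring.
  by rewrite cs s3_sqr mul1r r2.
have ca : cos (atan (b / a)) = a / r.
  rewrite cos_atan; have -> : 1 + (b / a) ^+ 2 = (r / a) ^+ 2.
    by rewrite !expr_div_n -ab; field; rewrite gt_eqF.
  by rewrite sqrtr_sqr gtr0_norm ?divr_gt0// invf_div.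
have sa : sin (atan (b / a)) = b / r.
  have ca0 : cos (atan (b / a)) != 0 by rewrite ca gt_eqF// divr_gt0.
  rewrite -[LHS](divfK ca0) -/(tan _) atanK ca.
  by field; rewrite !gt_eqF.
split => //; rewrite cosD sinD ca sa; split.
  transitivity (cos w * (cos w ^+ 2 + sin w ^+ 2) / r); first by rewrite /a /b; ring.
  by rewrite cs mulr1.
transitivity (s3 * sin w * (cos w ^+ 2 + sin w ^+ 2) / r); first by rewrite /a /b; ring.
by rewrite cs mulr1.
Qed.

Lemma tau31E q :
  let C := - sin (2 * q.2) in let S := cos (2 * q.2) in
  let d := Num.sqrt (4 - C ^+ 2) in
  let P := s3 / d in let Q := s3 * C / d in
  tau31 q = vec 6 [:: - (S / 2 / d);
    (Q * sin (2 * q.1) - P * sin (4 * q.1)) / 2;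
    (Q * cos (2 * q.1) + P * cos (4 * q.1)) / 2;
    (P * cos (4 * q.1) - Q * cos (2 * q.1)) / 2;
    (Q * sin (2 * q.1) + P * sin (4 * q.1)) / 2;
    3 * (S / 2 / d)].
Proof.
case: q => x t /= ; rewrite /tau31 /bipolar31 /=.
set C := - sin (2 * t); set S := cos (2 * t); set d := Num.sqrt (4 - _).
have [r_gt0 [cr sr]] := cos_sin_rho t.
set w := t + pi / 4 in r_gt0 cr sr; set r := Num.sqrt _ in r_gt0 cr sr.
have cs := cos2Dsin2 w.
have r2 : r ^+ 2 = cos w ^+ 2 + 3 * sin w ^+ 2.
  by rewrite sqr_sqrtr //; nra.
have CE : C = cos w ^+ 2 - sin w ^+ 2.
  rewrite /C -cosDpihalf -(_ : w + w = 2 * t + pi / 2); last by rewrite /w; field.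
  by rewrite cosD; ring.
have SE : S = 2 * sin w * cos w.
  rewrite /S -sinDpihalf -(_ : w + w = 2 * t + pi / 2); last by rewrite /w; field.
  by rewrite sinD; ring.
have d2 : d ^+ 2 = 4 - C ^+ 2.
  by rewrite sqr_sqrtr // /C subr_ge0 sqrrN; have := cos2Dsin2 (2 * t); nra.
have d_gt0 : 0 < d.
  by rewrite sqrtr_gt0 /C; have := cos2Dsin2 (2 * t); nra.
have DE : Num.sqrt (1 + 8 * cos (rho t) ^+ 2) = s3 * d / r ^+ 2.
  have -> : 1 + 8 * cos (rho t) ^+ 2 = (s3 * d / r ^+ 2) ^+ 2.
    have r0 : r ^+ 2 != 0 by rewrite gt_eqF // exprn_gt0.
    rewrite cr; apply: (@mulIf _ (r ^+ 2 ^+ 2)); first by rewrite expf_neq0.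
    transitivity (r ^+ 2 * (r ^+ 2 + 8 * cos w ^+ 2)); first by field; rewrite gt_eqF.
    transitivity (s3 ^+ 2 * d ^+ 2); last by field; rewrite gt_eqF.
    rewrite d2 s3_sqr r2 CE.
    have -> : sin w ^+ 2 = 1 - cos w ^+ 2 by rewrite -cs addrC addKr.
    by ring.
  by rewrite sqrtr_sqr gtr0_norm // divr_gt0 ?mulr_gt0 ?exprn_gt0.
clearbody w.
have x4 : 4 * x = 3 * x + x by ring.
have x2 : 2 * x = 3 * x - x by ring.
rewrite /wedge /lawson31 /lawson31_normal DE.
congr vec; rewrite !mxE !inordK //= cr sr x4 x2 !(cosD, sinD, cosN, sinN).
have csx := cos2Dsin2 x; have cs3x := cos2Dsin2 (3 * x).
rewrite -(mulr1 (s3 / d)) -[X in s3 / d * X]cs SE CE.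
move: (cos (3 * x)) (sin (3 * x)) (cos x) (sin x) (cos w) (sin w) cs3x csx {cs r2 cr sr CE SE DE}
  => c3 n3 c n cw sw cs3x csx.
have r0 : r != 0 by rewrite gt_eqF.
have d0 : d != 0 by rewrite gt_eqF.
have s0 : s3 != 0 by rewrite gt_eqF.
rewrite -s3_sqr; congr [:: _; _; _; _; _; _].
- transitivity (- (sw * cw * (c3 ^+ 2 + n3 ^+ 2) / d)); last by rewrite cs3x; field.
  by field; rewrite ?s0 ?r0 ?d0.
- by field; rewrite ?s0 ?r0 ?d0.
- by field; rewrite ?s0 ?r0 ?d0.
- by field; rewrite ?s0 ?r0 ?d0.
- by field; rewrite ?s0 ?r0 ?d0.
transitivity (s3 ^+ 2 * (sw * cw * (c ^+ 2 + n ^+ 2) / d)); last by rewrite csx; field.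
by field; rewrite ?s0 ?r0 ?d0.
Qed.

Lemma tau31_sphere4 q : sphere4 (tau31 q).
Proof.
set C := - sin (2 * q.2); set d := Num.sqrt (4 - C ^+ 2).
have d_gt0 : 0 < 4 - C ^+ 2.
  by rewrite /C sqrrN; have := cos2Dsin2 (2 * q.2); nra.
have d2 : d ^+ 2 = 4 - C ^+ 2 by rewrite sqr_sqrtr // ltW.
have d0 : d != 0 by rewrite gt_eqF // sqrtr_gt0.
rewrite tau31E /= -/C -/d /sphere4 /dot !big_ord_recl !big_ord0 !mxE /=.
split; last by field.
have := cos2Dsin2 (2 * q.2); have := cos2Dsin2 (2 * q.1); have := cos2Dsin2 (4 * q.1).
rewrite -(sqrrN (sin (2 * q.2))) -/C; move: (cos _) (sin _) (cos (2 * q.1)) (sin (2 * q.1)).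
move=> c4 n4 c2 n2 H4 H2 HS.
apply: (@mulIf _ (d ^+ 2)); first by rewrite expf_neq0.
transitivity ((5 * cos (2 * q.2) ^+ 2 + s3 ^+ 2 * (c4 ^+ 2 + n4 ^+ 2) + s3 ^+ 2 * C ^+ 2 * (c2 ^+ 2 + n2 ^+ 2)) / 2).
  by field.
rewrite H4 H2 s3_sqr d2 (_ : cos (2 * q.2) ^+ 2 = 1 - C ^+ 2); last by rewrite -[X in X - _]HS addrK.
by field.
Qed.

Lemma alternatingz (f : R -> R) (T : R) : alternating f T ->
  forall (k : int) x, f (x + k%:~R * T) = (-1) ^ k * f x.
Proof.
move=> fT [n|n] x; first by rewrite mulrzl -pmulrn alternatingn.
have := alternatingn fT n.+1 (x - T *+ n.+1); rewrite subrK => ->.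
rewrite NegzE mulrzl mulrNz -pmulrn mulrA.
have -> : (-1) ^ (- n.+1%:Z) = (-1) ^+ n.+1 :> R by rewrite -exprz_inv invrN1.
by rewrite -expr2 sqrr_sign mul1r.
Qed.

Lemma signz_sqr (k : int) : (-1) ^ k * (-1) ^ k = 1 :> R.
Proof. by rewrite -expfzMl mulrNN mulr1 exp1rz. Qed.

Lemma cosD2piz (l : int) x : cos (x + l%:~R * (2 * pi)) = cos x.
Proof.
rewrite (_ : _ * (2 * pi) = (l + l)%:~R * pi); last by rewrite intrD; ring.
by rewrite (alternatingz (@cosDpi R)) expfzDr ?oppr_eq0 ?oner_eq0// signz_sqr mul1r.
Qed.

Lemma sinD2piz (l : int) x : sin (x + l%:~R * (2 * pi)) = sin x.
Proof.
rewrite (_ : _ * (2 * pi) = (l + l)%:~R * pi); last by rewrite intrD; ring.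
by rewrite (alternatingz (@sinDpi R)) expfzDr ?oppr_eq0 ?oner_eq0// signz_sqr mul1r.
Qed.

Lemma cos_sin_inj x y : cos x = cos y -> sin x = sin y ->
  exists l : int, y = x + l%:~R * (2 * pi).
Proof.
move=> cxy sxy.
have pi2 : 0 < 2 * pi :> R by rewrite mulr_gt0 ?pi_gt0.
set v := (y - x) / (2 * pi); pose l := Num.floor v; exists l.
pose z := y - x - l%:~R * (2 * pi).
have yxE : y - x = v * (2 * pi) by rewrite /v divfK ?gt_eqF.
have z0 : 0 <= z by rewrite /z yxE -mulrBl mulr_ge0 ?subr_ge0 ?floor_le // ltW.
have z1 : z < 2 * pi.
  rewrite /z yxE -mulrBl gtr_pMl //.
  by have := Num.Theory.floorD1_gt v; rewrite intrD -/l; lra.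
have cz : cos z = 1.
  by rewrite -(cosD2piz l) subrK cosB cxy sxy -!expr2 cos2Dsin2.
suff z00 : z = 0 by rewrite -[LHS](subrK x) -(subrK (l%:~R * (2 * pi)) (y - x)) -/z z00 add0r addrC.
apply/eqP; rewrite eq_le z0 andbT leNgt; apply/negP => z_gt0.
have : 0 < sin (z / 2).
  by apply: sin_gt0_pi; rewrite divr_gt0 //= ltr_pdivrMr // mulrC.
have : cos z = 1 - 2 * sin (z / 2) ^+ 2.
  rewrite -[in LHS](_ : z / 2 + z / 2 = z); last by field.
  by rewrite cosD -!expr2 cos2sin2; ring.
by rewrite cz; nra.
Qed.

(* Hence tau31 induces an injection of the Klein bottle into S^4, whose image
   is that of bipolar31 by range_tau31 below. *)
Lemma tau31_eq p q : tau31 p = tau31 q <-> klein_equiv p q.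
Proof.
have dpos (C S : R) : C ^+ 2 + S ^+ 2 = 1 -> 0 < 4 - C ^+ 2 by nra.
split; last first.
  case: p q => x t [x' t'] [k [l [-> ->]]] /=.
  have ce : (-1) ^ k = 1 :> R \/ (-1) ^ k = -1 :> R.
    have /eqP := signz_sqr k; rewrite -expr2 sqrf_eq1 => /orP[/eqP e|/eqP e]; [by left|by right].
  have [Cu Su] : cos (2 * ((-1) ^ k * t + l%:~R * pi)) = cos (2 * t) /\ sin (2 * ((-1) ^ k * t + l%:~R * pi)) = (-1) ^ k * sin (2 * t).
    rewrite (_ : 2 * _ = 2 * ((-1) ^ k * t) + l%:~R * (2 * pi)); last by ring.
    rewrite cosD2piz sinD2piz; case: ce => ->; rewrite ?mul1r // !mulN1r mulrN.
    by rewrite cosN sinN.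
  rewrite !tau31E /= Cu Su.
  rewrite (_ : 4 * (x + _) = 4 * x + k%:~R * (2 * pi)); last by field.
  rewrite (_ : 2 * (x + _) = 2 * x + k%:~R * pi); last by field.
  rewrite cosD2piz sinD2piz (alternatingz (@cosDpi R)) (alternatingz (@sinDpi R)).
  by case: ce => ->; rewrite ?mul1r // !mulN1r ?opprK ?sqrrN !mulrN !mulNr ?mulrN ?opprK.
case: p q => x t [x' t']; rewrite !tau31E /= => /rowP E.
have := E (inord 0); have := E (inord 1); have := E (inord 2).
have := E (inord 3); have := E (inord 4); rewrite !mxE !inordK //= {E}.
set C := - sin (2 * t); set C' := - sin (2 * t').
set d := Num.sqrt _; set d' := Num.sqrt _.
have HC := cos2Dsin2 (2 * t); have HC' := cos2Dsin2 (2 * t').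
rewrite -(sqrrN (sin _)) -/C in HC; rewrite -(sqrrN (sin _)) -/C' in HC'.
have d_gt0 : 0 < d by rewrite sqrtr_gt0; apply: (dpos _ (cos (2 * t))); rewrite addrC.
have d'_gt0 : 0 < d' by rewrite sqrtr_gt0; apply: (dpos _ (cos (2 * t'))); rewrite addrC.
have d2 : d ^+ 2 = 4 - C ^+ 2.
  by rewrite sqr_sqrtr // ltW // (dpos _ (cos (2 * t))) // addrC.
have d'2 : d' ^+ 2 = 4 - C' ^+ 2.
  by rewrite sqr_sqrtr // ltW // (dpos _ (cos (2 * t'))) // addrC.
have d0 : d != 0 by rewrite gt_eqF.
have d'0 : d' != 0 by rewrite gt_eqF.
have s0 : s3 != 0 by rewrite gt_eqF.
move=> E4 E3 E2 E1 E0.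
have SE : cos (2 * t) * d' = cos (2 * t') * d.
  apply: (@mulIf _ (- (2 * d * d')^-1)).
    by rewrite oppr_eq0 invr_eq0 !mulf_neq0 ?pnatr_eq0.
  transitivity (- (cos (2 * t) / 2 / d)); first by field; rewrite d0 d'0.
  by rewrite E0; field; rewrite d0 d'0.
have S2 : cos (2 * t) ^+ 2 = cos (2 * t') ^+ 2.
  have := congr1 (fun z => z ^+ 2) SE; rewrite !exprMn d2 d'2.
  have -> : C ^+ 2 = 1 - cos (2 * t) ^+ 2 by rewrite -[X in X - _]HC addrC addKr.
  have -> : C' ^+ 2 = 1 - cos (2 * t') ^+ 2 by rewrite -[X in X - _]HC' addrC addKr.
  by lra.
have dd : d' = d.
  by congr Num.sqrt; congr (_ - _); move: HC HC'; rewrite S2; lra.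
have St : cos (2 * t) = cos (2 * t') by apply: (mulIf d0); rewrite -{1}dd.
rewrite dd in E1 E2 E3 E4.
have P0 : s3 / d != 0 by rewrite mulf_neq0 // invr_eq0.
have s4 : sin (4 * x) = sin (4 * x').
  by apply: (mulfI P0); move: E1 E4; lra.
have c4 : cos (4 * x) = cos (4 * x').
  by apply: (mulfI P0); move: E2 E3; lra.
have [k kE] := cos_sin_inj c4 s4.
have xE : x' = x + k%:~R * (pi / 2).
  by apply: (@mulfI _ 4); [rewrite pnatr_eq0 | rewrite kE; field].
have x2E : 2 * x' = 2 * x + k%:~R * pi by rewrite xE; field.
have s2 : C * sin (2 * x) = C' * sin (2 * x').
  by apply: (mulfI P0); move: E1 E4; lra.
have c2 : C * cos (2 * x) = C' * cos (2 * x').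
  by apply: (mulfI P0); move: E2 E3; lra.
rewrite x2E (alternatingz (@sinDpi R)) in s2.
rewrite x2E (alternatingz (@cosDpi R)) in c2.
have CE : C = (-1) ^ k * C'.
  rewrite -[LHS]mulr1 -(cos2Dsin2 (2 * x)).
  transitivity (C * cos (2 * x) * cos (2 * x) + C * sin (2 * x) * sin (2 * x)).
    by ring.
  rewrite s2 c2.
  transitivity ((-1) ^ k * C' * (cos (2 * x) ^+ 2 + sin (2 * x) ^+ 2)).
    by ring.
  by rewrite cos2Dsin2 mulr1.
have ce : (-1) ^ k = 1 :> R \/ (-1) ^ k = -1 :> R.
  have /eqP := signz_sqr k.
  by rewrite -expr2 sqrf_eq1 => /orP[/eqP e|/eqP e]; [left|right].
have [|| l lE] := @cos_sin_inj ((-1) ^ k * (2 * t)) (2 * t').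
- by case: ce => ->; rewrite ?mul1r // mulN1r cosN.
- move: CE; rewrite /C /C'; case: ce => ->; rewrite ?mul1r ?mulN1r ?sinN => ?; lra.
exists k, l; congr pair; first by [].
apply: (@mulfI _ 2); first by rewrite pnatr_eq0.
by rewrite lE /=; ring.
Qed.

Lemma continuous_rho : continuous (@rho R).
Proof.
have cw : continuous (fun t : R => t + pi / 4).
  by move=> t; apply: cvgD; [exact: cvg_id | exact: cvg_cst].
have cs : continuous (fun t : R => sin (t + pi / 4)).
  by move=> t; apply: continuous_comp; [exact: cw | exact: continuous_sin].
have cc : continuous (fun t : R => cos (t + pi / 4)).
  by move=> t; apply: continuous_comp; [exact: cw | exact: continuous_cos].
move=> t; apply: cvgD; first exact: cw.
pose g t : R := (s3 - 1) * sin (t + pi / 4) * cos (t + pi / 4)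
  / (cos (t + pi / 4) ^+ 2 + s3 * sin (t + pi / 4) ^+ 2).
apply: (@continuous_comp _ _ _ g (@atan R)); last exact: continuous_atan.
rewrite /g; apply: cvgM.
  by apply: cvgM; [apply: cvgM; [exact: cvg_cst | exact: cs] | exact: cc].
apply: cvgV; first by rewrite gt_eqF // rho_den_gt0.
have sqr_cont (f : R -> R) : continuous f -> continuous (fun u => f u ^+ 2).
  by move=> cf u; apply: (@continuous_comp _ _ _ f (fun v => v ^+ 2)); [exact: cf | exact: exprn_continuous].
apply: cvgD; first exact: (sqr_cont _ cc).
by apply: cvgM; [exact: cvg_cst | exact: (sqr_cont _ cs)].
Qed.

Lemma rho_surj y : exists t, rho t = y.
Proof.
have pi0 := @pi_gt0 R.
have rho_lt t : t - pi < rho t < t + pi.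
  rewrite /rho; set a := atan _.
  have : - (pi / 2) < a := atan_gtNpi2 _; have : a < pi / 2 := atan_ltpi2 _.
  by move=> ? ?; apply/andP; split; lra.
have /andP[_ l1] := rho_lt (y - pi); have /andP[l2 _] := rho_lt (y + pi).
have [||| t _ tE] := @IVT R (@rho R) (y - pi) (y + pi) y; last by exists t.
- lra.
- exact/continuous_subspaceT/continuous_rho.
by rewrite ge_min le_max; apply/andP; split; apply/orP; [left|right]; lra.
Qed.

Lemma range_tau31 : range (@tau31 R) = range (@bipolar31 R).
Proof.
apply/seteqP; split => _ [[x y] _ <-]; first by exists (x, rho y).
by have [t <-] := rho_surj y; exists (x, t).
Qed.

End Fibres.

(* Main.v *)
(* Let K carry the flat metric dx^2 + dt^2 / kd(t)^2, which is conformal to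
   the bipolar surface.  For f conformal to h, a centre c and a scale s > 0, the
   Li-Yau identity writes W(f) as the area of the stereographic lift of (f - c) / sqrt s
   to the unit sphere plus a nonnegative defect.  Hersch's balancing argument, here
   a minimisation of a logarithmic functional over (c, s), makes the coordinates of
   the lift orthogonal to constants for the weight of the metric of the bipolar
   surface.  Fourier analysis in x and Sturm comparison in t show that the first
   eigenvalue of that metric is 2, so that the area is at least that of the bipolar
   surface.  In the equality case the coordinates are first eigenfunctions, which
   form a space of dimension 5; the lift having norm 1 and being conformal, its Gram
   matrix is that of the bipolar surface, so the two lifts differ by a product of
   reflections, and reflections of the sphere are Moebius transformations. *)
Require Import Defs.
From mathcomp Require Import all_boot all_order all_algebra.
From mathcomp Require Import all_classical all_reals all_analysis.
From mathcomp Require Import measurable_realfun.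
From mathcomp Require Import ring lra.

Set Implicit Arguments.
Unset Strict Implicit.
Unset Printing Implicit Defensive.

Import Order.TTheory GRing.Theory Num.Theory.
Import numFieldNormedType.Exports.

Local Open Scope classical_set_scope.
Local Open Scope ring_scope.

(** * Integrals of continuous functions *)

(** Conformality makes the Dirichlet energies of the coordinates of a lift add up to twice its area,
    and unit norm makes their weighted squares add up to the area of the bipolar surface: this is
    how an eigenvalue bounds an area. The value 2 is dictated by minimality, since the coordinates
    of a minimal surface of a unit sphere are eigenfunctions for 2. No spectral theory shows that
    nothing nonconstant lies below: in each sector cut out by the glide reflection an explicit
    eigenfunction [w] is known, and completing the square in [u / w] gives the inequality together
    with its equality case. The obstacle is that [w] may vanish; [u] then has to vanish at the same
    points, by symmetry or after subtraction of a constant that the mean condition controls. In the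
    balancing, the obstacle is a lower bound for the logarithm that is uniform in the centre and in
    small scales; it holds because an immersion expands some coordinate along every short arc in the
    x direction. Integrals are increments of primitives; Lebesgue integrals serve only to construct
    primitives and to read [willmore] and [ellipticE]. *)

Lemma continuous_bigsum (R : realType) (T : topologicalType) (I : Type) (r : seq I)
    (f : I -> T -> R) :
  (forall i, continuous (f i)) -> continuous (fun x => \sum_(i <- r) f i x).
Proof.
move=> cf x; elim: r => [|i r IH].
  rewrite (_ : (fun _ => _) = fun=> 0); last by apply/funext => y; rewrite big_nil.
  exact: cvg_cst.
rewrite (_ : (fun _ => _) = fun y => f i y + \sum_(j <- r) f j y); last first.
  by apply/funext => y; rewrite big_cons.
by apply: cvgD IH; exact: cf.
Qed.

Section OneVariable.
Variable R : realType.
Implicit Types (f g F G : R -> R) (a b c x y : R).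

Lemma derive1_continuous F (df : R -> R) :
  (forall x, is_derive x 1 F (df x)) -> continuous F.
Proof.
move=> dF x; apply: differentiable_continuous; apply/derivable1_diffP.
exact: ex_derive.
Qed.

Lemma mean_value F (df : R -> R) a b : a < b ->
  (forall x, a < x < b -> is_derive x 1 F (df x)) ->
  (forall x, a <= x <= b -> {for x, continuous F}) ->
  exists2 c, a < c < b & F b - F a = df c * (b - a).
Proof.
move=> ab dF cF.
have dF' x : x \in `]a, b[%R -> is_derive x 1 F (df x) by rewrite in_itv; exact: dF.
have cF' : {within `[a, b], continuous F}.
  by apply: continuous_in_subspaceT => x /set_mem /=; rewrite in_itv /=; exact: cF.
by have [c cab E] := MVT ab dF' cF'; exists c.
Qed.

Lemma derive1_eq0_cst F a b :
  (forall x, a < x < b -> is_derive x 1 F 0) ->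
  forall x y, a < x < b -> a < y < b -> F x = F y.
Proof.
move=> dF; suff H x y : a < x < b -> a < y < b -> x < y -> F x = F y.
  move=> x y xab yab; have [xy|yx|->//] := ltgtP x y; first exact: H.
  by symmetry; exact: H.
move=> /andP[ax _] /andP[_ yb] xy.
have dF' z : x <= z <= y -> is_derive z 1 F 0.
  by move=> /andP[xz zy]; apply: dF; rewrite (lt_le_trans ax xz) (le_lt_trans zy yb).
have [||c _ /eqP] := @mean_value F (fun=> 0) x y xy.
- by move=> z /andP[xz zy]; apply: dF'; rewrite !ltW.
- move=> z /dF' zd; apply: differentiable_continuous; apply/derivable1_diffP.
  exact: ex_derive.
by rewrite mul0r subr_eq0 => /eqP.
Qed.

Lemma derive1_eq_diff F G (df : R -> R) :
  (forall x, is_derive x 1 F (df x)) -> (forall x, is_derive x 1 G (df x)) ->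
  forall a b, F b - F a = G b - G a.
Proof.
move=> dF dG a b.
have dH x : is_derive x 1 (F - G) 0 by apply: is_derive_eq; rewrite subrr.
pose m := `|a| + `|b| + 1.
have := @derive1_eq0_cst (F - G) (- m) m (fun x _ => dH x) a b.
rewrite -!ltr_norml /m !fctE => H.
have /H : `|a| < `|a| + `|b| + 1 by have := normr_ge0 b; lra.
have /[swap]/[apply] : `|b| < `|a| + `|b| + 1 by have := normr_ge0 a; lra.
lra.
Qed.

Lemma antiderivative_locally f a b : a < b -> continuous f ->
  exists F, forall x, a < x < b -> is_derive x 1 F (f x).
Proof.
move=> ab cf; exists (fun x => \int[lebesgue_measure]_(t in `[a, x]) f t).
move=> x /andP[ax xb].
have [] := @continuous_FTC1_closed R f a x b xb _ ax (cf x).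
  apply: continuous_compact_integrable; first exact: segment_compact.
  exact: continuous_subspaceT.
by move=> d1; rewrite derive1E => <-; exact: derivableP.
Qed.

(** Primitives on the intervals of radius [|N| + 1], normalised at 0, agree on overlaps and glue to
    a global one. *)
Lemma antiderivative f : continuous f ->
  exists F, forall x, is_derive x 1 F (f x).
Proof.
move=> cf.
have /choice[F dF] : forall N : R, exists F, forall x, `|x| < `|N| + 1 -> is_derive x 1 F (f x).
  move=> N; have [F dF] := @antiderivative_locally f (- (`|N| + 1)) (`|N| + 1)
    ltac:(have := normr_ge0 N; lra) cf.
  by exists F => x; rewrite ltr_norml; exact: dF.
have FE N N' x : `|x| < `|N| + 1 -> `|x| < `|N'| + 1 -> F N x - F N 0 = F N' x - F N' 0.
  move=> xN xN'; pose m := Num.min (`|N| + 1) (`|N'| + 1).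
  have dH y : - m < y < m -> is_derive y 1 (F N - F N') 0.
    rewrite -ltr_norml lt_min => /andP[yN yN'].
    have := dF _ _ yN; have := dF _ _ yN' => ? ?.
    by apply: is_derive_eq; rewrite subrr.
  have m0 : 0 < m by rewrite lt_min !ltr_wpDl.
  have := derive1_eq0_cst dH (x := x) (y := 0).
  rewrite -!ltr_norml lt_min xN xN' normr0 m0 !fctE => /(_ isT isT); lra.
(* Diagonal choice: the primitive indexed by [x] itself is valid on a neighbourhood of [x]. *)
exists (fun x => F x x - F x 0) => x.
have xE : `| `|x| + 1| = `|x| + 1 by rewrite ger0_norm // addr_ge0.
have Fx : is_derive x 1 (fun y => F (`|x| + 1) y - F (`|x| + 1) 0) (f x).
  have dx : is_derive x 1 (F (`|x| + 1)) (f x).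
    by apply: dF; rewrite xE; lra.
  by apply: is_derive_eq; rewrite subr0.
apply: near_eq_is_derive Fx; near=> y; apply: FE; last by rewrite ltrDl.
rewrite xE; near: y.
by apply: (cvgr_norm_lt x); [exact: cvg_id | lra].
Unshelve. all: by end_near. Qed.

(** A signed integral, meaningful also for [b < a]: the increment of any primitive, and 0 when there
    is none. The rules of integration thereby reduce to differentiation. *)
Definition itg a b f : R :=
  xget 0 [set v | exists2 F, forall x, is_derive x 1 F (f x) & v = F b - F a].

Lemma itgE F f a b : (forall x, is_derive x 1 F (f x)) -> itg a b f = F b - F a.
Proof.
move=> dF; rewrite /itg; case: xgetP => [v _ [G dG ->]|/(_ (F b - F a)) H].
  exact: derive1_eq_diff dG dF a b.
by exfalso; apply: H; exists F.
Qed.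

Lemma is_derive_itg f a x : continuous f -> is_derive x 1 (fun y => itg a y f) (f x).
Proof.
move=> /antiderivative[F dF].
have -> : (fun y => itg a y f) = F - cst (F a) by apply/funext => y; rewrite (itgE _ _ dF).
by apply: is_derive_eq; rewrite subr0.
Qed.

Lemma itg_cst a b c : itg a b (fun=> c) = c * (b - a).
Proof.
have dF x : is_derive x (1:R) (c *: (id : R -> R)) c.
  by apply: is_derive_eq; rewrite scaler1.
by rewrite (itgE _ _ dF) !fctE /GRing.scale /= mulrBr.
Qed.

Lemma itg_refl f a : itg a a f = 0.
Proof. by rewrite /itg; case: xgetP => [v _ [F _ ->]|//]; rewrite subrr. Qed.

Lemma itgZ c f a b : continuous f -> itg a b (fun x => c * f x) = c * itg a b f.
Proof.
move=> /antiderivative[F dF].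
have dcF x : is_derive x 1 (c *: F) (c * f x) by apply: is_derive_eq.
by rewrite (itgE _ _ dF) (itgE _ _ dcF) mulrBr.
Qed.

Lemma itgD f g a b : continuous f -> continuous g ->
  itg a b (fun x => f x + g x) = itg a b f + itg a b g.
Proof.
move=> /antiderivative[F dF] /antiderivative[G dG].
have dFG x : is_derive x 1 (F + G) (f x + g x) by exact: is_deriveD.
by rewrite (itgE _ _ dF) (itgE _ _ dG) (itgE _ _ dFG) !fctE; ring.
Qed.

Lemma itgB f g a b : continuous f -> continuous g ->
  itg a b (fun x => f x - g x) = itg a b f - itg a b g.
Proof.
move=> /antiderivative[F dF] /antiderivative[G dG].
have dFG x : is_derive x 1 (F - G) (f x - g x) by exact: is_deriveB.
by rewrite (itgE _ _ dF) (itgE _ _ dG) (itgE _ _ dFG) !fctE; ring.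
Qed.

Lemma itg_cat f a b c : continuous f -> itg a b f + itg b c f = itg a c f.
Proof. by move=> /antiderivative[F dF]; rewrite !(itgE _ _ dF); ring. Qed.

Lemma itg_shift f a b c : continuous f ->
  itg a b (fun x => f (x + c)) = itg (a + c) (b + c) f.
Proof.
move=> /antiderivative[F dF].
have dG x : is_derive x 1 (fun y => F (y + c)) (f (x + c)).
  have := @is_derive1_comp _ F (fun y => y + c) x (f (x + c)) 1 (dF _).
  rewrite mulr1; apply.
  by apply: is_derive_eq; rewrite addr0.
by rewrite (itgE _ _ dF) (itgE _ _ dG).
Qed.

Lemma itg_opp f a b : continuous f ->
  itg a b (fun x => f (- x)) = itg (- b) (- a) f.
Proof.
move=> /antiderivative[F dF].
have dG x : is_derive x 1 (- (F \o -%R)) (f (- x)).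
  have := @is_derive1_comp _ F -%R x (f (- x)) (-1) (dF _) _ => H.
  by apply: is_derive_eq; rewrite mulrN1 opprK.
by rewrite (itgE _ _ dF) (itgE _ _ dG) !fctE /=; ring.
Qed.

Lemma itg_periodic f T a : continuous f -> (forall x, f (x + T) = f x) ->
  itg a (a + T) f = itg 0 T f.
Proof.
move=> cf fT; have := itg_shift 0 a T cf.
rewrite add0r (_ : (fun x => f (x + T)) = f); last exact/funext.
have := itg_cat 0 a (a + T) cf; have := itg_cat 0 T (a + T) cf; lra.
Qed.

Lemma itg_ge0 f a b : a <= b -> continuous f ->
  (forall x, a <= x <= b -> 0 <= f x) -> 0 <= itg a b f.
Proof.
rewrite le_eqVlt => /predU1P[<-|ab] cf f0; first by rewrite itg_refl.
have [F dF] := antiderivative cf.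
have [c /andP[ac cb] E] := mean_value ab (fun x _ => dF x) (fun x _ => @derive1_continuous _ _ dF x).
by rewrite (itgE _ _ dF) E mulr_ge0 ?f0 ?subr_ge0 ?(ltW ab) ?(ltW ac) ?(ltW cb).
Qed.

Lemma le_itg f g a b : a <= b -> continuous f -> continuous g ->
  (forall x, a <= x <= b -> f x <= g x) -> itg a b f <= itg a b g.
Proof.
move=> ab cf cg fg; rewrite -subr_ge0 -itgB //; apply: itg_ge0 => //.
  by move=> x; apply: cvgB; [exact: cg | exact: cf].
by move=> x xab; rewrite subr_ge0 fg.
Qed.

Lemma itg_norm_le f a b e : a <= b -> continuous f ->
  (forall x, a <= x <= b -> `|f x| <= e) -> `|itg a b f| <= e * (b - a).
Proof.
move=> ab cf fe; rewrite ler_norml -mulNr -!itg_cst; apply/andP; split;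
  by apply: le_itg => //; do ?exact: cst_continuous; move=> x /fe; rewrite ler_norml => /andP[].
Qed.

Lemma itg_eq0 f a b : a < b -> continuous f ->
  (forall x, a <= x <= b -> 0 <= f x) -> itg a b f = 0 ->
  forall x, a < x < b -> f x = 0.
Proof.
move=> ab cf f0 I0 x xab; have [F dF] := antiderivative cf.
have cF := derive1_continuous dF.
have Fincr y z : a <= y -> z <= b -> y <= z -> F y <= F z.
  move=> ay zb yz; rewrite -subr_ge0 -(itgE _ _ dF); apply: itg_ge0 => // t /andP[yt tz].
  by rewrite f0 // (le_trans ay yt) (le_trans tz zb).
have Fa y : a <= y <= b -> F y = F a.
  move=> /andP[ay yb]; apply/eqP; rewrite eq_le (Fincr a y) // andbT.
  by have := Fincr y b ay (lexx b) yb; move: I0; rewrite (itgE _ _ dF); lra.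
have : is_derive x 1 F 0.
  apply: (@near_eq_is_derive _ _ _ (cst (F a))).
  near=> y; rewrite Fa //.
  have : y \in `]a, b[ by near: y; apply: near_in_itvoo; rewrite in_itv.
  by rewrite in_itv /= => /andP[/ltW-> /ltW->].
by case: (dF x) => _ <- [_ <-].
Unshelve. all: by end_near. Qed.

Lemma Rintegral_itg f a b : a <= b -> continuous f ->
  \int[lebesgue_measure]_(x in `[a, b]) f x = itg a b f.
Proof.
rewrite le_eqVlt => /predU1P[<-|ab] cf.
  by rewrite /Rintegral set_itv1 integral_set1 itg_refl.
have [F dF] := antiderivative cf; rewrite /Rintegral.
have cF := derive1_continuous dF.
rewrite (@continuous_FTC2 _ _ F _ _ ab); first 1 last.
- exact: continuous_subspaceT.
- split; first by move=> x _; exact: ex_derive.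
  + by apply: cvg_at_right_filter; exact: cF.
  + by apply: cvg_at_left_filter; exact: cF.
- by move=> x _; rewrite derive1E; case: (dF x).
by rewrite -EFinB /= (itgE _ _ dF).
Qed.

End OneVariable.

(** * Integrals with parameters and iterated integrals *)

Section Lebesgue.
Variable R : realType.
Implicit Types (F : R * R -> R) (a b c d x y : R).
Notation mu := (@lebesgue_measure R).

(** Second countability: an open set is the union of the rational open rectangles that it contains;
    the other rectangles are replaced by the empty set. *)
Lemma open_measurable2 (O : set (R * R)) : open O ->
  measurable (O : set (measurableTypeR R * measurableTypeR R)).
Proof.
move=> oO.
pose rect (q : (rat * rat) * (rat * rat)) : set (R * R) :=
  `]ratr q.1.1, ratr q.1.2[ `*` `]ratr q.2.1, ratr q.2.2[.
have -> : O = \bigcup_(q in setT) (if `[< rect q `<=` O >] then rect q else set0).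
  apply/seteqP; split=> [[x y] Oxy|z [q _]]; last by case: asboolP => // qO /qO.
  have /nbhs_ballP[e /= e0 eO] : nbhs (x, y) O by exact: open_nbhs_nbhs.
  have [q1 H1] := @rat_in_itvoo R (x - e) x ltac:(lra).
  have [q2 H2] := @rat_in_itvoo R x (x + e) ltac:(lra).
  have [q3 H3] := @rat_in_itvoo R (y - e) y ltac:(lra).
  have [q4 H4] := @rat_in_itvoo R y (y + e) ltac:(lra).
  move: H1 H2 H3 H4; rewrite !in_itv /= => /andP[? ?] /andP[? ?] /andP[? ?] /andP[? ?].
  exists ((q1, q2), (q3, q4)) => //=.
  case: asboolP => [_|[]]; rewrite /rect /= ?in_itv /=.
    by split; apply/andP.
  move=> [z t] [/=]; rewrite !in_itv /= => /andP[? ?] /andP[? ?]; apply: eO.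
  by split => /=; rewrite /ball /= ltr_norml; apply/andP; split; lra.
apply: countable_bigcupT_measurable; first exact: countableP.
move=> q; case: asboolP => _; last exact: measurable0.
by apply: measurableX; exact: measurable_itv.
Qed.

Lemma continuous_measurable_fun2 F : continuous F ->
  measurable_fun setT (F : measurableTypeR R * measurableTypeR R -> R).
Proof.
move=> /continuousP cF; apply: (measurability _ (RGenOpens.measurableE R)).
move=> _ [_ [a [b ->] <-]]; rewrite setTI; apply: open_measurable2.
exact/cF/interval_open.
Qed.

Lemma continuous_pair1 F x : continuous F -> continuous (fun y => F (x, y)).
Proof.
move=> cF y; apply: (@continuous_comp _ _ _ (fun y => (x, y)) F); last exact: cF.
by apply: (@cvg_pair _ _ _ (nbhs y) (nbhs x) (nbhs y) _ _ _ (fun=> x) id); [exact: cvg_cst | exact: cvg_id].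
Qed.

Lemma continuous_pair2 F y : continuous F -> continuous (fun x => F (x, y)).
Proof.
move=> cF x; apply: (@continuous_comp _ _ _ (fun x => (x, y)) F); last exact: cF.
by apply: (@cvg_pair _ _ _ (nbhs x) (nbhs x) (nbhs y) _ _ _ id (fun=> y)); [exact: cvg_id | exact: cvg_cst].
Qed.

(* The tube lemma, from the compactness of [a, b]. *)
Lemma near_uniform (T : topologicalType) (F : T -> R -> R) a b (z : T) e : 0 < e ->
  (forall y, a <= y <= b -> {for (z, y), continuous (fun q => F q.1 q.2)}) ->
  \forall x \near z, forall y, a <= y <= b -> `|F x y - F z y| <= e.
Proof.
move=> e0 cF2.
have /compact_near_coveringP nc := @segment_compact R a b.
suff : \forall x \near z, `[a, b] `<=` [set y | `|F x y - F z y| <= e].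
  by apply: filterS => x H y yab; apply: H; rewrite /= in_itv.
have := nc T (nbhs z) (fun (x : T) (y : R) => `|F x y - F z y| <= e). apply.
  move=> y /=; rewrite in_itv /= => yab.
  have /cvgrPdist_lt /(_ (e / 2)) : {for (z, y), continuous (fun q => F q.1 q.2)} by exact: cF2.
  rewrite divr_gt0 // => /(_ isT) [[U V] /= [Uz Vy] UV].
  exists (V, U) => //= -[y' x'] [/= Vy' Ux'].
  have := UV (x', y') (conj Ux' Vy'); have := UV (z, y') (conj (nbhs_singleton Uz) Vy').
  move=> /= H2 H1; rewrite distrC in H1.
  rewrite -(subrKA (F z y)) (splitr e).
  by apply: (le_trans (ler_normD _ _)); apply: lerD; exact: ltW.
Qed.

Lemma itg_continuous_at (T : topologicalType) (F : T -> R -> R) a b (z : T) : a <= b ->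
  (\forall x \near z, continuous (F x)) ->
  (forall y, a <= y <= b -> {for (z, y), continuous (fun q => F q.1 q.2)}) ->
  {for z, continuous (fun x : T => itg a b (F x))}.
Proof.
move=> ab cF cF2; apply/cvgrPdist_le => e e0.
have b0 : 0 < b - a + 1 by rewrite ltr_wpDl // subr_ge0.
pose e' := e / (b - a + 1).
have e'0 : 0 < e' by rewrite divr_gt0.
have near_e := @near_uniform T F a b z e' e'0 cF2.
have cFz : continuous (F z) := nbhs_singleton cF.
near=> x.
have cFx : continuous (F x) by near: x.
rewrite -itgB //; apply: (@le_trans _ _ (e' * (b - a))).
  apply: itg_norm_le => //.
    by move=> y; apply: cvgB; [exact: cFz|exact: cFx].
  by move=> y yab; rewrite distrC; move: y yab; near: x.
rewrite /e' mulrAC ler_pdivrMr // ler_pM2l //; lra.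
Unshelve. all: by end_near. Qed.

Lemma itg_continuous_param (T : topologicalType) (F : T * R -> R) a b : a <= b ->
  continuous F -> continuous (fun z : T => itg a b (fun y => F (z, y))).
Proof.
move=> ab cF z; apply: (@itg_continuous_at T (fun w y => F (w, y)) a b z ab).
  near=> w; move=> y; apply: (@continuous_comp _ _ _ (fun y => (w, y)) F); last exact: cF.
  by apply: (@cvg_pair _ _ _ (nbhs y) (nbhs w) (nbhs y) _ _ _ (fun=> w) id); [exact: cvg_cst | exact: cvg_id].
move=> y _; rewrite (_ : (fun _ => _) = F) ?cF //; first exact: cF.
by apply/funext => -[].
Unshelve. all: by end_near. Qed.

Lemma itg_continuous F a b : a <= b -> continuous F ->
  continuous (fun x => itg a b (fun y => F (x, y))).
Proof. exact: itg_continuous_param. Qed.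

Lemma continuous_swap F : continuous F -> continuous (fun q => F (q.2, q.1)).
Proof.
move=> cF q; apply: (@continuous_comp _ _ _ (fun q => (q.2, q.1)) F); last exact: cF.
by apply: (@cvg_pair _ _ _ (nbhs q) (nbhs q.2) (nbhs q.1) _ _ _ snd fst); [exact: cvg_snd | exact: cvg_fst].
Qed.

Lemma itg_continuous' F a b : a <= b -> continuous F ->
  continuous (fun y => itg a b (fun x => F (x, y))).
Proof. by move=> ab cF; exact: (itg_continuous ab (continuous_swap cF)). Qed.

Lemma mean_value_le (f df : R -> R) l e a b :
  (forall x, is_derive x 1 f (df x)) ->
  (forall x, `|x - a| <= `|b - a| -> `|df x - l| <= e) ->
  `|f b - f a - (b - a) * l| <= e * `|b - a|.
Proof.
move=> dF; have cF := derive1_continuous dF.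
have mv x y : x < y -> exists2 c, x < c < y & f y - f x = df c * (y - x).
  by move=> xy; exact: (mean_value xy (fun x _ => dF x) (fun x _ => @cF x)).
move=> H; have [ab|ba|->] := ltgtP a b; last by rewrite !subrr mul0r subrr normr0 mulr0.
- have [c /andP[ac cb] ->] := mv _ _ ab.
  rewrite (mulrC (b - a)) -mulrBl normrM ler_wpM2r // H // !gtr0_norm ?subr_gt0 //; lra.
- have [c /andP[ac cb] E] := mv _ _ ba.
  have -> : f b - f a = df c * (b - a) by move: E; lra.
  rewrite (mulrC (b - a)) -mulrBl normrM ler_wpM2r // H // !ltr0_norm ?subr_lt0 //; lra.
Qed.

Lemma is_derive_littleo (f : R -> R) x l :
  (forall e, 0 < e -> \forall y \near x, `|f y - f x - (y - x) * l| <= e * `|y - x|) ->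
  is_derive x 1 f l.
Proof.
move=> H.
have C : (fun h => h^-1 *: (f (h *: 1 + x) - f x)) @ 0^' --> l.
  apply/cvgrPdist_le => e e0; have /nbhs_ballP[d /= d0 Hd] := H e e0.
  near=> h.
  have h0 : h != 0 by near: h; exact: nbhs_dnbhs_neq.
  have hd : `|h| < d by near: h; exact: dnbhs0_lt.
  have := Hd (h *: 1 + x); rewrite /ball /= opprD addrCA subrr addr0 normrN.
  rewrite /GRing.scale /= mulr1 addrK => /(_ hd) Hh.
  rewrite distrC -(ler_pM2r (_ : 0 < `|h|)) ?normr_gt0 // -normrM mulrBl (mulrAC h^-1) mulVf //.
  by rewrite mul1r (mulrC l).
by split; [apply/cvg_ex; exists l | exact: cvg_lim C].
Unshelve. all: by end_near. Qed.

(** Compactness of [[a, b]] makes [Fx (x, y)] close to [Fx (z, y)] uniformly in [y]; the mean value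
    inequality turns this into a first-order expansion of [F] uniform in [y], which can be
    integrated. *)
Lemma is_derive_itg_param (F Fx : R * R -> R) a b : a <= b ->
  (forall x, continuous (fun y => F (x, y))) -> continuous Fx ->
  (forall x y, is_derive x 1 (fun x => F (x, y)) (Fx (x, y))) ->
  forall x, is_derive x 1 (fun x => itg a b (fun y => F (x, y))) (itg a b (fun y => Fx (x, y))).
Proof.
move=> ab cF cFx dF z; apply: is_derive_littleo => e e0.
have b0 : 0 < b - a + 1 by rewrite ltr_wpDl // subr_ge0.
pose e' := e / (b - a + 1).
have e'0 : 0 < e' by rewrite divr_gt0.
have := @near_uniform _ (fun x y => Fx (x, y)) a b z e' e'0 _.
have -> : (fun q : R * R => Fx (q.1, q.2)) = Fx by apply/funext => -[].
move=> /(_ (fun y _ => cFx (z, y))) /nbhs_ballP[d /= d0 Hd].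
exists d => //= x zx.
have cx w : continuous (fun y => Fx (w, y)) by exact: continuous_pair1.
have cd : continuous (fun y => F (x, y) - F (z, y)).
  by move=> y; apply: cvgB; exact: cF.
have cl : continuous (fun y => (x - z) * Fx (z, y)).
  by move=> y; apply: cvgM; [exact: cvg_cst | exact: cx].
rewrite -(itgB _ _ (cF x) (cF z)) -(itgZ _ _ _ (cx z)) -(itgB _ _ cd cl).
apply: (@le_trans _ _ (e' * `|x - z| * (b - a))).
  apply: itg_norm_le => //.
    by move=> y; apply: cvgB; [exact: cd | exact: cl].
  move=> y yab; apply: (mean_value_le (f := fun x => F (x, y)) (df := fun x => Fx (x, y))) => //.
  move=> w wz; apply: Hd => //; rewrite /ball /= distrC (le_lt_trans wz) // distrC.
  exact: zx.
rewrite mulrAC ler_wpM2r // /e' mulrAC ler_pdivrMr // ler_pM2l //; lra.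
Qed.

(** With [b] replaced by a variable upper limit, both sides vanish at [a] and have the same
    derivative, the right one by differentiation under the integral sign. *)
Lemma itg_fubini F a b c d : a <= b -> c <= d -> continuous F ->
  itg a b (fun x => itg c d (fun y => F (x, y))) =
  itg c d (fun y => itg a b (fun x => F (x, y))).
Proof.
move=> ab cd cF.
pose G (q : R * R) := itg a q.1 (fun x => F (x, q.2)).
have dG x y : is_derive x 1 (fun x => G (x, y)) (F (x, y)).
  by apply: (@is_derive_itg _ (fun x => F (x, y))); exact: continuous_pair2.
have cG x : continuous (fun y => G (x, y)).
  rewrite /G /=; have [ax|xa] := leP a x; first exact: itg_continuous'.
  rewrite (_ : (fun _ => _) = fun y => - itg x a (fun x => F (x, y))).
    by move=> y; apply: cvgN; exact: (itg_continuous' (ltW xa)).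
  apply/funext => y; apply/eqP; rewrite -addr_eq0 itg_cat ?itg_refl //.
  exact: continuous_pair2.
have dH := is_derive_itg_param cd cG cF dG.
rewrite (itgE _ _ dH) /G /=.
rewrite [X in _ - X](_ : _ = 0) ?subr0 //.
by rewrite (_ : (fun y => _) = fun=> 0) ?itg_cst ?mul0r //; apply/funext => y; rewrite itg_refl.
Qed.

Lemma Rintegral_prod F a b c d : a <= b -> c <= d -> continuous F ->
  (forall q, 0 <= F q) ->
  \int[(lebesgue_measure \x lebesgue_measure)%E]_(q in `[a, b[ `*` `[c, d[) F q =
  itg a b (fun x => itg c d (fun y => F (x, y))).
Proof.
move=> ab cd cF F0.
have mF := continuous_measurable_fun2 cF.
have cI := itg_continuous cd cF.
have itgb (f : R -> R) u v : u <= v -> continuous f ->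
    (\int[mu]_(x in `[u, v[) (f x)%:E = (itg u v f)%:E)%E.
  move=> uv cf; rewrite integral_itv_bndo_bndc; last first.
    by apply/measurable_EFinP/measurable_funTS; exact: continuous_measurable_fun.
  rewrite -(Rintegral_itg uv cf) /Rintegral fineK //.
  apply: integrable_fin_num => //; apply: continuous_compact_integrable.
    exact: segment_compact.
  exact: continuous_subspaceT.
pose D : set (R * R) := `[a, b[ `*` `[c, d[.
have mD : measurable (D : set (measurableTypeR R * measurableTypeR R)).
  by apply: measurableX; exact: measurable_itv.
rewrite /Rintegral integral_mkcond.
rewrite fubini_tonelli1; last 2 first.
- apply/(measurable_restrictT _ mD)/measurable_EFinP/measurable_funTS; exact: mF.
- by move=> q; rewrite patchE; case: ifP => // _; rewrite lee_fin.
rewrite -[RHS]/(fine (itg a b (fun x => itg c d (fun y => F (x, y))))%:E) -(itgb _ _ _ ab cI) [in RHS]integral_mkcond.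
congr fine; apply: eq_integral => x _; rewrite /fubini_F patchE; case: ifPn => xab.
  rewrite -itgb //; last exact: continuous_pair1.
  rewrite [RHS]integral_mkcond; apply: eq_integral => y _; rewrite !patchE.
  by rewrite /D in_setX xab.
by apply: integral0_eq => y _; rewrite patchE in_setX (negbTE xab).
Qed.

End Lebesgue.

(** * Calculus of smooth functions *)

Section Calculus.
Variable R : realType.

Section Continuity.
Variable T : topologicalType.
Implicit Types f g : T -> R.

Lemma continuous_cstf (a : R) : continuous (fun _ : T => a).
Proof. by move=> x; exact: cvg_cst. Qed.

Lemma continuous_addf f g : continuous f -> continuous g -> continuous (fun x => f x + g x).
Proof. by move=> cf cg x; apply: cvgD; [exact: cf|exact: cg]. Qed.

Lemma continuous_oppf f : continuous f -> continuous (fun x => - f x).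
Proof. by move=> cf x; apply: cvgN; exact: cf. Qed.

Lemma continuous_mulf f g : continuous f -> continuous g -> continuous (fun x => f x * g x).
Proof. by move=> cf cg x; apply: cvgM; [exact: cf|exact: cg]. Qed.

Lemma continuous_expf f n : continuous f -> continuous (fun x => f x ^+ n).
Proof.
move=> cf; elim: n => [|n IH]; first by move=> x; under eq_fun do rewrite expr0; exact: cvg_cst.
rewrite (_ : (fun x => _) = fun x => f x * f x ^+ n); first exact: continuous_mulf.
by apply/funext => x; rewrite exprS.
Qed.

Lemma continuous_invf f : (forall x, f x != 0) -> continuous f -> continuous (fun x => (f x)^-1).
Proof. by move=> f0 cf x; apply: cvgV; [exact: f0|exact: cf]. Qed.

Lemma continuous_compf (phi : R -> R) f : continuous phi -> continuous f ->
  continuous (fun x => phi (f x)).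
Proof. by move=> cp cf x; apply: (@continuous_comp _ _ _ f phi); [exact: cf|exact: cp]. Qed.

End Continuity.

Section Derivation.
Variable V : normedModType R.
Implicit Types (f g : V -> R) (x v : V) (a b : R).

Lemma is_derive_cstf a x v : is_derive x v (fun _ : V => a) 0.
Proof. exact: is_derive_cst. Qed.

Lemma is_derive_addf f g x v a b : is_derive x v f a -> is_derive x v g b ->
  is_derive x v (fun y => f y + g y) (a + b).
Proof. by move=> ? ?; exact: is_deriveD. Qed.

Lemma is_derive_oppf f x v a : is_derive x v f a -> is_derive x v (fun y => - f y) (- a).
Proof. by move=> ?; exact: is_deriveN. Qed.

Lemma is_derive_mulf f g x v a b : is_derive x v f a -> is_derive x v g b ->
  is_derive x v (fun y => f y * g y) (f x * b + g x * a).
Proof. by move=> ? ?; exact: is_deriveM. Qed.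

Lemma is_derive_expf f n x v a : is_derive x v f a ->
  is_derive x v (fun y => f y ^+ n) (n%:R * f x ^+ n.-1 * a).
Proof.
move=> df; have -> : (fun y => f y ^+ n) = f ^+ n by apply/funext => y; rewrite fctE.
by case: n => [|n]; [rewrite expr0 !mul0r; exact: is_derive_cst | exact: is_deriveX].
Qed.

Lemma is_derive_invf f x v a : f x != 0 -> is_derive x v f a ->
  is_derive x v (fun y => (f y)^-1) (- (a / f x ^+ 2)).
Proof.
move=> f0 [df <-]; have -> : - ('D_v f x / f x ^+ 2) = 'D_v (fun y => (f y)^-1) x.
  by rewrite deriveV // /GRing.scale /= mulNr mulrC.
by apply: derivableP; exact: derivableV.
Qed.

Lemma is_derive_sumf (I : Type) (r : seq I) (F : I -> V -> R) (dF : I -> R) x v :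
  (forall i, is_derive x v (F i) (dF i)) ->
  is_derive x v (fun y => \sum_(i <- r) F i y) (\sum_(i <- r) dF i).
Proof.
move=> H; elim: r => [|i r IH].
  rewrite big_nil (_ : (fun y => _) = fun=> 0); first exact: is_derive_cst.
  by apply/funext => y; rewrite big_nil.
rewrite big_cons (_ : (fun y => _) = fun y => F i y + \sum_(j <- r) F j y).
  exact: is_derive_addf.
by apply/funext => y; rewrite big_cons.
Qed.

(** A directional derivative only sees the restriction to a line, so it transfers between functions
    on different spaces that agree along corresponding lines. The chain rule and partial derivatives
    thus reduce to one variable. *)
Lemma eq_is_derive (W1 W2 : normedModType R) (f : W1 -> R) (g : W2 -> R)
    (x v : W1) (y w : W2) a :
  (forall h, f (h *: v + x) = g (h *: w + y)) -> is_derive x v f a -> is_derive y w g a.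
Proof.
move=> fg [df <-].
have E : (fun h => h^-1 *: (f (h *: v + x) - f x)) = (fun h => h^-1 *: (g (h *: w + y) - g y)).
  by apply/funext => h; rewrite fg; have := fg 0; rewrite !scale0r !add0r => ->.
have E' : (fun h => h^-1 *: ((f \o shift x) (h *: v) - f x)) = (fun h => h^-1 *: ((g \o shift y) (h *: w) - g y)).
  exact: E.
by split; move: df; rewrite /derivable /derive E'.
Qed.

Lemma is_derive_compf (phi : R -> R) f x v a b :
  is_derive (f x) 1 phi b -> is_derive x v f a ->
  is_derive x v (fun y => phi (f y)) (b * a).
Proof.
move=> dphi df.
pose F (h : R) := f (h *: v + x).
have F0 : F 0 = f x by rewrite /F scale0r add0r.
have dF : is_derive (0:R) 1 F a.
  by apply: eq_is_derive df => h; rewrite /F addr0 /GRing.scale /= mulr1.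
rewrite -F0 in dphi; have := is_derive1_comp dphi dF.
by apply: eq_is_derive => h; rewrite /F /= addr0 /GRing.scale /= mulr1.
Qed.

Lemma is_derive_sinf f x v a : is_derive x v f a ->
  is_derive x v (fun y => sin (f y)) (cos (f x) * a).
Proof. by move=> df; apply: is_derive_compf df; exact: is_derive_sin. Qed.

Lemma is_derive_cosf f x v a : is_derive x v f a ->
  is_derive x v (fun y => cos (f y)) (- sin (f x) * a).
Proof. by move=> df; apply: is_derive_compf df; exact: is_derive_cos. Qed.

Lemma is_derive_sqrtf f x v a : 0 < f x -> is_derive x v f a ->
  is_derive x v (fun y => Num.sqrt (f y)) ((2 * Num.sqrt (f x))^-1 * a).
Proof. by move=> f0 df; apply: is_derive_compf df; exact: is_derive1_sqrt. Qed.

Lemma is_derive_conv f x v a b : is_derive x v f a -> a = b -> is_derive x v f b.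
Proof. by move=> df <-. Qed.

End Derivation.

Implicit Types (F : R * R -> R) (x t l : R).

Lemma is_derive_fst F x t l :
  is_derive (x, t) ((1, 0) : R * R) F l <-> is_derive x 1 (fun x => F (x, t)) l.
Proof.
by split; apply: eq_is_derive => h; congr F; apply/pair_equal_spec; split => /=;
  rewrite /GRing.scale /= ?mulr0 ?add0r.
Qed.

Lemma is_derive_snd F x t l :
  is_derive (x, t) ((0, 1) : R * R) F l <-> is_derive t 1 (fun t => F (x, t)) l.
Proof.
by split; apply: eq_is_derive => h; congr F; apply/pair_equal_spec; split => /=;
  rewrite /GRing.scale /= ?mulr0 ?add0r.
Qed.

Section Smooth.
Variable W : normedModType R.
Implicit Types f g : R * R -> W.

Lemma Ck_weaken k f : Ck k.+1 f -> Ck k f.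
Proof.
elim: k f => [|k IH] f /=.
  by move=> [df _] p; exact: differentiable_continuous.
by move=> [df Hf]; split=> // v; exact: IH (Hf v).
Qed.

Lemma smooth_diff f p : smooth f -> differentiable f p.
Proof. by move=> /(_ 1%N) /= []. Qed.

Lemma smooth_continuous f : smooth f -> continuous f.
Proof. by move=> /(_ 0%N). Qed.

Lemma smooth_derive f v : smooth f -> smooth ('D_v f).
Proof. by move=> sf k; have [_ H] := sf k.+1; exact: H. Qed.

Lemma smooth_is_derive f v p : smooth f -> is_derive p v f ('D_v f p).
Proof. by move=> sf; apply/derivableP/diff_derivable/smooth_diff. Qed.

Lemma CkD k f g : Ck k f -> Ck k g -> Ck k (fun p => f p + g p).
Proof.
elim: k f g => [|k IH] f g /=; first by move=> cf cg p; apply: cvgD; [exact: cf|exact: cg].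
move=> [df Hf] [dg Hg]; split=> [p|v]; first by apply: (differentiableD (f := f) (g := g)).
have -> : 'D_v (fun p => f p + g p) = fun p => 'D_v f p + 'D_v g p.
  by apply/funext => p; rewrite -deriveD //; exact: diff_derivable.
exact: IH.
Qed.

Lemma Ck_cst k (a : W) : Ck k (fun=> a).
Proof.
elim: k a => [|k IH] a /=; first by move=> p; exact: cvg_cst.
split=> [p|v]; first exact: differentiable_cst.
by have -> : 'D_v (fun=> a) = fun=> 0 by apply/funext => p; exact: derive_cst.
Qed.

Lemma CkZl k (F : R * R -> R) (w : W) : Ck k F -> Ck k (fun p => F p *: w).
Proof.
elim: k F => [|k IH] F /=; first by move=> cF p; apply: cvgZr_tmp; exact: cF.
move=> [dF DF]; split=> [p|v]; first exact: differentiableZl.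
have -> : 'D_v (fun p => F p *: w) = fun p => 'D_v F p *: w.
  apply/funext => p; rewrite !deriveE //; last exact: differentiableZl.
  by rewrite diffZl.
exact: IH.
Qed.

Lemma Ck_sum k (I : Type) (r : seq I) (F : I -> R * R -> W) :
  (forall i, Ck k (F i)) -> Ck k (fun p => \sum_(i <- r) F i p).
Proof.
move=> sF; elim: r => [|i r IH]; first by under eq_fun do rewrite big_nil; exact: Ck_cst.
by under eq_fun do rewrite big_cons; exact: CkD.
Qed.

End Smooth.

Lemma CkM k F G : Ck k F -> Ck k G -> Ck k (fun p => F p * G p).
Proof.
elim: k F G => [|k IH] F G; first exact: continuous_mulf.
move=> HF HG; have [dF DF] := HF; have [dG DG] := HG.
split=> [p|v]; first by apply: (differentiableM (f := F) (g := G)).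
have -> : 'D_v (fun p => F p * G p) = fun p => F p * 'D_v G p + G p * 'D_v F p.
  by apply/funext => p; rewrite (deriveM (f := F) (g := G)) //; exact: diff_derivable.
by apply: CkD; apply: IH; [exact: Ck_weaken HF | exact: DG | exact: Ck_weaken HG | exact: DF].
Qed.

(* If [dphi] is the derivative of [phi] and [dphi \o F] is as regular as
   [phi \o F], then [phi \o F] gains one order of regularity. *)
Lemma Ck_comp_step k (phi dphi : R -> R) F : (forall p, is_derive (F p) 1 phi (dphi (F p))) ->
  Ck k.+1 F -> Ck k (fun p => dphi (F p)) -> Ck k.+1 (fun p => phi (F p)).
Proof.
move=> dphiF HF Hd; have [dF DF] := HF.
split=> [p|v].
  apply: (differentiable_comp (f := F) (g := phi)) => //.
  by apply/derivable1_diffP; exact: ex_derive.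
have -> : 'D_v (fun p => phi (F p)) = fun p => dphi (F p) * 'D_v F p.
  apply/funext => p; have dFp : is_derive p v F ('D_v F p).
    by apply/derivableP/diff_derivable.
  by have [_ ->] := is_derive_compf (dphiF p) dFp.
by apply: CkM => //; exact: DF.
Qed.

Lemma smooth_cst (W : normedModType R) (a : W) : smooth (fun=> a).
Proof. by move=> k; exact: Ck_cst. Qed.

Lemma smoothD (W : normedModType R) (f g : R * R -> W) :
  smooth f -> smooth g -> smooth (fun p => f p + g p).
Proof. by move=> sf sg k; exact: CkD. Qed.

Lemma smoothM F G : smooth F -> smooth G -> smooth (fun p => F p * G p).
Proof. by move=> sf sg k; exact: CkM. Qed.

Lemma smoothN F : smooth F -> smooth (fun p => - F p).
Proof.
move=> sF; rewrite (_ : (fun p => _) = fun p => -1 * F p).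
  by apply: smoothM => //; exact: smooth_cst.
by apply/funext => p; rewrite mulN1r.
Qed.

Lemma smoothX F n : smooth F -> smooth (fun p => F p ^+ n).
Proof.
move=> sF; elim: n => [|n IH]; first by under eq_fun do rewrite expr0; exact: smooth_cst.
by under eq_fun do rewrite exprS; exact: smoothM.
Qed.

Lemma smooth_sum (I : Type) (r : seq I) (F : I -> R * R -> R) :
  (forall i, smooth (F i)) -> smooth (fun p => \sum_(i <- r) F i p).
Proof.
move=> sF; elim: r => [|i r IH]; first by under eq_fun do rewrite big_nil; exact: smooth_cst.
by under eq_fun do rewrite big_cons; exact: smoothD.
Qed.

Lemma smooth_lin F (l : R * R -> R) : (forall p v, is_derive p v F (l v)) ->
  (forall p, differentiable F p) -> smooth F.
Proof.
move=> dF DF [|k] /=; first by move=> p; exact: differentiable_continuous.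
split=> // v; rewrite (_ : 'D_v _ = fun=> l v); first exact: Ck_cst.
by apply/funext => p; case: (dF p v).
Qed.

Lemma smooth_fst : smooth (@fst R R).
Proof.
apply: (@smooth_lin _ fst) => [p v|p].
  have : is_derive (0:R) 1 (fun h => h * v.1 + p.1) v.1.
    have := is_derive_addf (is_derive_mulf (is_derive_id (0:R) 1) (is_derive_cstf v.1 (0:R) 1))
      (is_derive_cstf p.1 (0:R) 1).
    by rewrite mulr0 mulr1 add0r addr0.
  by apply: eq_is_derive => h; rewrite /= addr0 /GRing.scale /= mulr1.
by apply: linear_differentiable => q; exact: cvg_fst.
Qed.

Lemma smooth_snd : smooth (@snd R R).
Proof.
apply: (@smooth_lin _ snd) => [p v|p].
  have : is_derive (0:R) 1 (fun h => h * v.2 + p.2) v.2.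
    have := is_derive_addf (is_derive_mulf (is_derive_id (0:R) 1) (is_derive_cstf v.2 (0:R) 1))
      (is_derive_cstf p.2 (0:R) 1).
    by rewrite mulr0 mulr1 add0r addr0.
  by apply: eq_is_derive => h; rewrite /= addr0 /GRing.scale /= mulr1.
by apply: linear_differentiable => q; exact: cvg_snd.
Qed.

Lemma smoothV F : (forall p, F p != 0) -> smooth F -> smooth (fun p => (F p)^-1).
Proof.
move=> F0 sF; elim=> [|k IH].
  by apply: continuous_invf => //; exact: smooth_continuous.
apply: (@Ck_comp_step k GRing.inv (fun x => - (x ^+ 2)^-1)) => [p|//|].
  have := is_derive_invf (F0 p) (is_derive_id (F p) 1).
  by rewrite mul1r.
rewrite (_ : (fun p => _) = fun p => -1 * ((F p)^-1 * (F p)^-1)); last first.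
  by apply/funext => p; rewrite mulN1r -invfM expr2.
by apply: CkM; [exact: Ck_cst | exact: CkM].
Qed.

Lemma smooth_sqrt F : (forall p, 0 < F p) -> smooth F -> smooth (fun p => Num.sqrt (F p)).
Proof.
move=> F0 sF; have s0 p : Num.sqrt (F p) != 0 by rewrite gt_eqF // sqrtr_gt0.
elim=> [|k IH].
  by apply: continuous_compf; [exact: sqrt_continuous | exact: smooth_continuous].
apply: (@Ck_comp_step k Num.sqrt (fun x => (2 * Num.sqrt x)^-1)) => [p|//|].
  exact: is_derive1_sqrt.
rewrite (_ : (fun p => _) = fun p => 2^-1 * (Num.sqrt (F p) * (F p)^-1)); last first.
  apply/funext => p; rewrite invfM; congr (_ * _).
  rewrite -[in X in _ = _ / X](sqr_sqrtr (ltW (F0 p))) expr2; field; exact: s0.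
apply: CkM; first exact: Ck_cst.
apply: CkM => //; apply: smoothV => // p; exact: lt0r_neq0.
Qed.

Lemma smooth_sin_cos F : smooth F ->
  smooth (fun p => sin (F p)) /\ smooth (fun p => cos (F p)).
Proof.
move=> sF; suff H k : Ck k (fun p => sin (F p)) /\ Ck k (fun p => cos (F p)).
  by split=> k; case: (H k).
elim: k => [|k [IHs IHc]].
  by split; apply: continuous_compf; do ?exact: smooth_continuous;
    [exact: continuous_sin | exact: continuous_cos].
split.
  by apply: (@Ck_comp_step k sin cos) => //; exact: (sF k.+1).
apply: (@Ck_comp_step k cos (fun x => - sin x)); first exact: (sF k.+1).
rewrite (_ : (fun p => _) = fun p => -1 * sin (F p)); last by apply/funext => p; rewrite mulN1r.
by apply: CkM => //; exact: Ck_cst.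
Qed.

Lemma smooth_sin F : smooth F -> smooth (fun p => sin (F p)).
Proof. by case/smooth_sin_cos. Qed.

Lemma smooth_cos F : smooth F -> smooth (fun p => cos (F p)).
Proof. by case/smooth_sin_cos. Qed.

Section Coordinates.
Variable n : nat.
Implicit Types f : R * R -> 'rV[R]_n.

Lemma coord_is_diff f i p : differentiable f p -> differentiable (fun q => f q 0 i) p.
Proof.
move=> df; apply: (differentiable_comp (f := f) (g := fun M : 'rV[R]_n => M 0 i)) => //.
exact: differentiable_coord.
Qed.

Lemma derive_coord f i v p : differentiable f p -> 'D_v f p 0 i = 'D_v (fun q => f q 0 i) p.
Proof. by move=> df; rewrite derive_mx ?mxE //; exact: diff_derivable. Qed.

Lemma smooth_coord f i : smooth f -> smooth (fun q => f q 0 i).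
Proof.
move=> sf k; have := sf k; elim: k f {sf} => [|k IH] f /=.
  move=> cf q; apply: (@continuous_comp _ _ _ f (fun M : 'rV[R]_n => M 0 i)); first exact: cf.
  exact: coord_continuous.
move=> [df Df]; split=> [p|v]; first exact: coord_is_diff.
rewrite (_ : 'D_v _ = fun q => 'D_v f q 0 i); first exact: IH.
by apply/funext => p; rewrite derive_coord.
Qed.

Lemma smooth_rV f : (forall i, smooth (fun q => f q 0 i)) -> smooth f.
Proof.
move=> sf k; have -> : f = fun q => \sum_(i < n) (f q 0 i *: (delta_mx 0 i : 'rV[R]_n)).
  by apply/funext => q; rewrite [LHS]row_sum_delta.
by apply: Ck_sum => i; apply: CkZl; exact: sf.
Qed.

End Coordinates.

End Calculus.

Ltac cont_leaf := first
  [ assumption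
  | match goal with H : forall _, continuous _ |- _ => exact: H end
  | exact: continuous_cstf
  | exact: continuous_sin | exact: continuous_cos
  | apply: (continuous_compf (@continuous_sin _)); cont_tac
  | apply: (continuous_compf (@continuous_cos _)); cont_tac
  | apply: (continuous_compf (@sqrt_continuous _)); cont_tac
  | by move=> ?; exact: cvg_id
  | by move=> ?; exact: cvg_fst
  | by move=> ?; exact: cvg_snd
  | apply: smooth_continuous; assumption ]
with cont_tac :=
  lazymatch goal with
  | |- forall _, continuous_at _ ?F =>
    lazymatch F with
    | fun _ => ?a => exact: continuous_cstf
    | fun _ => Algebra.add _ _ => apply: continuous_addf; cont_tac
    | fun _ => Algebra.opp _ => apply: continuous_oppf; cont_tac
    | fun _ => GRing.mul _ _ => apply: continuous_mulf; cont_tac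
    | Algebra.add _ => apply: continuous_addf; cont_tac
    | GRing.mul _ => apply: continuous_mulf; cont_tac
    | fun _ => GRing.exp _ _ => apply: continuous_expf; cont_tac
    | fun _ => GRing.inv _ => apply: continuous_invf; [by [] | cont_tac]
    | _ => cont_leaf
    end
  end.

(* [notypeclasses] keeps the instances of the library from being used, since
   they produce derivatives in terms of [_ *: _]. *)
Ltac isd_leaf := first
  [ notypeclasses refine (is_derive_cstf _ _ _)
  | notypeclasses refine (is_derive_id _ _)
  | match goal with H : _ |- _ => notypeclasses refine H end
  | match goal with H : _ |- _ => notypeclasses refine (H _) end
  | match goal with H : _ |- _ => notypeclasses refine (H _ _) end
  | notypeclasses refine (smooth_is_derive _ _ _); assumption
  | notypeclasses refine (is_derive_sinf _); isd_tac
  | notypeclasses refine (is_derive_cosf _); isd_tac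
  | notypeclasses refine (is_derive_sqrtf _ _); [ try by [] | isd_tac ] ]
with isd_tac :=
  lazymatch goal with
  | |- is_derive _ _ ?F _ =>
    lazymatch F with
    | fun _ => ?a => notypeclasses refine (is_derive_cstf _ _ _)
    | fun _ => Algebra.add _ _ => notypeclasses refine (is_derive_addf _ _); isd_tac
    | fun _ => Algebra.opp _ => notypeclasses refine (is_derive_oppf _); isd_tac
    | Algebra.add _ => notypeclasses refine (is_derive_addf _ _); isd_tac
    | GRing.mul _ => notypeclasses refine (is_derive_mulf _ _); isd_tac
    | Algebra.opp => notypeclasses refine (is_derive_oppf _); isd_tac
    | fun _ => GRing.mul _ _ => first
      [ match goal with H : _ |- _ => notypeclasses refine (H _) end
      | notypeclasses refine (is_derive_mulf _ _); isd_tac ]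
    | fun _ => GRing.exp _ _ => notypeclasses refine (is_derive_expf _ _); isd_tac
    | fun _ => GRing.inv _ => notypeclasses refine (is_derive_invf _ _); [ try by [] | isd_tac ]
    | _ => isd_leaf
    end
  end.

Ltac isd := notypeclasses refine (is_derive_conv _ _); [isd_tac | rewrite /=].

Ltac smooth_leaf := first
  [ assumption
  | match goal with H : forall _, smooth _ |- _ => exact: H end
  | exact: smooth_cst
  | exact: smooth_fst | exact: smooth_snd
  | apply: smooth_derive; smooth_tac
  | apply: smooth_sin; smooth_tac
  | apply: smooth_cos; smooth_tac
  | apply: smooth_sqrt; [by [] | smooth_tac]
  | apply: smooth_sum => ?; smooth_tac ]
with smooth_tac :=
  lazymatch goal with
  | |- smooth ?F =>
    lazymatch F with
    | fun _ => ?a => exact: smooth_cst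
    | fun _ => Algebra.add _ _ => apply: smoothD; smooth_tac
    | fun _ => Algebra.opp _ => apply: smoothN; smooth_tac
    | fun _ => GRing.mul _ _ => apply: smoothM; smooth_tac
    | fun _ => GRing.exp _ _ => apply: smoothX; smooth_tac
    | fun _ => GRing.inv _ => apply: smoothV; [by [] | smooth_tac]
    | _ => smooth_leaf
    end
  end.

(** * Sturm comparison and one-dimensional spectral gaps *)

Section GroundState.
Variable R : realType.
Implicit Types (f g : R -> R) (a b c x y : R).

Lemma is_derive_near f x l e : is_derive x 1 f l -> 0 < e ->
  \forall y \near x, `|f y - f x - (y - x) * l| <= e * `|y - x|.
Proof.
move=> [df dfl] e0.
have /cvgrPdist_le /(_ e e0) /nbhs_ballP[d /= d0 Hd] :
    (fun h => h^-1 *: (f (h *: (1:R) + x) - f x)) @ 0^' --> l by rewrite -dfl; exact: df.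
exists d => //= y; rewrite /ball /= => yd.
have [->|yx] := eqVneq y x; first by rewrite !subrr mul0r subrr normr0 mulr0.
have yx0 : y - x != 0 by rewrite subr_eq0.
have yd' : `|y - x| < d by rewrite distrC.
have := Hd (y - x); rewrite /ball /= sub0r normrN => /(_ yd' yx0).
rewrite /GRing.scale /= mulr1 subrK distrC => H.
have -> : f y - f x - (y - x) * l = ((y - x)^-1 * (f y - f x) - l) * (y - x) by field.
by rewrite normrM ler_wpM2r.
Qed.

(** Near a common zero [u] is at most of order [|y - x|] and [w] at least of that order, so the
    quotient is [O(|y - x|)]; its value at the zero itself is 0 because the numerator vanishes
    there. *)
Lemma continuous_sqr_div u w x a b : is_derive x 1 u a -> is_derive x 1 w b ->
  u x = 0 -> w x = 0 -> b != 0 -> {for x, continuous (fun y => u y ^+ 2 / w y)}.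
Proof.
move=> du dw ux wx b0.
have du1 := is_derive_near du ltr01.
have b2 : 0 < `|b| / 2 by rewrite divr_gt0 ?normr_gt0.
have dw1 := is_derive_near dw b2.
pose C : R := (`|a| + 1) ^+ 2 / (`|b| / 2).
have C0 : 0 <= C by rewrite divr_ge0 // ?sqr_ge0 // ltW.
have H : \forall y \near x, `|u y ^+ 2 / w y| <= C * `|y - x|.
  near=> y.
  have Hu : `|u y| <= (`|a| + 1) * `|y - x|.
    have : `|u y - u x - (y - x) * a| <= 1 * `|y - x| by near: y.
    rewrite ux subr0 => H.
    have := ler_normD (u y - (y - x) * a) ((y - x) * a); rewrite subrK normrM; lra.
  have Hw : `|b| / 2 * `|y - x| <= `|w y|.
    have : `|w y - w x - (y - x) * b| <= `|b| / 2 * `|y - x| by near: y.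
    rewrite wx subr0 => H.
    have : `|(y - x) * b| <= `|w y| + `|w y - (y - x) * b|.
      by rewrite -{1}[(y - x) * b](subKr (w y)) (le_trans (ler_normB _ _)).
    rewrite normrM; move: H (normr_ge0 (y - x)) b2; set n := `|y - x|; set m := `|w y - _|; nra.
  have [yx|yx] := eqVneq y x; first by rewrite yx ux expr0n mul0r normr0 subrr normr0 mulr0.
  have n0 : 0 < `|y - x| by rewrite normr_gt0 subr_eq0.
  have w0 : 0 < `|w y| by rewrite (lt_le_trans _ Hw) // mulr_gt0.
  rewrite normrM normfV normrX ler_pdivrMr //.
  apply: (@le_trans _ _ (((`|a| + 1) * `|y - x|) ^+ 2)).
    by rewrite lerXn2r // nnegrE // mulr_ge0 // addr_ge0.
  have -> : ((`|a| + 1) * `|y - x|) ^+ 2 = C * `|y - x| * (`|b| / 2 * `|y - x|).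
    by rewrite /C; field; rewrite normr_eq0.
  by rewrite ler_wpM2l // mulr_ge0.
apply/cvgrPdist_le => e e0; rewrite ux expr0n mul0r.
near=> y; rewrite sub0r normrN.
have : `|u y ^+ 2 / w y| <= C * `|y - x| by near: y.
move=> /le_trans; apply.
have : `|y - x| <= e / (C + 1).
  rewrite distrC; near: y; apply/nbhs_ballP; exists (e / (C + 1)) => /=.
    by rewrite divr_gt0 // ltr_wpDl.
  by move=> y; rewrite /ball /=; exact: ltW.
rewrite ler_pdivlMr ?ltr_wpDl // => H'.
have := normr_ge0 (y - x); lra.
Unshelve. all: by end_near. Qed.

Lemma eq_closed_itv f g a b : a < b -> continuous f -> continuous g ->
  (forall x, a < x < b -> f x = g x) -> forall x, a <= x <= b -> f x = g x.
Proof.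
move=> ab cf cg fg x /andP[ax xb]; apply/eqP; rewrite -subr_eq0 -normr_eq0.
apply/negPn/negP => h0.
have ch : continuous (fun y => f y - g y) by cont_tac.
have /cvgrPdist_lt /(_ `|f x - g x|) := ch x.
rewrite normr_gt0 -normr_eq0 h0 => /(_ isT) /nbhs_ballP[d /= d0 Hd].
have [y yab xy] : exists2 y, a < y < b & `|x - y| < d.
  pose e := Num.min (d / 2) ((b - a) / 3).
  have e0 : 0 < e by rewrite lt_min; apply/andP; split; lra.
  have e1 : e <= d / 2 by rewrite ge_min lexx.
  have e2 : e <= (b - a) / 3 by rewrite ge_min lexx orbT.
  have [xm|xm] := ltP x ((a + b) / 2).
    exists (x + e); first by apply/andP; split; lra.
    by rewrite opprD addNKr normrN gtr0_norm //; lra.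
  exists (x - e); first by apply/andP; split; lra.
  by rewrite opprB addrC subrK gtr0_norm //; lra.
by have := Hd y xy; rewrite /= (fg y yab) subrr subr0 ltxx.
Qed.

Variables (p q w dw u du : R -> R).
Hypothesis du_u : forall x, is_derive x 1 u (du x).
Hypothesis dw_w : forall x, is_derive x 1 w (dw x).
Hypothesis sturm : forall x, is_derive x 1 (fun y => p y * dw y) (q x * w x).
Hypotheses (cp : continuous p) (cq : continuous q) (cdu : continuous du).
Hypothesis p_gt0 : forall x, 0 < p x.

Let energy x := p x * du x ^+ 2 + q x * u x ^+ 2.
Let bterm x := p x * dw x * (u x ^+ 2 / w x).
Let cu : continuous u := derive1_continuous du_u.
Let cw : continuous w := derive1_continuous dw_w.
Let cpdw : continuous (fun y => p y * dw y) := derive1_continuous sturm.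

Lemma energy_continuous : continuous energy.
Proof. rewrite /energy; cont_tac. Qed.

(** Jacobi's identity: where [w] does not vanish, [energy - bterm' = p (u' - u w' / w)^2], since
    [(p w')' = q w]. The difference of the primitives is thus nondecreasing, and it is constant only
    if [u / w] is. *)
Lemma ground_state a b : a < b -> (forall x, a < x < b -> w x != 0) ->
  (w a = 0 -> u a = 0 /\ dw a != 0) -> (w b = 0 -> u b = 0 /\ dw b != 0) ->
  bterm b - bterm a <= itg a b energy /\
  (itg a b energy = bterm b - bterm a -> exists K, forall x, a <= x <= b -> u x = K * w x).
Proof.
move=> ab w0 wa wb; have [E dE] := antiderivative energy_continuous.
pose N x := E x - bterm x.
pose dN x := p x * (du x - u x * dw x / w x) ^+ 2.
have dNN x : a < x < b -> is_derive x 1 N (dN x).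
  move=> /w0 wx; have dbt : is_derive x 1 bterm (q x * u x ^+ 2 + p x * dw x * (2 * u x * du x / w x - u x ^+ 2 * dw x / w x ^+ 2)).
    rewrite /bterm; isd; by field.
  rewrite /N; isd.
  by rewrite /dN /energy; field.
(* Only an endpoint can be a zero of [w]; there [u] vanishes too and [w] has a simple zero, so the
   boundary term is still continuous. *)
have cN x : a <= x <= b -> {for x, continuous N}.
  move=> /andP[ax xb]; apply: cvgB; first exact: (derive1_continuous dE).
  apply: cvgM; first exact: cpdw.
  have [wx|wx] := eqVneq (w x) 0.
    have [ux dwx] : u x = 0 /\ dw x != 0.
      case: (ltgtP a x) ax => // [ax _|xa _]; last by subst x; exact: wa.
      case: (ltgtP x b) xb => // [xb _|xb _]; last by subst x; exact: wb.
      by have := w0 x; rewrite ax xb wx eqxx => /(_ isT).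
    exact: (continuous_sqr_div (du_u x) (dw_w x)).
  have cu2 : continuous (fun x => u x ^+ 2) by cont_tac.
  by apply: cvgM; [exact: cu2 | apply: cvgV => //; exact: cw].
have dN0 x : 0 <= dN x by rewrite mulr_ge0 ?sqr_ge0 // ltW.
have Nle x y : a <= x -> x <= y -> y <= b -> N x <= N y.
  move=> ax; rewrite le_eqVlt => /predU1P[-> //|xy] yb.
  have dNxy z : x < z < y -> is_derive z 1 N (dN z).
    by move=> /andP[xz zy]; apply: dNN; rewrite (le_lt_trans ax xz) (lt_le_trans zy yb).
  have cNxy z : x <= z <= y -> {for z, continuous N}.
    by move=> /andP[xz zy]; apply: cN; rewrite (le_trans ax xz) (le_trans zy yb).
  have [c _ /eqP] := mean_value xy dNxy cNxy.
  by rewrite subr_eq => /eqP ->; rewrite ler_wpDl // mulr_ge0 // subr_ge0 ltW.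
have NE : N b - N a = itg a b energy - (bterm b - bterm a).
  by rewrite (itgE _ _ dE) /N; ring.
split; first by have := Nle a b (lexx _) (ltW ab) (lexx _); lra.
move=> Heq; have Nconst x : a <= x <= b -> N x = N a.
  move=> /andP[ax xb]; have := Nle a x (lexx _) ax xb; have := Nle x b ax xb (lexx _); lra.
have dN0' x : a < x < b -> dN x = 0.
  move=> xab; have : is_derive x 1 N 0.
    apply: (@near_eq_is_derive _ _ _ (cst (N a))).
    near=> y; rewrite Nconst //.
    have : y \in `]a, b[ by near: y; apply: near_in_itvoo; rewrite in_itv.
    by rewrite in_itv /= => /andP[/ltW-> /ltW->].
  by case: (dNN x xab) => _ <- [_ <-].
have dquo x : a < x < b -> is_derive x 1 (fun y => u y / w y) 0.
  move=> xab; have wx := w0 x xab; isd.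
  have /eqP := dN0' x xab; rewrite /dN mulf_eq0 gt_eqF //= sqrf_eq0 subr_eq0 => /eqP -> /=.
  by field.
pose m := (a + b) / 2.
have mab : a < m < b by rewrite /m; apply/andP; split; lra.
exists (u m / w m) => x /andP[ax xb].
have Koo y : a < y < b -> u y = u m / w m * w y.
  by move=> yab; rewrite -(derive1_eq0_cst dquo yab mab) divfK // w0.
have cKw : continuous (fun x => u m / w m * w x) by cont_tac.
by apply: (eq_closed_itv ab cu cKw Koo); rewrite ax xb.
Unshelve. all: by end_near. Qed.

(* Two consecutive nodal intervals; the derivatives at the common zero of [w]
   force the two constants to agree. *)
Lemma ground_state2 a b c : a < b -> b < c ->
  (forall x, a < x < b -> w x != 0) -> (forall x, b < x < c -> w x != 0) ->
  w a = 0 -> w b = 0 -> w c = 0 -> u a = 0 -> u b = 0 -> u c = 0 ->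
  dw a != 0 -> dw b != 0 -> dw c != 0 ->
  0 <= itg a c energy /\
  (itg a c energy = 0 -> exists K, forall x, a <= x <= c -> u x = K * w x).
Proof.
move=> ab bc wab wbc wa wb wc ua ub uc dwa dwb dwc.
have b0 x : u x = 0 -> bterm x = 0 by rewrite /bterm => ->; rewrite expr0n mul0r mulr0.
have [H1 K1] := ground_state ab wab (fun _ => conj ua dwa) (fun _ => conj ub dwb).
have [H2 K2] := ground_state bc wbc (fun _ => conj ub dwb) (fun _ => conj uc dwc).
rewrite !b0 // subr0 in H1 K1 H2 K2; have ce := energy_continuous.
rewrite -(itg_cat a b c ce); split; first by rewrite addr_ge0.
move=> I0; have {K1}[|K1 HK1] := K1; first by lra.
have {K2}[|K2 HK2] := K2; first by lra.
have cdw : continuous dw.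
  rewrite (_ : dw = fun x => (p x * dw x) * (p x)^-1).
    by apply: continuous_mulf => //; apply: continuous_invf => // x; rewrite gt_eqF.
  by apply/funext => x; rewrite mulrAC divff ?mul1r // gt_eqF.
have slope K y z : y < z -> (forall x, y <= x <= z -> u x = K * w x) ->
    forall x, y <= x <= z -> du x = K * dw x.
  move=> yz HK; apply: eq_closed_itv => // [|x xyz]; first by cont_tac.
  have [_ E1] : is_derive x 1 (fun x => u x - K * w x) 0.
    apply: (@near_eq_is_derive _ _ _ (cst 0)).
    near=> t; have : t \in `]y, z[ by near: t; apply: near_in_itvoo; rewrite in_itv.
    by rewrite in_itv /= => /andP[/ltW yt /ltW tz]; rewrite HK ?subrr // yt tz.
  have [_ E2] : is_derive x 1 (fun x => u x - K * w x) (du x - K * dw x).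
    by isd; rewrite mulr0 addr0.
  by move/eqP: (etrans (esym E2) E1); rewrite subr_eq0 => /eqP.
have KE : K1 = K2.
  apply: (mulIf dwb); rewrite -(slope K1 a b ab HK1) ?(ltW ab) ?lexx //.
  by rewrite (slope K2 b c bc HK2) ?(ltW bc) ?lexx.
exists K1 => x /andP[ax xc]; case: (leP x b) => [xb|/ltW bx]; first by rewrite HK1 // ax xb.
by rewrite KE HK2 // bx xc.
Unshelve. all: by end_near. Qed.

End GroundState.

(** * Wirtinger inequalities and the profile of the bipolar metric *)

Section OneDimensionalGaps.
Variable R : realType.
Implicit Types (f df : R -> R) (x t T : R).
Local Notation pi := (@pi R).

Lemma periodicz_eq f T : (forall x, f (x + T) = f x) ->
  forall (k : int) x, f (x + k%:~R * T) = f x.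
Proof.
move=> fT; have H (n : nat) x : f (x + n%:R * T) = f x.
  elim: n x => [|n IH] x; first by rewrite mul0r addr0.
  by rewrite -natr1 mulrDl mul1r addrA fT IH.
case=> n x; first exact: H.
by rewrite NegzE mulrNz mulNr -(H n.+1 (x - _)) subrK.
Qed.

Lemma reduce_mod T a x : 0 < T -> exists k : int, a <= x + k%:~R * T <= a + T.
Proof.
move=> T0; exists (- Num.floor ((x - a) / T)).
have := floor_le ((x - a) / T); have := Num.Theory.floorD1_gt ((x - a) / T).
rewrite mulrNz intrD ltr_pdivrMr // ler_pdivlMr // => H1 H2.
by apply/andP; split; lra.
Qed.

Lemma periodic_eq f g T a : 0 < T -> (forall x, f (x + T) = f x) ->
  (forall x, g (x + T) = g x) -> (forall x, a <= x <= a + T -> f x = g x) -> f =1 g.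
Proof.
move=> T0 fT gT fg x; have [k kx] := reduce_mod a x T0.
by rewrite -(periodicz_eq fT k) -(periodicz_eq gT k) fg.
Qed.

Lemma derive_periodic f df T s : (forall x, is_derive x 1 f (df x)) ->
  (forall x, f (x + T) = s * f x) -> forall x, df (x + T) = s * df x.
Proof.
move=> dF fT x.
have [_ E1] : is_derive x 1 (fun y => f (y + T)) (df (x + T)).
  have dg : is_derive x 1 (fun y => y + T) 1 by isd; rewrite addr0.
  by rewrite -[df _]mulr1; exact: (is_derive_compf (f := fun y => y + T) (dF (x + T)) dg).
have [_ E2] : is_derive x 1 (fun y => s * f y) (s * df x) by isd; rewrite mulr0 addr0.
by rewrite -E1 -E2; congr ('D_1 _ x); apply/funext.
Qed.

Lemma antiperiodic_zero f T : continuous f -> 0 < T -> (forall x, f (x + T) = - f x) ->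
  exists a, f a = 0.
Proof.
move=> cf T0 fT.
have [||a _ fa] := @IVT R f 0 T 0 (ltW T0); last by exists a.
  exact: continuous_subspaceT.
have -> : f T = - f 0 by rewrite -{1}[T]add0r fT.
by rewrite ge_min le_max; case: (leP 0 (f 0)) => f0; apply/andP; split; apply/orP; [right|left|left|right]; lra.
Qed.

Lemma continuous_comp_shift f a : continuous f -> continuous (fun x => f (x + a)).
Proof.
move=> cf x; apply: (@continuous_comp _ _ _ (fun x => x + a) f); last exact: cf.
by apply: cvgD; [exact: cvg_id | exact: cvg_cst].
Qed.

Lemma itg_odd f T : 0 < T -> continuous f -> (forall x, f (x + T) = f x) ->
  (forall x, f (- x) = - f x) -> itg 0 T f = 0.
Proof.
move=> T0 cf fT fo.
have := itg_opp 0 T cf; rewrite oppr0 (_ : (fun x => f (- x)) = fun x => -1 * f x); last first.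
  by apply/funext => x; rewrite fo mulN1r.
by rewrite itgZ //; have := itg_periodic (- T) cf fT; rewrite addNr; lra.
Qed.

Section Wirtinger.
Variables f df : R -> R.
Hypothesis df_f : forall x, is_derive x 1 f (df x).
Hypothesis cdf : continuous df.
Variable T : R.
Hypothesis T0 : 0 < T.

Let cf : continuous f := derive1_continuous df_f.

Let sturm_sin k a x : is_derive x 1 (fun y => 1 * (k * cos (k * (y - a)))) (- k ^+ 2 * sin (k * (x - a))).
Proof. by isd; ring. Qed.

Let derive_sin k a x : is_derive x 1 (fun y => sin (k * (y - a))) (k * cos (k * (x - a))).
Proof. by isd; ring. Qed.

Let sin_neq0 k a x : 0 < k -> a < x < a + pi / k -> sin (k * (x - a)) != 0.
Proof.
move=> k0 /andP[ax xa]; rewrite gt_eqF // sin_gt0_pi // mulr_gt0 ?subr_gt0 //=.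
by rewrite mulrC -ltr_pdivlMr // ltrBlDl.
Qed.

(** An antiperiodic function has a zero [a], hence also the zero [a + T]; on the interval between
    them the comparison function [sin (k (x - a))] has no zero. *)
Lemma wirtinger_antiperiodic : (forall x, f (x + T) = - f x) ->
  let k := pi / T in
  0 <= itg 0 T (fun x => df x ^+ 2 - k ^+ 2 * f x ^+ 2) /\
  (itg 0 T (fun x => df x ^+ 2 - k ^+ 2 * f x ^+ 2) = 0 ->
   forall x, f x = f 0 * cos (k * x) + f (T / 2) * sin (k * x)).
Proof.
move=> fT k; have [a fa] := antiperiodic_zero cf T0 fT.
have k0 : 0 < k by rewrite divr_gt0 // pi_gt0.
have kT : k * T = pi by rewrite /k divfK // gt_eqF.
have Tk : pi / k = T by rewrite -kT mulrC mulKf // gt_eqF.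
have dfT x : df (x + T) = - df x.
  by rewrite -mulN1r; apply: derive_periodic => // y; rewrite mulN1r.
pose F x := df x ^+ 2 - k ^+ 2 * f x ^+ 2.
have cF : continuous F by rewrite /F; cont_tac.
have FT x : F (x + T) = F x by rewrite /F dfT fT !sqrrN.
rewrite -/F -(itg_periodic a cF FT).
have aT : a < a + T by rewrite ltrDl.
have c1 : continuous (fun _ : R => 1 : R) by cont_tac.
have ck : continuous (fun _ : R => - k ^+ 2) by cont_tac.
have [|||] := @ground_state R (fun=> 1) (fun=> - k ^+ 2) (fun x => sin (k * (x - a)))
  (fun x => k * cos (k * (x - a))) f df df_f (derive_sin k a) (sturm_sin k a)
  c1 ck cdf (fun=> ltr01) a (a + T) aT.
- by move=> x xa; apply: sin_neq0 => //; rewrite Tk.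
- by rewrite subrr mulr0 cos0 mulr1 fa gt_eqF.
- by rewrite fT fa oppr0 addrC addKr kT cospi mulrN1 oppr_eq0 gt_eqF.
rewrite fT fa oppr0 expr0n !mul0r !mulr0 subrr.
have -> : (fun x => 1 * df x ^+ 2 + - k ^+ 2 * f x ^+ 2) = F.
  by apply/funext => x; rewrite /F mul1r mulNr.
move=> I0 Eq; split=> // /Eq[K HK].
have HK' x : f x = K * sin (k * (x - a)).
  have [j jx] := reduce_mod a x T0.
  have := HK _ jx; have -> := alternatingz (f := f) fT.
  rewrite (_ : k * (x + j%:~R * T - a) = k * (x - a) + j%:~R * pi); last by rewrite -kT; ring.
  rewrite (alternatingz (@sinDpi R)) mulrCA => /mulfI; apply.
  by rewrite expfz_neq0 // oppr_eq0 oner_eq0.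
move=> x; rewrite !HK' mulrBr (_ : k * (T / 2 - a) = pi / 2 - k * a); last by rewrite -kT; field.
by rewrite sub0r mulrN sinN !sinB sin_pihalf cos_pihalf; ring.
Qed.

(** Some [a] satisfies [f (a + T / 2) = f a = c], so [f - c] vanishes at the three zeros [a],
    [a + T / 2], [a + T] of [sin (k (x - a))]. Since [f] has mean zero, subtracting [c] lowers the
    energy by [k^2 c^2 T], which has the favourable sign and forces [c = 0] in the equality case. *)
Lemma wirtinger_mean0 : (forall x, f (x + T) = f x) -> itg 0 T f = 0 ->
  let k := 2 * pi / T in
  0 <= itg 0 T (fun x => df x ^+ 2 - k ^+ 2 * f x ^+ 2) /\
  (itg 0 T (fun x => df x ^+ 2 - k ^+ 2 * f x ^+ 2) = 0 ->
   forall x, f x = f 0 * cos (k * x) + f (T / 4) * sin (k * x)).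
Proof.
move=> fT f_mean k; have T2 : 0 < T / 2 by rewrite divr_gt0.
pose g x := f (x + T / 2) - f x.
have gT x : g (x + T / 2) = - g x.
  by rewrite /g -addrA -splitr fT opprB.
have cg : continuous g.
  have ccs := @continuous_comp_shift f (T / 2) cf.
  by rewrite /g; cont_tac.
have [a /eqP] := antiperiodic_zero cg T2 gT.
rewrite subr_eq0 => /eqP fa; set c := f a in fa.
have k0 : 0 < k by rewrite divr_gt0 // mulr_gt0 // pi_gt0.
have kT : k * T = 2 * pi by rewrite /k divfK // gt_eqF.
have Tk : pi / k = T / 2.
  apply: (@mulfI _ k); first by rewrite gt_eqF.
  by rewrite mulrCA divff ?gt_eqF // mulr1 mulrA kT; field.
have dfT x : df (x + T) = df x.
  by rewrite -[RHS]mul1r; apply: derive_periodic => // y; rewrite mul1r.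
pose u x := f x - c.
have du_u x : is_derive x 1 u (df x) by rewrite /u; isd; rewrite addr0.
pose F x := df x ^+ 2 - k ^+ 2 * f x ^+ 2.
have cF : continuous F by rewrite /F; cont_tac.
have FT x : F (x + T) = F x by rewrite /F dfT fT.
rewrite -/F -(itg_periodic a cF FT).
have a1 : a < a + T / 2 by rewrite ltrDl.
have a2 : a + T / 2 < a + T by lra.
have c1 : continuous (fun _ : R => 1 : R) by cont_tac.
have ck : continuous (fun _ : R => - k ^+ 2) by cont_tac.
have kT2 : k * (a + T / 2 - a) = pi by rewrite addrC addKr -Tk mulrC divfK // gt_eqF.
have kT1 : k * (a + T - a) = pi + pi by rewrite addrC addKr kT; ring.
have [|||||||||||] := @ground_state2 R (fun=> 1) (fun=> - k ^+ 2) (fun x => sin (k * (x - a)))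
  (fun x => k * cos (k * (x - a))) u df du_u (derive_sin k a) (sturm_sin k a)
  c1 ck cdf (fun=> ltr01) a (a + T / 2) (a + T) a1 a2.
- by move=> x xa; apply: sin_neq0 => //; rewrite Tk.
- move=> x xa; have := @sin_neq0 k (a + T / 2) x k0.
  rewrite Tk -addrA -splitr => /(_ xa).
  rewrite (_ : k * (x - (a + T / 2)) = k * (x - a) - pi).
    by rewrite -[k * (x - a)](subrK pi) sinDpi oppr_eq0 addrK.
  by rewrite -kT2; ring.
- by rewrite subrr mulr0 sin0.
- by rewrite kT2 sinpi.
- by rewrite kT1 sinDpi sinpi oppr0.
- by rewrite /u subrr.
- by rewrite /u fa subrr.
- by rewrite /u fT subrr.
- by rewrite subrr mulr0 cos0 mulr1 gt_eqF.
- by rewrite kT2 cospi mulrN1 oppr_eq0 gt_eqF.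
- by rewrite kT1 cosDpi cospi opprK mulr1 gt_eqF.
have aT : a <= a + T by rewrite lerDl ltW.
have -> : itg a (a + T) (fun x => 1 * df x ^+ 2 + - k ^+ 2 * u x ^+ 2) =
    itg a (a + T) F - k ^+ 2 * c ^+ 2 * T.
  rewrite (_ : (fun x => _) = fun x => F x + (2 * k ^+ 2 * c * f x - k ^+ 2 * c ^+ 2)); last first.
    by apply/funext => x; rewrite /F /u; ring.
  rewrite itgD // ?itgB // ?itgZ // ?itg_cst; [|by cont_tac..].
  by rewrite (itg_periodic _ cf fT) f_mean; ring.
have kc : 0 <= k ^+ 2 * c ^+ 2 * T := mulr_ge0 (mulr_ge0 (sqr_ge0 k) (sqr_ge0 c)) (ltW T0).
move=> I0 Eq; split; first by lra.
move=> IF; have kc0 : k ^+ 2 * c ^+ 2 * T = 0 by lra.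
have c0 : c = 0.
  by move/eqP: kc0; rewrite mulf_eq0 (gt_eqF T0) orbF mulf_eq0 !sqrf_eq0 (gt_eqF k0) => /eqP.
have {Eq}[|K HK] := Eq; first by rewrite kc0 IF subrr.
have HK' : f =1 (fun x => K * sin (k * (x - a))).
  apply: (periodic_eq T0 fT _ (a := a)) => [x|x xa].
    by rewrite (_ : k * _ = k * (x - a) + pi + pi) ?sinDpi ?sinDpi ?opprK //; move: kT; lra.
  by rewrite -HK // /u c0 subr0.
move=> x; rewrite !HK' mulrBr (_ : k * (T / 4 - a) = pi / 2 - k * a); last by move: kT; lra.
by rewrite sub0r mulrN sinN !sinB sin_pihalf cos_pihalf; ring.
Qed.

End Wirtinger.

(* The metric of the bipolar surface is 6 kw kd (dx^2 + dt^2 / kd^2). *)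
Definition kC t : R := - sin (2 * t).
Definition kS t : R := cos (2 * t).
Definition kd t : R := Num.sqrt (4 - kC t ^+ 2).
Definition kw t : R := (4 + kC t ^+ 2) / kd t ^+ 3.

Lemma kC2_le1 t : kC t ^+ 2 <= 1.
Proof. by rewrite /kC sqrrN; have := cos2Dsin2 (2 * t); nra. Qed.

Lemma kdom_gt0 t : 0 < 4 - kC t ^+ 2.
Proof. by have := kC2_le1 t; lra. Qed.

Lemma kd_gt0 t : 0 < kd t.
Proof. by rewrite sqrtr_gt0 kdom_gt0. Qed.

Lemma kd_neq0 t : kd t != 0.
Proof. by rewrite gt_eqF ?kd_gt0. Qed.

Lemma kd2 t : kd t ^+ 2 = 4 - kC t ^+ 2.
Proof. by rewrite sqr_sqrtr // ltW ?kdom_gt0. Qed.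

Lemma kS2 t : kS t ^+ 2 = 1 - kC t ^+ 2.
Proof. by have := cos2Dsin2 (2 * t); rewrite /kS /kC sqrrN; lra. Qed.

Lemma kw_gt0 t : 0 < kw t.
Proof. by rewrite divr_gt0 ?exprn_gt0 ?kd_gt0 // ltr_wpDr ?sqr_ge0. Qed.

Lemma is_derive_kC t : is_derive t 1 kC (- (2 * kS t)).
Proof. by rewrite /kC /kS; isd; ring. Qed.

Lemma is_derive_kS t : is_derive t 1 kS (2 * kC t).
Proof. by rewrite /kC /kS; isd; ring. Qed.

Lemma is_derive_kd t : is_derive t 1 kd (2 * kS t * kC t / kd t).
Proof.
have d0 := kdom_gt0 t; have dC := is_derive_kC t; rewrite /kd; isd => //.
by have := kd_neq0 t; rewrite /kd => ?; field.
Qed.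

Lemma continuous_kC : continuous kC. Proof. exact: derive1_continuous is_derive_kC. Qed.
Lemma continuous_kS : continuous kS. Proof. exact: derive1_continuous is_derive_kS. Qed.
Lemma continuous_kd : continuous kd. Proof. exact: derive1_continuous is_derive_kd. Qed.

Lemma kC_periodic t : kC (t + pi) = kC t.
Proof. by rewrite /kC (_ : 2 * (t + pi) = 2 * t + pi + pi) ?sinDpi ?sinDpi ?opprK //; ring. Qed.

Lemma kS_periodic t : kS (t + pi) = kS t.
Proof. by rewrite /kS (_ : 2 * (t + pi) = 2 * t + pi + pi) ?cosDpi ?cosDpi ?opprK //; ring. Qed.

Lemma kd_periodic t : kd (t + pi) = kd t.
Proof. by rewrite /kd kC_periodic. Qed.

Lemma kw_periodic t : kw (t + pi) = kw t.
Proof. by rewrite /kw kC_periodic kd_periodic. Qed.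

Lemma kC_odd t : kC (- t) = - kC t.
Proof. by rewrite /kC mulrN sinN. Qed.

Lemma kS_even t : kS (- t) = kS t.
Proof. by rewrite /kS mulrN cosN. Qed.

Lemma kd_even t : kd (- t) = kd t.
Proof. by rewrite /kd kC_odd sqrrN. Qed.

Lemma kw_even t : kw (- t) = kw t.
Proof. by rewrite /kw kC_odd kd_even sqrrN. Qed.

Lemma continuous_kw : continuous kw.
Proof.
rewrite /kw; have cC := continuous_kC; have cd := continuous_kd.
have d0 t : kd t ^+ 3 != 0 by rewrite expf_neq0 // kd_neq0.
by cont_tac.
Qed.

Lemma is_derive_Cd t : is_derive t 1 (fun t => kC t / kd t) (- (8 * kS t / kd t ^+ 3)).
Proof.
have d0 := kd_neq0 t; have dC := is_derive_kC t; have dd := is_derive_kd t; isd.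
by field: (kd2 t) (kS2 t).
Qed.

End OneDimensionalGaps.

(** * Sturm comparison along the meridians *)

Section MeridianGaps.
Variable R : realType.
Local Notation pi := (@pi R).
Local Notation kC := (@kC R).
Local Notation kS := (@kS R).
Local Notation kd := (@kd R).
Local Notation kw := (@kw R).
Implicit Types (t : R).

(** The potential seen by the [t]-factor of a function whose [x]-factor has frequency squared [k].
    The term [12 kw] is the eigenvalue 2 times the area density [6 kw] of the bipolar surface. *)
Definition kq (k t : R) : R := k / kd t - 12 * kw t.

Lemma continuous_kq k : continuous (kq k).
Proof.
have cd := @continuous_kd R; have cw := @continuous_kw R; have d0 := @kd_neq0 R.
rewrite /kq; cont_tac.
Qed.

Lemma kq_periodic k t : kq k (t + pi) = kq k t.
Proof. by rewrite /kq kd_periodic kw_periodic. Qed.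

Lemma is_derive_Sd t : is_derive t 1 (fun t => kS t / kd t) (6 * kC t / kd t ^+ 3).
Proof.
have d0 := kd_neq0 t; have dC := is_derive_kS t; have dd := is_derive_kd t; isd.
by field: (kd2 t) (kS2 t).
Qed.

Lemma is_derive_invd t : is_derive t 1 (fun t => (kd t)^-1) (- (2 * kS t * kC t / kd t ^+ 3)).
Proof.
have d0 := kd_neq0 t; have dd := is_derive_kd t; isd.
by field.
Qed.

(** The profiles [kC / kd], [kS / kd] and [1 / kd] solve [(kd m')' = kq k m] for [k = 4], [0] and
    [16]. They are the [t]-factors of the coordinates of [tau31], which go with the frequencies 2, 0
    and 4 in [x]; minimality of the bipolar surface is what makes the equations hold. *)
Lemma sturm_Cd t : is_derive t 1 (fun t => kd t * - (8 * kS t / kd t ^+ 3)) (kq 4 t * (kC t / kd t)).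
Proof.
have d0 := kd_neq0 t; have d3 : kd t ^+ 3 != 0 by rewrite expf_neq0.
have dC := is_derive_kC t; have dS := is_derive_kS t; have dd := is_derive_kd t.
isd; rewrite /kq /kw.
by field: (kd2 t) (kS2 t).
Qed.

Lemma sturm_Sd t : is_derive t 1 (fun t => kd t * (6 * kC t / kd t ^+ 3)) (kq 0 t * (kS t / kd t)).
Proof.
have d0 := kd_neq0 t; have d3 : kd t ^+ 3 != 0 by rewrite expf_neq0.
have dC := is_derive_kC t; have dS := is_derive_kS t; have dd := is_derive_kd t.
isd; rewrite /kq /kw.
by field: (kd2 t) (kS2 t).
Qed.

Lemma sturm_invd t :
  is_derive t 1 (fun t => kd t * - (2 * kS t * kC t / kd t ^+ 3)) (kq 16 t * (kd t)^-1).
Proof.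
have d0 := kd_neq0 t; have d3 : kd t ^+ 3 != 0 by rewrite expf_neq0.
have dC := is_derive_kC t; have dS := is_derive_kS t; have dd := is_derive_kd t.
isd; rewrite /kq /kw.
by field: (kd2 t) (kS2 t).
Qed.

Lemma kC_neq0 t : 0 < t < pi / 2 \/ pi / 2 < t < pi -> kC t != 0.
Proof.
rewrite /kC oppr_eq0; case=> /andP[t0 t1].
  by rewrite gt_eqF // sin_gt0_pi //; apply/andP; split; lra.
rewrite -[2 * t](subrK pi) sinDpi oppr_eq0 gt_eqF // sin_gt0_pi //; apply/andP; split; lra.
Qed.

Lemma kS_neq0 t : - (pi / 4) < t < pi / 4 \/ pi / 4 < t < 3 * pi / 4 -> kS t != 0.
Proof.
rewrite /kS; case=> /andP[t0 t1].
  by rewrite gt_eqF // cos_gt0_pihalf //; apply/andP; split; lra.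
rewrite -[2 * t](subrK pi) cosDpi oppr_eq0 gt_eqF // cos_gt0_pihalf //; apply/andP; split; lra.
Qed.

Lemma kC0 : kC 0 = 0. Proof. by rewrite /kC mulr0 sin0 oppr0. Qed.
Lemma kS0 : kS 0 = 1. Proof. by rewrite /kS mulr0 cos0. Qed.

Lemma kC_half : kC (pi / 2) = 0.
Proof. by rewrite /kC (_ : 2 * (pi / 2) = pi) ?sinpi ?oppr0 //; field. Qed.

Lemma kS_half : kS (pi / 2) = -1.
Proof. by rewrite /kS (_ : 2 * (pi / 2) = pi) ?cospi //; field. Qed.

Lemma kC_quarter : kC (pi / 4) = -1.
Proof. by rewrite /kC (_ : 2 * (pi / 4) = pi / 2) ?sin_pihalf //; field. Qed.

Lemma kS_quarter : kS (pi / 4) = 0.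
Proof. by rewrite /kS (_ : 2 * (pi / 4) = pi / 2) ?cos_pihalf //; field. Qed.

Section Function.
Variables f df : R -> R.
Hypothesis df_f : forall t, is_derive t 1 f (df t).
Hypothesis cdf : continuous df.
Hypothesis f_periodic : forall t, f (t + pi) = f t.

Let cf : continuous f := derive1_continuous df_f.
Let pi0 : 0 < pi := pi_gt0 R.

Let df_periodic t : df (t + pi) = df t.
Proof. by rewrite -[RHS]mul1r; apply: derive_periodic => // y; rewrite mul1r. Qed.

Definition menergy k t : R := kd t * df t ^+ 2 + kq k t * f t ^+ 2.

(** Oddness and periodicity force zeros of [f] at 0, [pi / 2] and [pi], which are the zeros of the
    comparison function [kC / kd]. *)
Lemma gap_odd : (forall t, f (- t) = - f t) ->
  0 <= itg 0 pi (menergy 4) /\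
  (itg 0 pi (menergy 4) = 0 -> exists K, forall t, f t = K * (kC t / kd t)).
Proof.
move=> fo; have f0 : f 0 = 0 by have := fo 0; rewrite oppr0; lra.
have f1 : f (pi / 2) = 0.
  by have := f_periodic (- (pi / 2)); rewrite (_ : - (pi / 2) + pi = pi / 2) ?fo; lra.
have d0 := @kd_neq0 R.
have h0 : 0 < pi / 2 by rewrite divr_gt0.
have h1 : pi / 2 < pi by move: pi0; lra.
have [|||||||||||] := @ground_state2 R kd (kq 4) _ _ f df df_f (@is_derive_Cd R) sturm_Cd
  (@continuous_kd R) (@continuous_kq 4) cdf (@kd_gt0 R) 0 (pi / 2) pi h0 h1.
- by move=> t tt; rewrite mulf_neq0 ?invr_eq0 // kC_neq0 //; left.
- by move=> t tt; rewrite mulf_neq0 ?invr_eq0 // kC_neq0 //; right.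
- by rewrite kC0 mul0r.
- by rewrite kC_half mul0r.
- by rewrite -[pi]add0r kC_periodic kC0 mul0r.
- exact: f0.
- exact: f1.
- by rewrite -[pi]add0r f_periodic.
- by rewrite kS0 oppr_eq0 mulf_neq0 ?invr_eq0 ?expf_neq0 // mulf_neq0 // ?oner_eq0.
- by rewrite kS_half oppr_eq0 mulf_neq0 ?invr_eq0 ?expf_neq0 // mulf_neq0 // oppr_eq0 oner_eq0.
- rewrite -[pi]add0r kS_periodic kS0 oppr_eq0 mulf_neq0 ?invr_eq0 ?expf_neq0 // mulf_neq0 // oner_eq0 //.
move=> I0 Eq; split=> // /Eq[K HK]; exists K.
apply: (periodic_eq pi0 f_periodic _ (a := 0)) => [t|t].
  by rewrite kC_periodic kd_periodic.
by rewrite add0r => /HK.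
Qed.

(** The comparison function [1 / kd] has no zero, so no symmetry of [f] is required; the boundary
    terms cancel by periodicity. *)
Lemma gap_any : 0 <= itg 0 pi (menergy 16) /\
  (itg 0 pi (menergy 16) = 0 -> exists K, forall t, f t = K / kd t).
Proof.
have d0 := @kd_neq0 R; have dV0 t : (kd t)^-1 != 0 by rewrite invr_eq0.
have bad t : (kd t)^-1 = 0 -> f t = 0 /\ - (2 * kS t * kC t / kd t ^+ 3) != 0.
  by move=> /eqP; rewrite (negbTE (dV0 t)).
have [] := @ground_state R kd (kq 16) _ _ f df df_f is_derive_invd sturm_invd
  (@continuous_kd R) (@continuous_kq 16) cdf (@kd_gt0 R) 0 pi pi0 (fun t _ => dV0 t) (bad 0) (bad pi).
have kdp : kd pi = kd 0 by rewrite -(kd_periodic 0) add0r.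
have kSp : kS pi = kS 0 by rewrite -(kS_periodic 0) add0r.
have kCp : kC pi = kC 0 by rewrite -(kC_periodic 0) add0r.
have fp : f pi = f 0 by rewrite -(f_periodic 0) add0r.
rewrite kdp kSp kCp fp subrr => I0 Eq; split=> // /Eq[K HK]; exists K.
apply: (periodic_eq pi0 f_periodic _ (a := 0)) => [t|t].
  by rewrite kd_periodic.
by rewrite add0r => /HK.
Qed.

(** Evenness and periodicity give [f] the same value [c] at the three zeros [- pi / 4], [pi / 4],
    [3 pi / 4] of [kS], so the comparison applies to [f - c]. As [kq 0 = - 12 kw], the weighted mean
    condition leaves the correction [- 12 c^2] times the integral of [kw], of the favourable
    sign. *)
Lemma gap_even : (forall t, f (- t) = f t) -> itg 0 pi (fun t => kw t * f t) = 0 ->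
  0 <= itg 0 pi (menergy 0) /\
  (itg 0 pi (menergy 0) = 0 -> exists K, forall t, f t = K * (kS t / kd t)).
Proof.
move=> fe f_mean; have d0 := @kd_neq0 R.
have cd := @continuous_kd R; have cw := @continuous_kw R; have cq := @continuous_kq 0.
pose c := f (pi / 4).
pose u t := f t - c.
have du_u t : is_derive t 1 u (df t) by rewrite /u; isd; rewrite addr0.
have f1 : f (- (pi / 4)) = c by rewrite fe.
have f2 : f (3 * pi / 4) = c.
  by rewrite -f1 -(f_periodic (- (pi / 4))); congr f; lra.
have h0 : - (pi / 4) < pi / 4 by move: pi0; lra.
have h1 : pi / 4 < 3 * pi / 4 by move: pi0; lra.
have E34 : 3 * pi / 4 = - (pi / 4) + pi by lra.
have [|||||||||||] := @ground_state2 R kd (kq 0) _ _ u df du_u is_derive_Sd sturm_Sd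
  cd cq cdf (@kd_gt0 R) (- (pi / 4)) (pi / 4) (3 * pi / 4) h0 h1.
- by move=> t tt; rewrite mulf_neq0 ?invr_eq0 // kS_neq0 //; left.
- by move=> t tt; rewrite mulf_neq0 ?invr_eq0 // kS_neq0 //; right.
- by rewrite kS_even kS_quarter mul0r.
- by rewrite kS_quarter mul0r.
- by rewrite E34 kS_periodic kS_even kS_quarter mul0r.
- by rewrite /u f1 subrr.
- by rewrite /u subrr.
- by rewrite /u f2 subrr.
- by rewrite kC_odd kC_quarter opprK mulr1 mulf_neq0 ?invr_eq0 ?expf_neq0 // pnatr_eq0.
- by rewrite kC_quarter mulrN1 mulNr oppr_eq0 mulf_neq0 ?invr_eq0 ?expf_neq0 // pnatr_eq0.
- by rewrite E34 kC_periodic kC_odd kC_quarter opprK mulr1 mulf_neq0 ?invr_eq0 ?expf_neq0 // pnatr_eq0.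
pose W := itg 0 pi kw.
have W0 : 0 < W.
  rewrite lt_neqAle eq_sym; apply/andP; split; last first.
    by apply: itg_ge0 => //; [exact: ltW | move=> t _; exact/ltW/kw_gt0].
  apply/eqP => /(itg_eq0 pi0 cw (fun t _ => ltW (kw_gt0 t))) /(_ (pi / 2)) H.
  have : kw (pi / 2) = 0 by apply: H; apply/andP; split; move: pi0; lra.
  by apply/eqP; rewrite gt_eqF ?kw_gt0.
have cme : continuous (menergy 0) by rewrite /menergy; cont_tac.
have meT t : menergy 0 (t + pi) = menergy 0 t.
  by rewrite /menergy kd_periodic df_periodic kq_periodic f_periodic.
have -> : itg (- (pi / 4)) (3 * pi / 4) (fun t => kd t * df t ^+ 2 + kq 0 t * u t ^+ 2) =
    itg 0 pi (menergy 0) - 12 * c ^+ 2 * W.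
  rewrite (_ : (fun t => _) = fun t => menergy 0 t + (24 * c * (kw t * f t) - 12 * c ^+ 2 * kw t)).
    have c1 : continuous (fun t => kw t * f t) := continuous_mulf cw cf.
    rewrite itgD // ?itgB // ?itgZ //; [|by cont_tac..].
    have wfT t : kw (t + pi) * f (t + pi) = kw t * f t by rewrite kw_periodic f_periodic.
    rewrite E34 (itg_periodic _ cme meT) (itg_periodic _ c1 wfT) (itg_periodic _ cw (@kw_periodic R)).
    by rewrite f_mean /W; ring.
  by apply/funext => t; rewrite /menergy /kq /u; ring.
have c20 := sqr_ge0 c.
have cW : 0 <= 12 * c ^+ 2 * W by apply: mulr_ge0; [lra | exact: ltW].
move=> I0 Eq; split; first by lra.
move=> IF; have cW0 : 12 * c ^+ 2 * W = 0 by lra.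
have c0 : c = 0.
  by move/eqP: cW0; rewrite mulf_eq0 (gt_eqF W0) orbF mulf_eq0 sqrf_eq0 pnatr_eq0 => /eqP.
have {Eq}[|K HK] := Eq; first by rewrite cW0 IF subrr.
exists K; apply: (periodic_eq pi0 f_periodic _ (a := - (pi / 4))) => [t|t].
  by rewrite kS_periodic kd_periodic.
by rewrite -E34 => /HK; rewrite /u c0 subr0.
Qed.

End Function.
End MeridianGaps.

(** * The spectral gap of the bipolar surface *)

Section KleinGap.
Variable R : realType.
Local Notation pi := (@pi R).
Local Notation kC := (@kC R).
Local Notation kS := (@kS R).
Local Notation kd := (@kd R).
Local Notation kw := (@kw R).
Implicit Types (x t k : R) (F G u v : R * R -> R).

Let pi0 : 0 < pi := pi_gt0 R.
Let h0 : 0 < pi / 2. Proof. by rewrite divr_gt0. Qed.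
Let pi0' := ltW pi0.
Let h0' := ltW h0.

Definition II F : R := itg 0 pi (fun t => itg 0 (pi / 2) (fun x => F (x, t))).

Lemma II_swap F : continuous F -> II F = itg 0 (pi / 2) (fun x => itg 0 pi (fun t => F (x, t))).
Proof. by move=> cF; rewrite /II (itg_fubini h0' pi0' cF). Qed.

Lemma continuous_inner F : continuous F ->
  continuous (fun t => itg 0 (pi / 2) (fun x => F (x, t))).
Proof. by move=> cF; exact: itg_continuous'. Qed.

Lemma continuous_outer F : continuous F ->
  continuous (fun x => itg 0 pi (fun t => F (x, t))).
Proof. by move=> cF; exact: itg_continuous. Qed.

Lemma IID F G : continuous F -> continuous G -> II (fun q => F q + G q) = II F + II G.
Proof.
move=> cF cG; rewrite /II -itgD; [|exact: continuous_inner..].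
by congr itg; apply/funext => t; apply: itgD; exact: continuous_pair2.
Qed.

Lemma IIZ k F : continuous F -> II (fun q => k * F q) = k * II F.
Proof.
move=> cF; rewrite /II -itgZ; last exact: continuous_inner.
by congr itg; apply/funext => t; apply: itgZ; exact: continuous_pair2.
Qed.

Lemma IIB F G : continuous F -> continuous G -> II (fun q => F q - G q) = II F - II G.
Proof.
move=> cF cG; rewrite (_ : (fun q => _) = fun q => F q + -1 * G q).
  by rewrite IID ?IIZ ?mulN1r //; cont_tac.
by apply/funext => q; rewrite mulN1r.
Qed.

Lemma II_sum (I : Type) (r : seq I) (F : I -> R * R -> R) : (forall i, continuous (F i)) ->
  II (fun q => \sum_(i <- r) F i q) = \sum_(i <- r) II (F i).
Proof.
move=> cF; elim: r => [|i r IH].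
  rewrite big_nil /II (_ : (fun t => _) = fun=> 0) ?itg_cst ?mul0r //.
  apply/funext => t; rewrite (_ : (fun x => _) = fun=> 0) ?itg_cst ?mul0r //.
  by apply/funext => x; rewrite big_nil.
rewrite big_cons -IH -IID //; last exact: continuous_bigsum.
by congr II; apply/funext => q; rewrite big_cons.
Qed.

Lemma II_ge0 F : continuous F -> (forall q, 0 <= F q) -> 0 <= II F.
Proof.
move=> cF F0; apply: itg_ge0 => //; first exact: continuous_inner.
by move=> t _; apply: itg_ge0 => //; exact: continuous_pair2.
Qed.

Lemma continuous_kd2 : continuous (fun q : R * R => kd q.2).
Proof. by apply: continuous_compf; [exact: continuous_kd | move=> q; exact: cvg_snd]. Qed.

Lemma continuous_kw2 : continuous (fun q : R * R => kw q.2).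
Proof. by apply: continuous_compf; [exact: continuous_kw | move=> q; exact: cvg_snd]. Qed.

Definition C1 u ux ut : Prop :=
  [/\ continuous u, continuous ux, continuous ut,
      forall x t, is_derive x 1 (fun x => u (x, t)) (ux (x, t)) &
      forall x t, is_derive t 1 (fun t => u (x, t)) (ut (x, t))].

(** Polarised density of the Dirichlet energy minus 2 times the squared norm, for the bipolar
    metric. The Dirichlet part is conformally invariant and is written in the metric dx^2 + dt^2 /
    kd^2. *)
Definition rayleigh u ux ut v vx vt q : R :=
  ux q * vx q / kd q.2 + kd q.2 * (ut q * vt q) - 12 * kw q.2 * (u q * v q).

Lemma continuous_rayleigh u ux ut v vx vt : C1 u ux ut -> C1 v vx vt ->
  continuous (rayleigh u ux ut v vx vt).
Proof.
have cd := continuous_kd2; have cw := continuous_kw2.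
have d0 (q : R * R) : kd q.2 != 0 by exact: kd_neq0.
by move=> [c1 c2 c3 _ _] [c4 c5 c6 _ _]; rewrite /rayleigh; cont_tac.
Qed.

Definition klein_form u ux ut := II (rayleigh u ux ut u ux ut).

Lemma klein_formD u ux ut v vx vt : C1 u ux ut -> C1 v vx vt ->
  II (rayleigh u ux ut v vx vt) = 0 ->
  klein_form (fun q => u q + v q) (fun q => ux q + vx q) (fun q => ut q + vt q) =
  klein_form u ux ut + klein_form v vx vt.
Proof.
move=> Hu Hv H0; have c1 := continuous_rayleigh Hu Hu.
have c2 := continuous_rayleigh Hv Hv; have c3 := continuous_rayleigh Hu Hv.
rewrite /klein_form -IID // -[RHS]addr0 -[0](mulr0 2) -H0 -IIZ // -IID; [|by cont_tac..].
by congr II; apply/funext => q; rewrite /rayleigh; ring.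
Qed.

Section Part.
Variables (k : R) (u ux ut : R * R -> R).
Hypothesis Hu : C1 u ux ut.
Let Fx t := itg 0 (pi / 2) (fun x => ux (x, t) ^+ 2 - k * u (x, t) ^+ 2).
Let Ft x := itg 0 pi (menergy (fun t => u (x, t)) (fun t => ut (x, t)) k).

(** Adding and subtracting [k u^2 / kd] splits the form into a Wirtinger term in [x] with weight
    [1 / kd] and a meridian energy in [t] with potential [kq k]. Each is nonnegative for a suitable
    [k], and both vanish in the equality case. *)
Lemma klein_form_part : (forall t, 0 <= Fx t) -> (forall x, 0 <= Ft x) ->
  0 <= klein_form u ux ut /\
  (klein_form u ux ut = 0 -> (forall t, 0 <= t <= pi -> Fx t = 0) /\
                             (forall x, 0 <= x <= pi / 2 -> Ft x = 0)).
Proof.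
have [c1 c2 c3 _ _] := Hu; have cd := continuous_kd2; have cw := continuous_kw2.
have d0 (q : R * R) : kd q.2 != 0 by exact: kd_neq0.
move=> Fx0 Ft0.
pose G1 q := (kd q.2)^-1 * (ux q ^+ 2 - k * u q ^+ 2).
pose G0 q := ux q ^+ 2 - k * u q ^+ 2.
pose G2 q := kd q.2 * ut q ^+ 2 + (k / kd q.2 - 12 * kw q.2) * u q ^+ 2.
have cG0 : continuous G0 by rewrite /G0; cont_tac.
have cG1 : continuous G1 by rewrite /G1; cont_tac.
have cG2 : continuous G2 by rewrite /G2; cont_tac.
have cFx : continuous Fx := continuous_inner cG0.
have cFt : continuous Ft := continuous_outer cG2.
have ckd := @continuous_kd R; have d0' := @kd_neq0 R.
have E1 : II G1 = itg 0 pi (fun t => (kd t)^-1 * Fx t).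
  congr itg; apply/funext => t; rewrite -itgZ; first by [].
  exact: (@continuous_pair2 R G0 t cG0).
have E2 : II G2 = itg 0 (pi / 2) Ft by rewrite II_swap.
have E : klein_form u ux ut = II G1 + II G2.
  rewrite -IID //; congr II; apply/funext => q; rewrite /rayleigh /G1 /G2; ring.
have cW : continuous (fun t => (kd t)^-1 * Fx t) by cont_tac.
have W0 t : 0 <= (kd t)^-1 * Fx t by rewrite mulr_ge0 // invr_ge0 ltW ?kd_gt0.
have H1 : 0 <= II G1 by rewrite E1; apply: itg_ge0.
have H2 : 0 <= II G2 by rewrite E2; apply: itg_ge0.
rewrite E; split; first exact: addr_ge0.
move=> E0; have I1 : II G1 = 0 by lra.
have I2 : II G2 = 0 by lra.
have c0 : continuous (fun _ : R => 0 : R) by cont_tac.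
split; last first.
  by apply: (eq_closed_itv h0 cFt c0); apply: itg_eq0 => //; rewrite -E2.
move=> t tp; have : (kd t)^-1 * Fx t = 0.
  move: t tp; apply: (eq_closed_itv pi0 cW c0).
  by apply: itg_eq0 => //; rewrite -E1.
by move=> /eqP; rewrite mulf_eq0 invr_eq0 (negbTE (d0' t)) => /eqP.
Qed.

End Part.

(** Antiperiodicity with step [pi / 2] gives the Wirtinger constant [2^2 = 4], which is the index of
    the meridian gap for odd functions. In the equality case the profiles at [x = 0] and
    [x = pi / 4] determine [u]. *)
Lemma klein_form_odd u ux ut : C1 u ux ut ->
  (forall x t, u (x + pi / 2, t) = - u (x, t)) ->
  (forall x t, u (x, t + pi) = u (x, t)) ->
  (forall x t, u (x, - t) = - u (x, t)) ->
  0 <= klein_form u ux ut /\ (klein_form u ux ut = 0 ->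
  exists A B, forall x t, u (x, t) = (A * cos (2 * x) + B * sin (2 * x)) * (kC t / kd t)).
Proof.
move=> Hu ux2 uT uo; have [c1 c2 c3 d1 d2] := Hu.
have W t := wirtinger_antiperiodic (fun x => d1 x t) (@continuous_pair2 R ux t c2) h0 (ux2^~ t).
have k2 : pi / (pi / 2) = 2 by rewrite invf_div mulrCA divff ?mulr1 // gt_eqF.
rewrite k2 /= in W.
have V x := gap_odd (fun t => d2 x t) (@continuous_pair1 R ut x c3) (uT x) (uo x).
have [||H0 H1] := @klein_form_part 4 u ux ut Hu.
- by move=> t; have [] := W t; rewrite (_ : 2 ^+ 2 = 4) //; ring.
- by move=> x; have [] := V x.
split=> // /H1[{H1}Hx Ht].
have [K HK] : exists K, forall t, u (0, t) = K * (kC t / kd t).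
  by have [_] := V 0; apply; apply: Ht; rewrite lexx.
have [L HL] : exists L, forall t, u (pi / 2 / 2, t) = L * (kC t / kd t).
  by have [_] := V (pi / 2 / 2); apply; apply: Ht; apply/andP; split; move: pi0; lra.
exists K, L => x; apply: (periodic_eq pi0 (uT x) _ (a := 0)) => [t|t].
  by rewrite kC_periodic kd_periodic.
rewrite add0r => tp; have [_ /(_ _ x) ->] := W t; last first.
  by rewrite (_ : 2 ^+ 2 = 4) ?Hx //; ring.
by rewrite HK HL; ring.
Qed.

(** Period [pi / 2] and mean zero in [x] give the Wirtinger constant [4^2 = 16], matched by the
    meridian gap with the positive profile [1 / kd]. *)
Lemma klein_form_mean0 u ux ut : C1 u ux ut ->
  (forall x t, u (x + pi / 2, t) = u (x, t)) ->
  (forall x t, u (x, t + pi) = u (x, t)) ->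
  (forall t, itg 0 (pi / 2) (fun x => u (x, t)) = 0) ->
  0 <= klein_form u ux ut /\ (klein_form u ux ut = 0 ->
  exists A B, forall x t, u (x, t) = (A * cos (4 * x) + B * sin (4 * x)) / kd t).
Proof.
move=> Hu ux2 uT u0; have [c1 c2 c3 d1 d2] := Hu.
have W t := wirtinger_mean0 (fun x => d1 x t) (@continuous_pair2 R ux t c2) h0 (ux2^~ t) (u0 t).
have k2 : 2 * pi / (pi / 2) = 4.
  by rewrite invf_div mulrACA divff ?gt_eqF // mulr1 -natrM.
rewrite k2 /= in W.
have V x := gap_any (fun t => d2 x t) (@continuous_pair1 R ut x c3) (uT x).
have [||H0 H1] := @klein_form_part 16 u ux ut Hu.
- by move=> t; have [] := W t; rewrite (_ : 4 ^+ 2 = 16) //; ring.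
- by move=> x; have [] := V x.
split=> // /H1[{H1}Hx Ht].
have [K HK] : exists K, forall t, u (0, t) = K / kd t.
  by have [_] := V 0; apply; apply: Ht; rewrite lexx.
have [L HL] : exists L, forall t, u (pi / 2 / 4, t) = L / kd t.
  by have [_] := V (pi / 2 / 4); apply; apply: Ht; apply/andP; split; move: pi0; lra.
exists K, L => x; apply: (periodic_eq pi0 (uT x) _ (a := 0)) => [t|t].
  by rewrite kd_periodic.
rewrite add0r => tp; have [_ /(_ _ x) ->] := W t; last first.
  by rewrite (_ : 4 ^+ 2 = 16) ?Hx //; ring.
by rewrite HK HL; ring.
Qed.

End KleinGap.

Section KleinGapTheorem.
Variable R : realType.
Local Notation pi := (@pi R).
Local Notation kC := (@kC R).
Local Notation kS := (@kS R).
Local Notation kd := (@kd R).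
Local Notation kw := (@kw R).
Implicit Types (x t k : R) (F G u v : R * R -> R).

Let pi0 : 0 < pi := pi_gt0 R.
Let h0 : 0 < pi / 2. Proof. by rewrite divr_gt0. Qed.
Let pi0' := ltW pi0.
Let h0' := ltW h0.

(** The sector of frequency 0. The mean condition excludes the constants, on which the form is
    negative. *)
Lemma klein_form_meridian (m dm : R -> R) :
  (forall t, is_derive t 1 m (dm t)) -> continuous dm ->
  (forall t, m (t + pi) = m t) -> (forall t, m (- t) = m t) ->
  itg 0 pi (fun t => kw t * m t) = 0 ->
  0 <= klein_form (fun q => m q.2) (fun=> 0) (fun q => dm q.2) /\
  (klein_form (fun q => m q.2) (fun=> 0) (fun q => dm q.2) = 0 ->
   exists K, forall t, m t = K * (kS t / kd t)).
Proof.
move=> dmm cdm mT me m0; have [H0 H1] := gap_even dmm cdm mT me m0.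
have cm := derive1_continuous dmm.
have cd := @continuous_kd R; have cq := @continuous_kq R 0.
have cme : continuous (menergy m dm 0) by rewrite /menergy; cont_tac.
have -> : klein_form (fun q => m q.2) (fun=> 0) (fun q => dm q.2) =
    pi / 2 * itg 0 pi (menergy m dm 0).
  rewrite /klein_form /II -itgZ //; congr itg; apply/funext => t.
  rewrite (_ : (fun x => _) = fun=> menergy m dm 0 t) ?itg_cst ?subr0 1?mulrC //.
  by apply/funext => x; rewrite /rayleigh /menergy /kq /=; ring.
split; first by rewrite mulr_ge0.
by move=> /eqP; rewrite mulf_eq0 (gt_eqF h0) => /eqP.
Qed.

(** The glide reflection ties parity in [t] to translation by [pi / 2] in [x]: the odd part [o] is
    antiperiodic and the even part [e] periodic. With [m] the mean of [e] in [x] and [r = e - m],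
    the pieces [o], [r], [m] are orthogonal for the form, and each falls under one of the three
    preceding gaps. *)
Lemma klein_gap u ux ut : C1 u ux ut ->
  (forall x t, u (x + pi / 2, - t) = u (x, t)) ->
  (forall x t, u (x, t + pi) = u (x, t)) ->
  II (fun q => kw q.2 * u q) = 0 ->
  0 <= klein_form u ux ut /\
  (klein_form u ux ut = 0 -> exists A B C D E, forall x t,
    u (x, t) = A * (kS t / kd t) + (B * cos (4 * x) + C * sin (4 * x)) / kd t
             + (D * cos (2 * x) + E * sin (2 * x)) * (kC t / kd t)).
Proof.
move=> Hu uk uT u0; have [cu cux cut dux dut] := Hu.
have utT x t : ut (x, t + pi) = ut (x, t).
  have uT1 s : u (x, s + pi) = 1 * u (x, s) by rewrite mul1r uT.
  by rewrite -[RHS]mul1r; exact: (derive_periodic (dut x) uT1).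
have uxT x t : ux (x, t + pi) = ux (x, t).
  have [_ <-] := dux x (t + pi); have [_ <-] := dux x t.
  by congr ('D_1 _ x); apply/funext => y; rewrite uT.
have crefl (F : R * R -> R) : continuous F -> continuous (fun q => F (q.1, - q.2)).
  move=> cF q; apply: (@continuous_comp _ _ _ (fun q => (q.1, - q.2)) F); last exact: cF.
  by apply: (@cvg_pair _ _ _ (nbhs q) (nbhs q.1) (nbhs (- q.2)) _ _ _ fst (fun q => - q.2));
    [exact: cvg_fst | apply: cvgN; exact: cvg_snd].
have dut' x t : is_derive t 1 (fun t => u (x, - t)) (- ut (x, - t)).
  have dg : is_derive t 1 (fun y => - y) (-1) by isd.
  by rewrite -mulrN1; exact: (is_derive_compf (f := fun y => - y) (dut x (- t)) dg).
pose o q := 2^-1 * (u q + - u (q.1, - q.2)).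
pose ox q := 2^-1 * (ux q + - ux (q.1, - q.2)).
pose ot q := 2^-1 * (ut q + ut (q.1, - q.2)).
pose e q := 2^-1 * (u q + u (q.1, - q.2)).
pose ex q := 2^-1 * (ux q + ux (q.1, - q.2)).
pose et q := 2^-1 * (ut q + - ut (q.1, - q.2)).
have cru := crefl _ cu; have crux := crefl _ cux; have crut := crefl _ cut.
have Ho : C1 o ox ot.
  split; try by rewrite /o /ox /ot; cont_tac.
  - by move=> x t; rewrite /o /ox /=; isd; ring.
  - by move=> x t; rewrite /o /ot /=; isd; ring.
have He : C1 e ex et.
  split; try by rewrite /e /ex /et; cont_tac.
  - by move=> x t; rewrite /e /ex /=; isd; ring.
  - by move=> x t; rewrite /e /et /=; isd; ring.
have uk' x t : u (x + pi / 2, t) = u (x, - t) by rewrite -{1}(opprK t) uk.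
have oh x t : o (x + pi / 2, t) = - o (x, t).
  by rewrite /o /= uk' uk; ring.
have eh x t : e (x + pi / 2, t) = e (x, t).
  by rewrite /e /= uk' uk; ring.
have rT (F : R * R -> R) x t : (forall x t, F (x, t + pi) = F (x, t)) -> F (x, - (t + pi)) = F (x, - t).
  by move=> FT; rewrite opprD -(FT x (- t - pi)) subrK.
have oT x t : o (x, t + pi) = o (x, t) by rewrite /o /= uT (rT u).
have eT x t : e (x, t + pi) = e (x, t) by rewrite /e /= uT (rT u).
have oo x t : o (x, - t) = - o (x, t) by rewrite /o /= opprK; ring.
have ee x t : e (x, - t) = e (x, t) by rewrite /e /= opprK; ring.
pose m t := (pi / 2)^-1 * itg 0 (pi / 2) (fun x => e (x, t)).
pose dm t := (pi / 2)^-1 * itg 0 (pi / 2) (fun x => et (x, t)).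
have [ce cex cet dex det] := He.
have dI t : is_derive t 1 (fun t => itg 0 (pi / 2) (fun x => e (x, t))) (itg 0 (pi / 2) (fun x => et (x, t))).
  apply: (is_derive_itg_param (F := fun q => e (q.2, q.1)) (Fx := fun q => et (q.2, q.1)) h0').
  - by move=> s; exact: (@continuous_pair2 R e s ce).
  - exact: (continuous_swap cet).
  - by move=> s x; exact: det.
have dmm t : is_derive t 1 m (dm t).
  by rewrite /m /dm; isd; rewrite mulr0 addr0.
have cdm : continuous dm.
  by have := itg_continuous' h0' cet => c; rewrite /dm; cont_tac.
have cm := derive1_continuous dmm.
have mT t : m (t + pi) = m t.
  by congr (_ * itg _ _ _); apply/funext => x; rewrite eT.
have me t : m (- t) = m t.
  by congr (_ * itg _ _ _); apply/funext => x; rewrite ee.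
have Hm : C1 (fun q => m q.2) (fun=> 0) (fun q => dm q.2).
  split.
  - by apply: (continuous_compf cm) => q; exact: cvg_snd.
  - exact: continuous_cstf.
  - by apply: (continuous_compf cdm) => q; exact: cvg_snd.
  - by move=> x t /=; exact: is_derive_cstf.
  - by move=> x t /=; exact: dmm.
pose r q := e q + -1 * m q.2.
pose rx q := ex q + -1 * (0 : R).
pose rt q := et q + -1 * dm q.2.
have Hr : C1 r rx rt.
  have [c1 c2 c3 d1 d2] := Hm; split; try by rewrite /r /rx /rt; cont_tac.
  - by move=> x t; rewrite /r /rx /=; isd; rewrite mulr0.
  - by move=> x t; rewrite /r /rt /=; isd; ring.
have hV : (pi / 2)^-1 * (pi / 2) = 1 by rewrite mulVf // gt_eqF.
have r0 t : itg 0 (pi / 2) (fun x => r (x, t)) = 0.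
  rewrite (_ : (fun x => _) = fun x => e (x, t) + - m t); last first.
    by apply/funext => x; rewrite /r mulN1r.
  rewrite itgD; [|exact: (@continuous_pair2 R e t ce)|exact: continuous_cstf].
  by rewrite itg_cst /m subr0 mulNr mulrAC hV mul1r subrr.
have rt0 t : itg 0 (pi / 2) (fun x => rt (x, t)) = 0.
  rewrite (_ : (fun x => _) = fun x => et (x, t) + - dm t); last first.
    by apply/funext => x; rewrite /rt mulN1r.
  rewrite itgD; [|exact: (@continuous_pair2 R et t cet)|exact: continuous_cstf].
  by rewrite itg_cst /dm subr0 mulNr mulrAC hV mul1r subrr.
have rh x t : r (x + pi / 2, t) = r (x, t) by rewrite /r eh.
have rT' x t : r (x, t + pi) = r (x, t) by rewrite /r eT /= mT.
have [cr crx crt _ _] := Hr; have [co cox cot _ _] := Ho.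
have cw2 := @continuous_kw2 R; have cd2 := @continuous_kd2 R.
have cw := @continuous_kw R; have cd := @continuous_kd R.
have d0 := @kd_neq0 R.
have cm2 : continuous (fun q : R * R => m q.2) by case: Hm.
(* The mixed density is odd and periodic in [t]. *)
have Boe : II (rayleigh o ox ot e ex et) = 0.
  have cB := continuous_rayleigh Ho He; rewrite II_swap //.
  rewrite (_ : (fun x => _) = fun=> 0) ?itg_cst ?mul0r //; apply/funext => x.
  apply: itg_odd => // [|t|t]; first exact: (@continuous_pair1 R _ x cB).
  - rewrite /rayleigh /o /ox /ot /e /ex /et /= kd_periodic kw_periodic.
    by rewrite uT uxT utT !(rT u) ?(rT ux) ?(rT ut).
  - by rewrite /rayleigh /o /ox /ot /e /ex /et /= kd_even kw_even !opprK; ring.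
have Brm : II (rayleigh r rx rt (fun q => m q.2) (fun=> 0) (fun q => dm q.2)) = 0.
  rewrite /II (_ : (fun t => _) = fun=> 0) ?itg_cst ?mul0r //; apply/funext => t.
  have c1 := @continuous_pair2 R r t cr; have c2 := @continuous_pair2 R rt t crt.
  rewrite (_ : (fun x => _) = fun x => kd t * dm t * rt (x, t) - 12 * kw t * m t * r (x, t)).
    by rewrite itgB ?itgZ // ?r0 ?rt0 ?mulr0 ?subrr //; cont_tac.
  by apply/funext => x; rewrite /rayleigh /=; ring.
(* The mean condition on [u] passes to [m]: [o] is odd in [t] and [r] has mean zero in [x], so
   neither contributes. *)
have kwm : itg 0 pi (fun t => kw t * m t) = 0.
  have cwm : continuous (fun q : R * R => kw q.2 * m q.2) by cont_tac.
  have cwr : continuous (fun q => kw q.2 * r q) by cont_tac.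
  have cwo : continuous (fun q => kw q.2 * o q) by cont_tac.
  have E : II (fun q => kw q.2 * u q) = II (fun q => kw q.2 * o q) + (II (fun q => kw q.2 * r q) + II (fun q => kw q.2 * m q.2)).
    rewrite -!IID //; last by cont_tac.
    by congr II; apply/funext => -[x t]; rewrite /o /r /e /=; field.
  have Eo : II (fun q => kw q.2 * o q) = 0.
    rewrite II_swap // (_ : (fun x => _) = fun=> 0) ?itg_cst ?mul0r //; apply/funext => x.
    apply: itg_odd => // [|t|t]; first exact: (@continuous_pair1 R _ x cwo).
    - by rewrite /= kw_periodic oT.
    - by rewrite /= kw_even oo mulrN.
  have Er : II (fun q => kw q.2 * r q) = 0.
    rewrite /II (_ : (fun t => _) = fun=> 0) ?itg_cst ?mul0r //; apply/funext => t /=.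
    by rewrite itgZ ?r0 ?mulr0 //; exact: (@continuous_pair2 R r t cr).
  move: E; rewrite u0 Eo Er !add0r /II /= => /esym E.
  have : pi / 2 * itg 0 pi (fun t => kw t * m t) = 0.
    rewrite -[RHS]E -itgZ; last by cont_tac.
    by congr itg; apply/funext => t; rewrite itg_cst subr0 mulrC.
  by move=> /eqP; rewrite mulf_eq0 (gt_eqF h0) => /eqP.
have Ee : klein_form e ex et = klein_form r rx rt + klein_form (fun q => m q.2) (fun=> 0) (fun q => dm q.2).
  rewrite -(klein_formD Hr Hm Brm); congr klein_form; apply/funext => q.
  - by rewrite /r; ring.
  - by rewrite /rx; ring.
  - by rewrite /rt; ring.
have Eu : klein_form u ux ut = klein_form o ox ot + klein_form e ex et.
  rewrite -(klein_formD Ho He Boe); congr klein_form; apply/funext => -[x t].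
  - by rewrite /o /e /=; field.
  - by rewrite /ox /ex /=; field.
  - by rewrite /ot /et /=; field.
have [Po So] := klein_form_odd Ho oh oT oo.
have [Pr Sr] := klein_form_mean0 Hr rh rT' r0.
have [Pm Sm] := klein_form_meridian dmm cdm mT me kwm.
rewrite Eu Ee; split; first by rewrite !addr_ge0.
move=> E0; have {So}[|D [E HDE]] := So; first by lra.
have {Sr}[|B [C HBC]] := Sr; first by lra.
have {Sm}[|A HA] := Sm; first by lra.
exists A, B, C, D, E => x t.
transitivity (m t + r (x, t) + o (x, t)); last by rewrite HA HBC HDE.
by rewrite /r /o /e /=; field.
Qed.

End KleinGapTheorem.

(** * The complete elliptic integral *)

Section Elliptic.
Variable R : realType.
Local Notation pi := (@pi R).
Local Notation kC := (@kC R).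
Local Notation kS := (@kS R).
Local Notation kd := (@kd R).
Local Notation kw := (@kw R).
Implicit Types (x t k : R).

Let pi0 : 0 < pi := pi_gt0 R.
Let modulus : R := 2 * Num.sqrt 2 / 3.

Let modulus2 : modulus ^+ 2 = 8 / 9.
Proof. by rewrite /modulus expr_div_n exprMn sqr_sqrtr //; field. Qed.

Let e a : R := Num.sqrt (1 - modulus ^+ 2 * sin a ^+ 2).

Let ce : continuous e.
Proof. by rewrite /e; have := @sqrt_continuous R => ?; cont_tac. Qed.

Lemma ellipticE_itg : ellipticE modulus = itg 0 (pi / 2) e.
Proof. by rewrite /ellipticE Rintegral_itg // ltW // divr_gt0. Qed.

Let eT a : e (a + pi) = e a.
Proof. by rewrite /e sinDpi sqrrN. Qed.

Let e_even a : e (- a) = e a.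
Proof. by rewrite /e sinN sqrrN. Qed.

Lemma itg_2pi : itg 0 (2 * pi) e = 4 * itg 0 (pi / 2) e.
Proof.
have h1 : itg 0 (pi / 2) e = itg (- (pi / 2)) 0 e.
  by rewrite -[in LHS](_ : (fun x => e (- x)) = e) ?itg_opp ?oppr0 //; apply/funext.
have h2 : itg (- (pi / 2)) (- (pi / 2) + pi) e = itg 0 pi e by exact: itg_periodic.
have h3 : itg pi (pi + pi) e = itg 0 pi e by exact: itg_periodic.
have h4 := itg_cat 0 pi (pi + pi) ce.
have h5 := itg_cat (- (pi / 2)) 0 (pi / 2) ce.
have E1 : - (pi / 2) + pi = pi / 2 by lra.
have E2 : 2 * pi = pi + pi by ring.
by rewrite E1 in h2; rewrite E2; lra.
Qed.

(* Gauss's transformation: [sin (gauss t) = 3 s / (2 + s ^ 2)] for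
   [s = sin (2 t)], which turns the modulus 2 sqrt 2 / 3 into 1 / 2. *)
Let num t : R := - (kC t * kS t * (3 - kd t)).
Let den t : R := kS t ^+ 2 * kd t + 3 * kC t ^+ 2.
Let gauss t : R := 2 * t + atan (num t / den t).

Let den_gt0 t : 0 < den t.
Proof. by rewrite /den; have := kd_gt0 t; have := kS2 t; have := kC2_le1 t; nra. Qed.

Let C2_gt0 t : 0 < 2 + kC t ^+ 2.
Proof. by rewrite ltr_wpDr ?sqr_ge0. Qed.

Let num_den t : den t ^+ 2 + num t ^+ 2 = (2 + kC t ^+ 2) ^+ 2.
Proof. by rewrite /den /num; ring: (kd2 t) (kS2 t). Qed.

Let sin_gauss t : sin (gauss t) = 3 * - kC t / (2 + kC t ^+ 2).
Proof.
have D0 := den_gt0 t; have C0 := C2_gt0 t.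
have D0' : den t != 0 by rewrite gt_eqF.
have C0' : 2 + kC t ^+ 2 != 0 by rewrite gt_eqF.
have ca : cos (atan (num t / den t)) = den t / (2 + kC t ^+ 2).
  rewrite cos_atan; have -> : 1 + (num t / den t) ^+ 2 = ((2 + kC t ^+ 2) / den t) ^+ 2.
    by rewrite !expr_div_n -num_den; field.
  by rewrite sqrtr_sqr gtr0_norm ?divr_gt0// invf_div.
have sa : sin (atan (num t / den t)) = num t / (2 + kC t ^+ 2).
  have ca0 : cos (atan (num t / den t)) != 0 by rewrite ca gt_eqF// divr_gt0.
  by rewrite -[LHS](divfK ca0) -/(tan _) atanK ca; field; rewrite C0' D0'.
rewrite /gauss sinD ca sa (_ : sin (2 * t) = - kC t); last exact: esym (opprK _).
rewrite -/(kS t) /num /den.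
by field: (kd2 t) (kS2 t).
Qed.

Let e_gauss t : e (gauss t) = (2 - kC t ^+ 2) / (2 + kC t ^+ 2).
Proof.
have C0' : 2 + kC t ^+ 2 != 0 by rewrite gt_eqF.
have C1 := kC2_le1 t.
rewrite /e sin_gauss modulus2.
have -> : 1 - 8 / 9 * (3 * - kC t / (2 + kC t ^+ 2)) ^+ 2 = ((2 - kC t ^+ 2) / (2 + kC t ^+ 2)) ^+ 2.
  by field.
by rewrite sqrtr_sqr ger0_norm // divr_ge0 ?(ltW (C2_gt0 t)) // subr_ge0; lra.
Qed.

Let derive_gauss t : is_derive t 1 gauss (6 * (2 - kC t ^+ 2) / ((2 + kC t ^+ 2) * kd t)).
Proof.
have C0' : 2 + kC t ^+ 2 != 0 by rewrite gt_eqF.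
have d0 := kd_neq0 t; have D0 : den t != 0 by rewrite gt_eqF.
have dC := is_derive_kC t; have dS := is_derive_kS t; have dd := is_derive_kd t.
have dnum : is_derive t 1 num (- ((2 * kC t ^+ 2 - 2 * kS t ^+ 2) * (3 - kd t) - kC t * kS t * (2 * kS t * kC t / kd t))).
  by rewrite /num; isd; field.
have dden : is_derive t 1 den (4 * kS t * kC t * kd t + kS t ^+ 2 * (2 * kS t * kC t / kd t) - 12 * kC t * kS t).
  by rewrite /den; isd; field.
have dq : is_derive t 1 (fun t => num t / den t) _ := is_derive_mulf dnum (is_derive_invf D0 dden).
have da := is_derive_compf (f := fun t => num t / den t) (is_derive1_atan (num t / den t)) dq.
have d2t : is_derive t 1 (fun t : R => 2 * t) 2 by isd; ring.
notypeclasses refine (is_derive_conv (is_derive_addf d2t da) _).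
have -> : 1 + (num t / den t) ^+ 2 = ((2 + kC t ^+ 2) / den t) ^+ 2.
  by rewrite !expr_div_n -num_den; field.
set dN := - (_ - kC t * kS t * _); set dD := _ - 12 * kC t * kS t.
transitivity (2 + (dN * den t - num t * dD) / (2 + kC t ^+ 2) ^+ 2).
  by field; rewrite D0 C0'.
rewrite /dN /dD /num /den.
by field: (kd2 t) (kS2 t); rewrite d0; exact: C0'.
Qed.

(** Up to the factor 1/2, [kw] is the pullback of the elliptic integrand by [gauss] plus the
    derivative of an algebraic function vanishing at 0 and [pi]. As [gauss] maps [[0, pi]] to
    [[0, 2 pi]], four complete integrals result. *)
Lemma itg_kw : itg 0 pi kw = 2 * ellipticE modulus.
Proof.
have [A dA] := antiderivative ce.
have dC := @is_derive_kC R; have dS := @is_derive_kS R; have dd := @is_derive_kd R.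
(* The algebraic term accounts for the difference between [2 kw] and
   [6 (2 - kC^2)^2 / ((2 + kC^2)^2 kd)], the derivative of [A (gauss t)]. *)
pose W t : R := 2^-1 * (A (gauss t) + 2 / 3 * (kC t * kS t * (kd t / (2 + kC t ^+ 2) + (kd t)^-1))).
have dW t : is_derive t 1 W (kw t).
  have C0' : 2 + kC t ^+ 2 != 0 by rewrite gt_eqF.
  have d0 := kd_neq0 t.
  have dAg := is_derive_compf (dA (gauss t)) (derive_gauss t).
  rewrite /W; isd; rewrite ?e_gauss /kw => //.
  by field: (kd2 t) (kS2 t); rewrite d0; exact: C0'.
have g0 : gauss 0 = 0 by rewrite /gauss /num kC0 !mul0r oppr0 mul0r atan0 mulr0 addr0.
have gpi : gauss pi = 2 * pi.
  by rewrite /gauss /num -{2}[pi]add0r kC_periodic kC0 !mul0r oppr0 mul0r atan0 addr0.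
rewrite (itgE _ _ dW) /W g0 gpi.
have -> : kC pi = 0 by rewrite -[pi]add0r kC_periodic kC0.
rewrite kC0 !mul0r !mulr0 !addr0 -mulrBr -(itgE _ _ dA) itg_2pi ellipticE_itg.
by field.
Qed.

End Elliptic.

(** * Hersch's balancing argument *)

Section LogarithmBound.
Variable R : realType.
Implicit Types (x y a b k s : R).

Lemma ln_ge x : 0 < x -> 1 - x^-1 <= ln x.
Proof.
move=> x0; have xV0 : 0 < x^-1 by rewrite invr_gt0.
have := @le_ln1Dx R (x^-1 - 1); rewrite addrCA subrr addr0 lnV ?posrE // => H.
have := H ltac:(lra); lra.
Qed.

Lemma ln_le x : 0 < x -> ln x <= x - 1.
Proof. by move=> x0; have := @le_ln1Dx R (x - 1); rewrite addrCA subrr addr0 => H; apply: H; lra. Qed.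

Lemma continuous_lnf (T : topologicalType) (f : T -> R) :
  (forall z, 0 < f z) -> continuous f -> continuous (fun z => ln (f z)).
Proof. by move=> f0 cf x; apply: (@continuous_comp T R R f (@ln R)); [exact: cf | exact: continuous_ln]. Qed.

Let zlog s k z : R := z * ln (s + k ^+ 2 * z ^+ 2).

(** Dropping [s] leaves [2 z ln (k z)], and [ln x >= 1 - 1 / x] bounds it below by [2 z - 2 / k],
    independently of [s]. *)
Let zlog_ge s k z : 0 < s -> 0 < k -> 0 <= z -> - (2 / k) <= zlog s k z.
Proof.
move=> s0 k0; rewrite le_eqVlt => /predU1P[<-|z0].
  by rewrite /zlog mul0r oppr_le0 divr_ge0 // ltW.
have kz : 0 < k * z by exact: mulr_gt0.
have H1 : 1 - (k * z)^-1 <= ln (k * z) := ln_ge kz.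
have H2 : ln ((k * z) ^+ 2) <= ln (s + k ^+ 2 * z ^+ 2).
  rewrite ler_ln ?posrE ?exprn_gt0 //; first by rewrite exprMn; lra.
  by rewrite ltr_wpDr // mulr_ge0 ?sqr_ge0.
rewrite lnXn // mulr2n in H2.
apply: (@le_trans _ _ (z * (2 * (1 - (k * z)^-1)))).
  rewrite (_ : z * _ = 2 * z - 2 / k); last by field; rewrite !gt_eqF.
  by lra.
by rewrite ler_wpM2l ?(ltW z0) //; lra.
Qed.

Let zlogN s k z : zlog s k (- z) = - zlog s k z.
Proof. by rewrite /zlog sqrrN mulNr. Qed.

(* The singularity of the logarithm is integrable along a line, uniformly in [s]. *)
Lemma itg_ln_ge s k a b y : 0 < s -> 0 < k -> a <= y <= b ->
  - (4 / k) - 2 * (b - a) <= itg a b (fun x => ln (s + k ^+ 2 * (x - y) ^+ 2)).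
Proof.
move=> s0 k0 /andP[ay yb]; have ab := le_trans ay yb.
have p0 x : 0 < s + k ^+ 2 * (x - y) ^+ 2 by rewrite ltr_wpDr // mulr_ge0 ?sqr_ge0.
have p1 x : s + k ^+ 2 * (x - y) ^+ 2 != 0 by rewrite gt_eqF.
pose g x := ln (s + k ^+ 2 * (x - y) ^+ 2).
pose q x := 2 * (k ^+ 2 * (x - y) ^+ 2) / (s + k ^+ 2 * (x - y) ^+ 2).
have cg : continuous g by apply: continuous_lnf => //; cont_tac.
have cq : continuous q by rewrite /q; cont_tac.
(* Integration by parts: [(x - y)] times the logarithm has as derivative the logarithm plus a
   remainder [q] that is at most 2. *)
have dG x : is_derive x 1 (fun x => zlog s k (x - y)) (g x + q x).
  have dp : is_derive x 1 (fun x => s + k ^+ 2 * (x - y) ^+ 2) (2 * k ^+ 2 * (x - y)) by isd; ring.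
  have dl := is_derive_compf (f := fun x => s + k ^+ 2 * (x - y) ^+ 2) (is_derive1_ln (p0 x)) dp.
  rewrite /zlog; isd; rewrite /g /q; have := p1 x; set P := s + _ => P0.
  by field.
have q2 x : q x <= 2.
  by rewrite /q ler_pdivrMr //; lra.
have H : itg a b q <= 2 * (b - a).
  by rewrite -itg_cst; apply: le_itg => //; exact: continuous_cstf.
have E := itgE a b dG; rewrite itgD // in E.
have H1 : - (2 / k) <= zlog s k (b - y) by apply: zlog_ge => //; rewrite subr_ge0.
have H2 : - (2 / k) <= zlog s k (y - a) by apply: zlog_ge => //; rewrite subr_ge0.
rewrite -(opprB a y) zlogN in H2.
rewrite -/g (_ : 4 / k = 2 * (2 / k)); last by rewrite mulrA -natrM.
by move: H H1 H2 E; lra.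
Qed.

End LogarithmBound.

(** * A lower bound for the integral of the logarithm along the parallels *)

Section Balancing.
Variable R : realType.
Variable n : nat.
Local Notation pi := (@pi R).
Local Notation kw := (@kw R).
Variables (f fx : 'I_n -> R * R -> R).
Hypothesis cf : forall j, continuous (f j).
Hypothesis cfx : forall j, continuous (fx j).
Hypothesis dfx : forall j (x t : R), is_derive x 1 (fun x => f j (x, t)) (fx j (x, t)).
Hypothesis fx_neq0 : forall q, exists j, fx j q != 0.
Implicit Types (x y t a b l : R) (q : R * R) (c : 'rV[R]_n).

Let pi0 : 0 < pi := pi_gt0 R.
Let h0 : 0 < pi / 2. Proof. by rewrite divr_gt0. Qed.
Let pi0' := ltW pi0.
Let h0' := ltW h0.

Definition dist2 c q : R := \sum_j (f j q - c 0 j) ^+ 2.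

Lemma dist2_ge0 c q : 0 <= dist2 c q.
Proof. by apply: sumr_ge0 => j _; exact: sqr_ge0. Qed.

Lemma dist2_ge c q j : (f j q - c 0 j) ^+ 2 <= dist2 c q.
Proof. by rewrite /dist2 (bigD1 j) //= lerDl sumr_ge0 // => i _; exact: sqr_ge0. Qed.

Lemma continuous_dist2 c : continuous (dist2 c).
Proof. apply: continuous_bigsum => j; have cfj : continuous (f j) by exact: cf. cont_tac. Qed.

(** The number [l] is both the radius of the window and the expansion rate, so that a single small
    parameter has to be chosen uniformly. *)
Let expanding l q := exists j, forall x y, `|x - q.1| <= l -> `|y - q.1| <= l ->
  l * `|x - y| <= `|f j (x, q.2) - f j (y, q.2)|.

(** Near a point where [fx j] does not vanish, the mean value theorem makes [f j] expand at a rate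
    close to [|fx j|]; compactness of the closed fundamental rectangle yields one rate for all
    points. *)
Lemma uniformly_expanding : exists2 l, 0 < l & forall x t, 0 <= x <= pi / 2 -> 0 <= t <= pi -> expanding l (x, t).
Proof.
have cK : compact (`[0, pi / 2] `*` `[0, pi] : set (R * R)).
  by apply: compact_setX; exact: segment_compact.
have /compact_near_coveringP nc := cK.
have : \forall l \near (0:R)^'+, (`[0, pi / 2] `*` `[0, pi] : set (R * R)) `<=` expanding l.
  apply: (nc R ((0:R)^'+) expanding) => q0 _.
  have [j fj0] := fx_neq0 q0.
  have m0 : 0 < `|fx j q0| / 2 by rewrite divr_gt0 // normr_gt0.
  have /cvgrPdist_lt /(_ _ m0) /nbhs_ballP[e /= e0 He] := @cfx j q0.
  exists (ball q0 (e / 2), [set l | 0 < l /\ l < Num.min (e / 8) (`|fx j q0| / 2)]) => /=.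
    split; first by apply/nbhs_ballP; exists (e / 2) => //=; rewrite divr_gt0.
    near=> l; split; first by near: l; exact: nbhs_right_gt.
    by near: l; apply: nbhs_right_lt; rewrite lt_min m0 andbT divr_gt0.
  move=> [q l] [/= [q1 q2] [l0]]; rewrite lt_min => /andP[le lm].
  exists j => x y xq yq.
  have near_fx s : `|s - y| <= `|x - y| -> `|fx j (s, q.2) - fx j q0| <= `|fx j q0| / 2.
    move=> sy; rewrite distrC; apply/ltW/(He (s, q.2)); split => /=; last first.
      by rewrite /ball /=; move: q2; rewrite /ball /=; lra.
    rewrite /ball /=; move: q1; rewrite /ball /= => q1.
    have xy : `|x - y| <= l + l.
      rewrite (_ : x - y = (x - q.1) - (y - q.1)); last by ring.
      by rewrite (le_trans (ler_normB _ _)) // lerD.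
    rewrite (_ : q0.1 - s = (q0.1 - q.1) - (y - q.1) - (s - y)); last by ring.
    apply: (le_lt_trans (ler_normB _ _)).
    have := ler_normB (q0.1 - q.1) (y - q.1); lra.
  have H := mean_value_le (fun x => dfx j x q.2) near_fx.
  have : `|(x - y) * fx j q0| <= `|f j (x, q.2) - f j (y, q.2)| + `|fx j q0| / 2 * `|x - y|.
    rewrite -[(x - y) * _](subKr (f j (x, q.2) - f j (y, q.2))).
    by rewrite (le_trans (ler_normB _ _)) // lerD2l.
  have xy0 := normr_ge0 (x - y); rewrite normrM.
  by move: xy0 lm; set d := `|x - y|; set m := `|fx j q0|; nra.
move=> H; near (0:R)^'+ => l; exists l; first by near: l; exact: nbhs_right_gt.
move=> x t xh tp; have He : (`[0, pi / 2] `*` `[0, pi] : set (R * R)) `<=` expanding l by near: l.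
by apply: He; split; rewrite /= in_itv.
Unshelve. all: by end_near. Qed.

(** Let [y] minimise [|f j - c j|] on the window. For every other [x], expansion gives [l |x - y| <=
    |f j x - c j| + |f j y - c j| <= 2 |f j x - c j|], so the squared distance to [c] dominates
    [(l / 2)^2 (x - y)^2], whatever [c] is. *)
Let itg_dist2_piece l a t c s : 0 < l -> 0 < s -> expanding l (a, t) ->
  - (8 / l) - 2 * l <= itg a (a + l) (fun x => ln (s + dist2 c (x, t))).
Proof.
move=> l0 s0 [j Hj].
have al : a <= a + l by rewrite lerDl ltW.
have cfj : continuous (fun x => (f j (x, t) - c 0 j) ^+ 2).
  have c1 : continuous (fun x => f j (x, t)) by apply: continuous_pair2; exact: cf.
  by cont_tac.
have [y] := EVT_min al (continuous_subspaceT cfj); rewrite in_itv /= => yI ymin.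
have k0 : 0 < l / 2 by rewrite divr_gt0.
have p0 x : 0 < s + (l / 2) ^+ 2 * (x - y) ^+ 2 by rewrite ltr_wpDr // mulr_ge0 ?sqr_ge0.
have N0 z : 0 < s + dist2 c z by rewrite ltr_wpDr // dist2_ge0.
have c1 : continuous (fun x => ln (s + (l / 2) ^+ 2 * (x - y) ^+ 2)).
  by apply: continuous_lnf => //; cont_tac.
have c2 : continuous (fun x => ln (s + dist2 c (x, t))).
  apply: continuous_lnf => [z|]; first exact: N0.
  by apply: continuous_addf; [exact: continuous_cstf | apply: continuous_pair2; exact: continuous_dist2].
have pw x : a <= x <= a + l -> ln (s + (l / 2) ^+ 2 * (x - y) ^+ 2) <= ln (s + dist2 c (x, t)).
  move=> /andP[ax xl]; rewrite ler_ln ?posrE // lerD2l.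
  apply: (le_trans _ (dist2_ge c (x, t) j)).
  have : (f j (y, t) - c 0 j) ^+ 2 <= (f j (x, t) - c 0 j) ^+ 2.
    by apply: ymin; rewrite in_itv /= ax xl.
  rewrite -[X in X <= _ -> _]real_normK ?num_real // -[X in _ <= X -> _]real_normK ?num_real //.
  rewrite ler_pXn2r ?nnegrE // => yx.
  have : l * `|x - y| <= `|f j (x, t) - f j (y, t)|.
    by move: yI => /andP[ay yl]; apply: Hj; rewrite /= ler_norml; apply/andP; split; lra.
  rewrite (_ : f j (x, t) - f j (y, t) = (f j (x, t) - c 0 j) - (f j (y, t) - c 0 j)); last by ring.
  move=> H; have H' := le_trans H (ler_normB _ _).
  rewrite -exprMn -[X in X <= _]real_normK ?num_real // -[X in _ <= X]real_normK ?num_real //.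
  by rewrite ler_pXn2r ?nnegrE // normrM (gtr0_norm k0); lra.
apply: le_trans (le_itg al c1 c2 pw).
apply: le_trans (itg_ln_ge s0 k0 yI).
rewrite (addrC a) addrK (_ : 8 / l = 4 / (l / 2)) //; field; rewrite gt_eqF //.
Qed.

(** The interval [[0, pi / 2]] is cut into [N] windows whose length [l] is at most the uniform
    expansion rate. The bound does not depend on the centre, the scale or the parallel. *)
Lemma itg_ln_dist2_ge : exists C, forall c s t, 0 < s -> 0 <= t <= pi ->
  C <= itg 0 (pi / 2) (fun x => ln (s + dist2 c (x, t))).
Proof.
have [l0 l00 Hl0] := uniformly_expanding.
pose N := (Num.truncn (pi / 2 / l0)).+1.
have N0 : 0 < N%:R :> R by rewrite ltr0n.
pose l := pi / 2 / N%:R.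
have l_gt0 : 0 < l by rewrite divr_gt0.
have ll0 : l <= l0.
  rewrite /l ler_pdivrMr // (mulrC l0) -ler_pdivrMr //.
  by rewrite ltW // truncnS_gt.
have Hl x t : 0 <= x <= pi / 2 -> 0 <= t <= pi -> expanding l (x, t).
  move=> xh tp; have [j Hj] := Hl0 x t xh tp; exists j => y z yx zx.
  apply: le_trans (Hj y z (le_trans yx ll0) (le_trans zx ll0)).
  by rewrite ler_wpM2r.
exists (N%:R * (- (8 / l) - 2 * l)) => c s t s0 tp.
have cg : continuous (fun x => ln (s + dist2 c (x, t))).
  apply: continuous_lnf => [z|]; first by rewrite ltr_wpDr // dist2_ge0.
  by apply: continuous_addf; [exact: continuous_cstf | apply: continuous_pair2; exact: continuous_dist2].
suff H (m : nat) : (m <= N)%N ->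
    m%:R * (- (8 / l) - 2 * l) <= itg 0 (m%:R * l) (fun x => ln (s + dist2 c (x, t))).
  by have := H N (leqnn N); rewrite (_ : N%:R * l = pi / 2) // /l mulrCA divff ?mulr1 // gt_eqF.
elim: m => [_|m IH mN]; first by rewrite !mul0r itg_refl.
have := IH (ltnW mN); have := @itg_dist2_piece l (m%:R * l) t c s l_gt0 s0.
have -> : m%:R * l + l = m.+1%:R * l by rewrite -natr1; ring.
rewrite -(itg_cat 0 (m%:R * l) (m.+1%:R * l) cg) => /(_ _) H1 H2.
have : expanding l (m%:R * l, t).
  apply: Hl => //; apply/andP; split; first by rewrite mulr_ge0 // ltW.
  rewrite /l mulrCA ger_pMr // ler_pdivrMr // mul1r ler_nat; exact: ltnW.
move=> /H1; rewrite -natr1 mulrDl mul1r; lra.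
Qed.

End Balancing.

(** * Existence of a balanced centre and scale *)

Section Minimization.
Variable R : realType.
Variable n : nat.
Local Notation pi := (@pi R).
Local Notation kw := (@kw R).
Variables (f fx : 'I_n -> R * R -> R).
Hypothesis cf : forall j, continuous (f j).
Hypothesis cfx : forall j, continuous (fx j).
Hypothesis dfx : forall j (x t : R), is_derive x 1 (fun x => f j (x, t)) (fx j (x, t)).
Hypothesis fx_neq0 : forall q, exists j, fx j q != 0.
Implicit Types (x y t a b l : R) (q : R * R) (c : 'rV[R]_n).

Let pi0 : 0 < pi := pi_gt0 R.
Let h0 : 0 < pi / 2. Proof. by rewrite divr_gt0. Qed.
Let pi0' := ltW pi0.
Let h0' := ltW h0.

Let M := II (fun q => kw q.2).

Let M0 : 0 < M.
Proof.
rewrite /M /II (_ : (fun t => _) = fun t => pi / 2 * kw t); last first.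
  by apply/funext => t /=; rewrite itg_cst subr0 mulrC.
have cw := @continuous_kw R; rewrite itgZ // mulr_gt0 //.
rewrite lt_neqAle eq_sym; apply/andP; split; last first.
  by apply: itg_ge0 => // t _; exact/ltW/kw_gt0.
apply/eqP => /(itg_eq0 pi0 cw (fun t _ => ltW (kw_gt0 t))) /(_ (pi / 2)) H.
have : kw (pi / 2) = 0 by apply: H; apply/andP; split; move: pi0; lra.
by apply/eqP; rewrite gt_eqF ?kw_gt0.
Qed.

(** The weighted integral of [ln ((s + |f - c|^2) / sqrt s)], that is, up to an additive constant
    and sign, of half the logarithm of the conformal factor of the stereographic lift. Its critical
    equations in [c] and [s] say that the coordinates of the lift have weighted mean zero. *)
Let Phi c s : R := II (fun q => kw q.2 * ln (s + dist2 f c q)) - M / 2 * ln s.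

Let cPhi : continuous (fun z : 'rV[R]_n * R => Phi z.1 (expR z.2)).
Proof.
have cN : continuous (fun z : ('rV[R]_n * R) * (R * R) => expR z.1.2 + dist2 f z.1.1 z.2).
  apply: continuous_addf.
    apply: (continuous_compf (@continuous_expR R)) => z.
    by apply: (@continuous_comp _ _ _ fst snd); [exact: cvg_fst | exact: cvg_snd].
  apply: continuous_bigsum => j; apply: continuous_expf; apply: continuous_addf.
    move=> z; apply: (@continuous_comp _ _ _ snd (f j)); [exact: cvg_snd | exact: cf].
  apply: continuous_oppf => z.
  apply: (@continuous_comp _ _ _ (fun z : ('rV[R]_n * R) * (R * R) => z.1.1) (fun M : 'rV[R]_n => M 0 j)).
    by apply: (@continuous_comp _ _ _ fst fst); [exact: cvg_fst | exact: cvg_fst].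
  exact: coord_continuous.
have N0 (z : ('rV[R]_n * R) * (R * R)) : 0 < expR z.1.2 + dist2 f z.1.1 z.2.
  by rewrite ltr_wpDr ?dist2_ge0 // expR_gt0.
have cL := continuous_lnf N0 cN.
pose F1 (w : ('rV[R]_n * R) * R * R) := kw w.1.2 * ln (expR w.1.1.2 + dist2 f w.1.1.1 (w.2, w.1.2)).
have cF1 : continuous F1.
  apply: continuous_mulf.
    apply: (continuous_compf (@continuous_kw R)) => w.
    by apply: (@continuous_comp _ _ _ fst snd); [exact: cvg_fst | exact: cvg_snd].
  move=> w; apply: (@continuous_comp _ _ _ (fun w : ('rV[R]_n * R) * R * R => (w.1.1, (w.2, w.1.2)))
    (fun z => ln (expR z.1.2 + dist2 f z.1.1 z.2))); last exact: cL.
  have c1 : (fun w : ('rV[R]_n * R) * R * R => w.1.1) @ w --> w.1.1.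
    by apply: (@continuous_comp _ _ _ fst fst); [exact: cvg_fst | exact: cvg_fst].
  have c2 : (fun w : ('rV[R]_n * R) * R * R => w.1.2) @ w --> w.1.2.
    by apply: (@continuous_comp _ _ _ fst snd); [exact: cvg_fst | exact: cvg_snd].
  have c3 : (fun w : ('rV[R]_n * R) * R * R => w.2) @ w --> w.2 by exact: cvg_snd.
  exact: (cvg_pair c1 (cvg_pair c3 c2)).
have c1 := itg_continuous_param h0' cF1.
have c2 := itg_continuous_param pi0' c1.
have c3 : continuous (fun z : 'rV[R]_n * R => z.2) by move=> z; exact: cvg_snd.
have -> : (fun z : 'rV[R]_n * R => Phi z.1 (expR z.2)) = fun z =>
    itg 0 pi (fun t => itg 0 (pi / 2) (fun x => F1 (z, t, x))) + (- (M / 2)) * z.2.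
  by apply/funext => z; rewrite /Phi expRK mulNr.
by apply: continuous_addf => //; apply: continuous_mulf => //; exact: continuous_cstf.
Qed.

Variable F : R.
Hypothesis f_le : forall j x t, 0 <= x <= pi / 2 -> 0 <= t <= pi -> `|f j (x, t)| <= F.

Let cintegrand c (s : R) : 0 < s -> continuous (fun q => kw q.2 * ln (s + dist2 f c q)).
Proof.
move=> s0; apply: continuous_mulf; first exact: continuous_kw2.
apply: continuous_lnf => [q|]; first by rewrite ltr_wpDr // dist2_ge0.
by apply: continuous_addf; [exact: continuous_cstf | exact: (continuous_dist2 cf)].
Qed.

Let Phi_ge c (s v : R) : 0 < s ->
  (forall x t, 0 <= x <= pi / 2 -> 0 <= t <= pi -> v <= ln (s + dist2 f c (x, t))) ->
  M * v - M / 2 * ln s <= Phi c s.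
Proof.
move=> s0 H; rewrite /Phi lerD2r.
have cw2 := @continuous_kw2 R.
have cL : continuous (fun q : R * R => v * kw q.2) by cont_tac.
have cR := @cintegrand c s s0.
rewrite mulrC -IIZ //; apply: le_itg => //; [exact: continuous_inner cL | exact: continuous_inner cR |].
move=> t tp; apply: le_itg => //; [exact: (@continuous_pair2 R _ t cL) | exact: (@continuous_pair2 R _ t cR) |].
by move=> x xh; rewrite mulrC; apply: ler_wpM2l; [exact/ltW/kw_gt0 | exact: H].
Qed.

(** With [s = expR tau], [Phi] is at least its value at [(0, 1)] outside a compact box. For large
    [tau] the term [ln s] dominates ([H1]); for very negative [tau] the uniform bound on the
    logarithm leaves [- M / 2 * tau] ([H2]); for bounded-above [tau] and distant [c] the distance to
    the surface is large ([H3]). *)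
Lemma Phi_min : exists c s, 0 < s /\ forall c' s', 0 < s' -> Phi c s <= Phi c' s'.
Proof.
have [C HC] := itg_ln_dist2_ge cf cfx dfx fx_neq0.
pose V : R := `|Phi 0 1|.
have V0 : 0 <= V := normr_ge0 _.
have VP : Phi 0 1 <= V := ler_norm _.
have H1 c (tau : R) : M / 2 * tau <= Phi c (expR tau).
  have s0 := expR_gt0 tau; have := @Phi_ge c (expR tau) tau s0.
  rewrite expRK => H; apply: le_trans (H _); first by lra.
  move=> x t _ _; rewrite -{1}(expRK tau) ler_ln ?posrE // ?lerDl ?dist2_ge0 //.
  by rewrite ltr_wpDr // dist2_ge0.
pose C1 : R := `|C * itg 0 pi kw|.
have H2 c (tau : R) : - C1 - M / 2 * tau <= Phi c (expR tau).
  have s0 := expR_gt0 tau; rewrite /Phi expRK lerD2r.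
  apply: (@le_trans _ _ (C * itg 0 pi kw)); first by rewrite /C1 lerNl -normrN ler_norm.
  have cw := @continuous_kw R; have ci := @cintegrand c (expR tau) s0.
  have cl : continuous (fun q => ln (expR tau + dist2 f c q)).
    apply: (@continuous_lnf R (R * R)%type (fun q => expR tau + dist2 f c q)) => [z|].
      by rewrite ltr_wpDr // dist2_ge0.
    by apply: continuous_addf; [exact: continuous_cstf | exact: (continuous_dist2 cf)].
  rewrite -itgZ //; apply: le_itg => //; first by cont_tac.
  - exact: (continuous_inner ci).
  move=> t tp.
  have -> : itg 0 (pi / 2) (fun x => kw (x, t).2 * ln (expR tau + dist2 f c (x, t))) =
      kw t * itg 0 (pi / 2) (fun x => ln (expR tau + dist2 f c (x, t))).
    by rewrite /= itgZ //; exact: (@continuous_pair2 R _ t cl).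
  by rewrite mulrC; apply: ler_wpM2l; [exact/ltW/kw_gt0 | exact: HC].
(* Chosen so that [M / 2 * L = V + C1], which suffices for both [H1] and [H2]. *)
pose L : R := 2 * (V + C1) / M.
have C10 : 0 <= C1 := normr_ge0 _.
have L0 : 0 <= L by rewrite divr_ge0 ?(ltW M0) // mulr_ge0 // addr_ge0.
have ML : M / 2 * L = V + C1 by rewrite /L; field; rewrite gt_eqF.
(* At distance at least [expR w] the logarithm is at least [2 w], and
   [M * (2 w) - M / 2 * L = V]. *)
pose w : R := (V + M / 2 * L) / (2 * M).
have w0 : 0 <= w by rewrite divr_ge0 ?mulr_ge0 ?(ltW M0) // addr_ge0 // ML addr_ge0.
have Mw : M * (2 * w) = V + M / 2 * L by rewrite /w; field; rewrite gt_eqF.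
have H3 c (tau : R) j : tau <= L -> F + expR w < `|c 0 j| -> V <= Phi c (expR tau).
  move=> tL cj; have s0 := expR_gt0 tau; have := @Phi_ge c (expR tau) (2 * w) s0.
  rewrite expRK => H; apply: le_trans (H _).
    by have := ler_wpM2l (ltW M0) tL; rewrite Mw; lra.
  move=> x t xh tp; have fj := f_le j xh tp.
  have Ew : expR w <= `|f j (x, t) - c 0 j|.
    by have := ler_normB (f j (x, t)) (f j (x, t) - c 0 j); rewrite subKr; lra.
  have -> : 2 * w = ln (expR w ^+ 2) by rewrite lnXn ?expR_gt0 // expRK mulr2n; ring.
  rewrite ler_ln ?posrE ?exprn_gt0 ?expR_gt0 //; last by rewrite ltr_wpDr // dist2_ge0.
  apply: (le_trans _ (_ : (f j (x, t) - c 0 j) ^+ 2 <= _)).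
    by rewrite -[X in _ <= X]real_normK ?num_real // ler_pXn2r ?nnegrE ?expR_ge0.
  by apply: le_trans (dist2_ge f c (x, t) j) _; rewrite lerDr ltW.
pose B := F + expR w.
pose K : set ('rV[R]_n * R) := [set v : 'rV[R]_n | forall j, (`[- B, B]%classic : set R) (v ord0 j)] `*` (`[- L, L]%classic : set R).
have cK : compact K.
  apply: compact_setX; last exact: segment_compact.
  by apply: (@rV_compact R n (fun=> `[- B, B]%classic)) => j; exact: segment_compact.
(* For [n = 0] nothing bounds [F] from below, but then the box imposes no condition on
   coordinates. *)
have F0 : 0 <= F \/ n = 0%N.
  case: (posnP n) => [->|n0]; [by right | left].
  apply: le_trans (normr_ge0 _) (@f_le (Ordinal n0) 0 0 _ _); by rewrite lexx ltW.
have K0 : K (0, 0).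
  split => /=; last by rewrite in_itv /= oppr_le0 L0.
  move=> j; rewrite mxE in_itv /= oppr_le0 andbb /B addr_ge0 ?expR_ge0 //.
  by case: F0 => // n0; case: j => m; rewrite n0.
have [[c tau] _ min] := compact_EVT_min (ex_intro _ _ K0) cK (continuous_subspaceT cPhi).
exists c, (expR tau); split; first exact: expR_gt0.
move=> c' s' s0; rewrite -(lnK s0); set tau' := ln s'.
have minV : Phi c (expR tau) <= V.
  by have := min (0, 0); rewrite inE /= expR0 => /(_ K0) H; exact: le_trans H VP.
have [t1|t1] := leP tau' L; last first.
  apply: le_trans minV _; apply: le_trans (H1 c' tau').
  have : M / 2 * L <= M / 2 * tau' by apply: ler_wpM2l; [rewrite divr_ge0 // ltW | exact: ltW].
  by rewrite ML; lra.
have [t2|t2] := leP (- L) tau'; last first.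
  apply: le_trans minV _; apply: le_trans (H2 c' tau').
  have : M / 2 * L <= M / 2 * - tau' by apply: ler_wpM2l; [rewrite divr_ge0 // ltW | lra].
  by rewrite ML; lra.
have [[j cj]|cB] := pselect (exists j, B < `|c' 0 j|).
  exact: le_trans minV (H3 c' tau' j t1 cj).
apply: (min (c', tau')); rewrite inE; split => /=; last by rewrite in_itv /= t2 t1.
move=> j; rewrite in_itv /= -ler_norml leNgt; apply/negP => cj; apply: cB; by exists j.
Qed.

Let dist2_shift c j (eta : R) q :
  dist2 f (c + eta *: delta_mx 0 j) q = dist2 f c q - 2 * eta * (f j q - c 0 j) + eta ^+ 2.
Proof.
rewrite /dist2 (bigD1 j) //= [in RHS](bigD1 j) //= !mxE !eqxx mulr1.
rewrite (eq_bigr (fun i => (f i q - c 0 i) ^+ 2)).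
  by ring.
by move=> i ij; rewrite !mxE (negbTE ij) mulr0 addr0.
Qed.

Let ln_diff_le (u v : R) : 0 < u -> 0 < v -> ln v - ln u <= (v - u) / u.
Proof.
move=> u0 v0; rewrite -ln_div ?posrE // mulrBl divff ?gt_eqF //.
by apply: ln_le; rewrite divr_gt0.
Qed.

(** The value at [eta = a / (b + 1)] is negative unless [a = 0]; the [+ 1] covers [b = 0]. *)
Let quadratic_eq0 (a b : R) : 0 <= b -> (forall eta, 0 <= eta ^+ 2 * b - 2 * eta * a) -> a = 0.
Proof.
move=> b0 H; have b1 : 0 < b + 1 by rewrite ltr_wpDl.
have := H (a / (b + 1)).
have -> : (a / (b + 1)) ^+ 2 * b - 2 * (a / (b + 1)) * a = - (a ^+ 2 * (b + 2) / (b + 1) ^+ 2).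
  by field; rewrite gt_eqF.
rewrite oppr_ge0 pmulr_lle0 ?invr_gt0 ?exprn_gt0 // pmulr_lle0; last by lra.
by move=> a0; apply/eqP; rewrite -sqrf_eq0 eq_le a0 sqr_ge0.
Qed.

(** The critical equations are derived without differentiating [Phi]: the inequality
    [ln v - ln u <= (v - u) / u] bounds its variation above by elementary expressions, and
    minimality forces their first-order terms to vanish. *)
Lemma balance : exists c s, [/\ 0 < s,
  forall j, II (fun q => kw q.2 * ((f j q - c 0 j) / (s + dist2 f c q))) = 0 &
  II (fun q => kw q.2 * (s / (s + dist2 f c q))) = II (fun q => kw q.2) / 2].
Proof.
have [c [s [s0 min]]] := Phi_min; exists c, s.
have W0 c' q (s' : R) : 0 < s' -> 0 < s' + dist2 f c' q by move=> ?; rewrite ltr_wpDr // dist2_ge0.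
have Wn q : s + dist2 f c q != 0 by rewrite gt_eqF // W0.
have cW : continuous (fun q => s + dist2 f c q).
  by apply: continuous_addf; [exact: continuous_cstf | exact: (continuous_dist2 cf)].
have cw2 := @continuous_kw2 R; have cdist := @continuous_dist2 R n f cf c.
have cI : continuous (fun q => kw q.2 / (s + dist2 f c q)) by cont_tac.
pose S := II (fun q => kw q.2 / (s + dist2 f c q)).
have S0 : 0 <= S.
  by apply: II_ge0 => // q; rewrite divr_ge0 ?ltW ?kw_gt0 ?W0.
(* [G] is the increment of [s + dist2]. By concavity of the logarithm the increment of the integral
   in [Phi] is at most the right-hand side, while minimality makes the total variation
   nonnegative. *)
have perturb c' (s' : R) G : 0 < s' -> continuous G ->
    (forall q, s' + dist2 f c' q - (s + dist2 f c q) = G q) ->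
    M / 2 * (ln s' - ln s) <= II (fun q => kw q.2 * (G q / (s + dist2 f c q))).
  move=> s'0 cG HG; have := min c' s' s'0; rewrite /Phi => Hmin.
  have c1 := @cintegrand c s s0; have c2 := @cintegrand c' s' s'0.
  have c3 : continuous (fun q => kw q.2 * (G q / (s + dist2 f c q))) by cont_tac.
  have c4 := continuous_addf c2 (continuous_oppf c1).
  have : 0 <= II (fun q => kw q.2 * (G q / (s + dist2 f c q)) -
      (kw q.2 * ln (s' + dist2 f c' q) - kw q.2 * ln (s + dist2 f c q))).
    apply: II_ge0 => [|q].
      exact: (continuous_addf c3 (continuous_oppf c4)).
    rewrite -!mulrBr; apply: mulr_ge0; first exact/ltW/kw_gt0.
    by rewrite subr_ge0 -HG; apply: ln_diff_le; exact: W0.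
  by rewrite !IIB //; lra.
split=> // [j|].
  have cfj : continuous (f j) by exact: cf.
  apply: (quadratic_eq0 S0) => eta.
  have := @perturb (c + eta *: delta_mx 0 j) s
    (fun q => eta ^+ 2 - 2 * eta * (f j q - c 0 j)) s0 _ _.
  rewrite subrr mulr0 => H; apply: le_trans (H _ _) _.
  - by cont_tac.
  - by move=> q; rewrite dist2_shift; ring.
  rewrite (_ : (fun q => _) = fun q => eta ^+ 2 * (kw q.2 / (s + dist2 f c q))
     - 2 * eta * (kw q.2 * ((f j q - c 0 j) / (s + dist2 f c q)))).
    by rewrite IIB ?IIZ //; cont_tac.
  by apply/funext => q; ring.
have -> : II (fun q => kw q.2 * (s / (s + dist2 f c q))) = s * S.
  by rewrite /S -IIZ //; congr II; apply/funext => q; ring.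
rewrite -/M.
(* Varying [s] alone gives an inequality for both signs of [eta]; in the limit [eta -> 0] they force
   [s * S = M / 2]. *)
have H eta : - s < eta -> M / 2 * (ln (s + eta) - ln s) <= eta * S.
  move=> eta0; have se : 0 < s + eta by lra.
  have := @perturb c (s + eta) (fun=> eta) se (@continuous_cstf R _ eta) (fun q => ltac:(ring)).
  by rewrite /S -IIZ // (_ : (fun q => eta * _) = fun q => kw q.2 * (eta / (s + dist2 f c q))) //;
    apply/funext => q; ring.
have H' eta : - s < eta -> M / 2 * eta <= eta * S * (s + eta).
  move=> eta0; have se : 0 < s + eta by lra.
  have := H eta eta0; have := ln_diff_le se s0.
  have -> : s - (s + eta) = - eta by ring.
  rewrite ler_pdivlMr // => L1 L2.
  have M2 : 0 <= M / 2 by rewrite divr_ge0 // ltW.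
  have := ler_wpM2r (ltW se) L2; have := ler_wpM2l M2 L1.
  set l := ln s - ln (s + eta); have -> : ln (s + eta) - ln s = - l by rewrite /l; ring.
  by lra.
have up eta : 0 < eta -> M / 2 <= S * (s + eta).
  move=> e0; have := H' eta ltac:(lra); rewrite (mulrC (M / 2)) -(mulrA eta) ler_pM2l //.
have down eta : - s < eta -> eta < 0 -> S * (s + eta) <= M / 2.
  by move=> e1 e0; have := H' eta e1; rewrite (mulrC (M / 2)) -(mulrA eta) ler_nM2l.
apply/eqP; rewrite eq_le; apply/andP; split; apply/ler_addgt0Pr => e e0.
  (* The bound [s / 2] keeps [s + eta] positive, and [e / (S + 1)] keeps the error [S |eta|] below
     [e]. *)
  pose eta := - Num.min (s / 2) (e / (S + 1)).
  have m1 : Num.min (s / 2) (e / (S + 1)) <= s / 2 by rewrite ge_min lexx.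
  have m2 : Num.min (s / 2) (e / (S + 1)) <= e / (S + 1) by rewrite ge_min lexx orbT.
  have m0 : 0 < Num.min (s / 2) (e / (S + 1)) by rewrite lt_min !divr_gt0 // ltr_wpDl.
  have := down eta ltac:(rewrite /eta; lra) ltac:(rewrite /eta; lra).
  have := ler_wpM2l S0 m2; rewrite /eta mulrDr mulrN => L1 L2.
  have : S * (e / (S + 1)) <= e.
    by rewrite mulrA ler_pdivrMr ?ltr_wpDl // mulrC ler_wpM2l ?(ltW e0) //; lra.
  by lra.
have := up (e / (S + 1)) ltac:(rewrite divr_gt0 // ltr_wpDl //).
have : S * (e / (S + 1)) <= e.
  by rewrite mulrA ler_pdivrMr ?ltr_wpDl // mulrC ler_wpM2l ?(ltW e0) //; lra.
by rewrite mulrDr; lra.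
Qed.

End Minimization.

(** * Surfaces conformal to the bipolar surface *)

Section VectorCalculus.
Variable R : realType.
Local Notation pi := (@pi R).
Local Notation e1 := ((1, 0) : R * R).
Local Notation e2 := ((0, 1) : R * R).

Section Dot.
Variable n : nat.
Implicit Types (u v w : 'rV[R]_n) (a : R).

Lemma dotC u v : dot u v = dot v u.
Proof. by apply: eq_bigr => i _; rewrite mulrC. Qed.

Lemma dotDl u v w : dot (u + v) w = dot u w + dot v w.
Proof. by rewrite /dot -big_split; apply: eq_bigr => i _; rewrite mxE mulrDl. Qed.

Lemma dotZl a u v : dot (a *: u) v = a * dot u v.
Proof. by rewrite /dot mulr_sumr; apply: eq_bigr => i _; rewrite mxE mulrA. Qed.

Lemma dotNl u v : dot (- u) v = - dot u v.
Proof. by rewrite -scaleN1r dotZl mulN1r. Qed.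

Lemma dotBl u v w : dot (u - v) w = dot u w - dot v w.
Proof. by rewrite dotDl dotNl. Qed.

Lemma dotDr u v w : dot w (u + v) = dot w u + dot w v.
Proof. by rewrite !(dotC w) dotDl. Qed.

Lemma dotZr a u v : dot v (a *: u) = a * dot v u.
Proof. by rewrite !(dotC v) dotZl. Qed.

Lemma dotNr u v : dot v (- u) = - dot v u.
Proof. by rewrite !(dotC v) dotNl. Qed.

Lemma dotBr u v w : dot w (u - v) = dot w u - dot w v.
Proof. by rewrite dotDr dotNr. Qed.

Lemma dot0l u : dot 0 u = 0.
Proof. by rewrite /dot big1 // => i _; rewrite mxE mul0r. Qed.

Lemma dot_ge0 u : 0 <= dot u u.
Proof. by apply: sumr_ge0 => i _; rewrite -expr2 sqr_ge0. Qed.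

Lemma dot_eq0 u : dot u u = 0 -> u = 0.
Proof.
move=> /eqP; rewrite psumr_eq0 => [/allP H|i _]; last by rewrite -expr2 sqr_ge0.
apply/rowP => i; have := H i; rewrite mem_index_enum => /(_ isT).
by rewrite /= -expr2 sqrf_eq0 mxE => /eqP.
Qed.

Lemma mulmx_dot m (A : 'M[R]_(m, n)) u i : (u *m A^T) 0 i = dot u (row i A).
Proof. by rewrite mxE; apply: eq_bigr => j _; rewrite !mxE. Qed.

Lemma dotE u v : dot u v = (u *m v^T) 0 0.
Proof. by rewrite mxE; apply: eq_bigr => j _; rewrite !mxE. Qed.

Implicit Types f g : R * R -> 'rV[R]_n.

Lemma smooth_dot f g : smooth f -> smooth g -> smooth (fun q => dot (f q) (g q)).
Proof. by move=> sf sg; apply: smooth_sum => i; apply: smoothM; exact: smooth_coord. Qed.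

Lemma is_derive_dot f g (p d : R * R) : smooth f -> smooth g ->
  is_derive p d (fun q => dot (f q) (g q)) (dot (f p) ('D_d g p) + dot (g p) ('D_d f p)).
Proof.
move=> sf sg; notypeclasses refine (is_derive_conv (is_derive_sumf _ _) _).
  by move=> i; notypeclasses refine (is_derive_mulf _ _); apply: smooth_is_derive; exact: smooth_coord.
rewrite big_split /=; congr (_ + _); apply: eq_bigr => i _;
  by rewrite derive_coord //; exact: smooth_diff.
Qed.

Lemma smoothB f g : smooth f -> smooth g -> smooth (fun q => f q - g q).
Proof.
move=> sf sg; apply: smooth_rV => i.
rewrite (_ : (fun q => _) = fun q => f q 0 i + - g q 0 i); last by apply/funext => q; rewrite !mxE.
by apply: smoothD; [|apply: smoothN]; exact: smooth_coord.
Qed.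

End Dot.

(** The second difference of [F] over a small square is, by the mean value theorem applied twice in
    either order, [h^2] times each mixed derivative at some point of the square; continuity excludes
    distinct values at the corner. *)
Lemma schwarz_scalar (F : R * R -> R) (p : R * R) : smooth F ->
  'D_e1 ('D_e2 F) p = 'D_e2 ('D_e1 F) p.
Proof.
move=> sF; case: p => x t.
have s1 := smooth_derive e1 sF; have s2 := smooth_derive e2 sF.
have c21 := smooth_continuous (smooth_derive e2 s1).
have c12 := smooth_continuous (smooth_derive e1 s2).
have dF1 (y s : R) : is_derive y 1 (fun y => F (y, s)) ('D_e1 F (y, s)).
  by apply: (is_derive_fst F y s _).1; exact: smooth_is_derive.
have dF2 (y s : R) : is_derive s 1 (fun s => F (y, s)) ('D_e2 F (y, s)).
  by apply: (is_derive_snd F y s _).1; exact: smooth_is_derive.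
have dF21 (y s : R) : is_derive s 1 (fun s => 'D_e1 F (y, s)) ('D_e2 ('D_e1 F) (y, s)).
  by apply: (is_derive_snd ('D_e1 F) y s _).1; exact: smooth_is_derive.
have dF12 (y s : R) : is_derive y 1 (fun y => 'D_e2 F (y, s)) ('D_e1 ('D_e2 F) (y, s)).
  by apply: (is_derive_fst ('D_e2 F) y s _).1; exact: smooth_is_derive.
have mv (g dg : R -> R) (y z : R) : (forall s : R, is_derive s 1 g (dg s)) -> y < z ->
    exists2 w, y < w < z & g z - g y = dg w * (z - y).
  by move=> dg' yz; exact: (mean_value yz (fun w _ => dg' w) (fun w _ => @derive1_continuous R g dg dg' w)).
apply/eqP/negPn/negP => ne.
set a := 'D_e1 _ _ in ne; set b := 'D_e2 _ _ in ne.
have ab0 : 0 < `|a - b| / 2 by rewrite divr_gt0 // normr_gt0 subr_eq0.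
have /cvgrPdist_lt /(_ _ ab0) /nbhs_ballP[r1 /= r10 H1] := c12 (x, t).
have /cvgrPdist_lt /(_ _ ab0) /nbhs_ballP[r2 /= r20 H2] := c21 (x, t).
pose m := Num.min r1 r2; pose h := m / 2.
have m1 : m <= r1 by rewrite ge_min lexx.
have m2 : m <= r2 by rewrite ge_min lexx orbT.
have m0 : 0 < m by rewrite lt_min r10.
have h0 : 0 < h by rewrite divr_gt0.
have hr1 : h < r1 by rewrite /h; lra.
have hr2 : h < r2 by rewrite /h; lra.
have inball (y s r : R) : x < y < x + h -> t < s < t + h -> h < r -> ball (x, t) r (y, s).
  by move=> /andP[? ?] /andP[? ?] ?; split => /=; rewrite /ball /= ltr_norml; apply/andP; split; lra.
have gap_absurd (u v w w' : R) : w = w' -> `|u - w| < `|u - v| / 2 -> `|v - w'| < `|u - v| / 2 -> False.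
  move=> <-; have := ler_normB (u - w) (v - w); rewrite opprB addrA subrK; lra.
have xh : x < x + h by lra.
have th : t < t + h by lra.
have d1 (y : R) : is_derive y 1 (fun y => F (y, t + h) - F (y, t)) ('D_e1 F (y, t + h) - 'D_e1 F (y, t)).
  by isd.
have d2 (s : R) : is_derive s 1 (fun s => F (x + h, s) - F (x, s)) ('D_e2 F (x + h, s) - 'D_e2 F (x, s)).
  by isd.
have [y1 y1x E1] := mv _ _ _ _ d1 xh.
have [s1' s1t E1'] := mv _ _ _ _ (dF21 y1) th.
have [s2' s2t E2] := mv _ _ _ _ d2 th.
have [y2 y2x E2'] := mv _ _ _ _ (fun y => dF12 y s2') xh.
rewrite E1' in E1; rewrite E2' in E2.
have EQ : 'D_e1 ('D_e2 F) (y2, s2') = 'D_e2 ('D_e1 F) (y1, s1').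
  have gen (A B : R) : A * (t + h - t) * (x + h - x) = B * (x + h - x) * (t + h - t) -> B = A.
    have -> : t + h - t = h by ring.
    have -> : x + h - x = h by ring.
    by have hn : h != 0 by [rewrite gt_eqF]; move=> /(mulIf hn)/(mulIf hn) ->.
  have swap (a' b' c d : R) : a' - b' - (c - d) = a' - c - (b' - d) by ring.
  exact: (gen _ _ (etrans (esym E1) (etrans (swap _ _ _ _) E2))).
have L1 := H1 _ (inball _ _ _ y2x s2t hr1); have L2 := H2 _ (inball _ _ _ y1x s1t hr2).
exact: (gap_absurd a b _ _ EQ L1 L2).
Qed.

Lemma schwarz n (f : R * R -> 'rV[R]_n) (p : R * R) : smooth f ->
  'D_e1 ('D_e2 f) p = 'D_e2 ('D_e1 f) p.
Proof.
move=> sf; apply/rowP => i.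
have E v w : 'D_v ('D_w f) p 0 i = 'D_v ('D_w (fun q => f q 0 i)) p.
  rewrite derive_coord; last by apply: smooth_diff; exact: smooth_derive.
  by congr ('D_v _ p); apply/funext => q; rewrite derive_coord //; exact: smooth_diff.
exact: (etrans (E _ _) (etrans (schwarz_scalar p (smooth_coord i sf)) (esym (E _ _)))).
Qed.

End VectorCalculus.

(** * Mean curvature in conformal coordinates *)

Section Surfaces.
Variable R : realType.
Local Notation pi := (@pi R).
Local Notation kC := (@kC R).
Local Notation kS := (@kS R).
Local Notation kd := (@kd R).
Local Notation kw := (@kw R).
Local Notation e1 := ((1, 0) : R * R).
Local Notation e2 := ((0, 1) : R * R).

Lemma is_derive_kd_snd q : is_derive q e2 (fun q : R * R => kd q.2) (2 * kS q.2 * kC q.2 / kd q.2).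
Proof. by case: q => x t; apply: (is_derive_snd (fun q => kd q.2) x t _).2; exact: is_derive_kd. Qed.

Lemma is_derive_kd_fst q : is_derive q e1 (fun q : R * R => kd q.2) 0.
Proof.
case: q => x t; apply: (is_derive_fst (fun q => kd q.2) x t _).2.
exact: (is_derive_cstf (kd t) x (1 : R)).
Qed.

Variable n : nat.
Implicit Types (f g : R * R -> 'rV[R]_n) (q : R * R) (E : R * R -> R).

Lemma is_derive_dotE f g df dg (v p : R * R) : smooth f -> smooth g ->
  'D_v f = df -> 'D_v g = dg ->
  is_derive p v (fun q => dot (f q) (g q)) (dot (f p) (dg p) + dot (g p) (df p)).
Proof. by move=> sf sg <- <-; exact: is_derive_dot. Qed.

(* Naming the partial derivatives keeps unification from unfolding them. *)
Record jet f fx ft fxx fxt ftt : Prop := Jet {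
  jet_smooth : smooth f;
  jet_fx : 'D_e1 f = fx; jet_ft : 'D_e2 f = ft;
  jet_fxx : 'D_e1 fx = fxx; jet_fxt : 'D_e2 fx = fxt;
  jet_ftx : 'D_e1 ft = fxt; jet_ftt : 'D_e2 ft = ftt }.

Lemma smooth_jet f : smooth f -> exists fx ft fxx fxt ftt, jet f fx ft fxx fxt ftt.
Proof.
move=> sf; exists ('D_e1 f), ('D_e2 f), ('D_e1 ('D_e1 f)), ('D_e2 ('D_e1 f)), ('D_e2 ('D_e2 f)).
apply: (Jet sf erefl erefl erefl erefl _ erefl).
by apply/funext => q; exact: schwarz.
Qed.

(* [f] is conformal to dx^2 + dt^2 / kd(t)^2, with conformal factor [E]. *)
Definition conformal_factor (fx ft : R * R -> 'rV[R]_n) E : Prop := forall q,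
  [/\ 0 < E q, dot (fx q) (fx q) = E q, dot (fx q) (ft q) = 0 &
      kd q.2 ^+ 2 * dot (ft q) (ft q) = E q].

Section Conformal.
Variables f fx ft fxx fxt ftt : R * R -> 'rV[R]_n.
Variable E : R * R -> R.
Hypothesis jf : jet f fx ft fxx fxt ftt.
Hypothesis fE : conformal_factor fx ft E.

Let sf : smooth f := jet_smooth jf.
Lemma jet_smooth_fx : smooth fx. Proof. by rewrite -(jet_fx jf); exact: smooth_derive. Qed.
Lemma jet_smooth_ft : smooth ft. Proof. by rewrite -(jet_ft jf); exact: smooth_derive. Qed.
Lemma jet_smooth_fxx : smooth fxx.
Proof. by rewrite -(jet_fxx jf); apply: smooth_derive; exact: jet_smooth_fx. Qed.
Lemma jet_smooth_ftt : smooth ftt.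
Proof. by rewrite -(jet_ftt jf); apply: smooth_derive; exact: jet_smooth_ft. Qed.
Let sfx := jet_smooth_fx.
Let sft := jet_smooth_ft.
Let d0 q : kd q.2 != 0. Proof. exact: kd_neq0. Qed.

(* The Laplacian of the metric dx^2 + dt^2 / kd(t)^2. *)
Definition klein_lap q : 'rV[R]_n :=
  fxx q + kd q.2 ^+ 2 *: ftt q + (2 * kS q.2 * kC q.2) *: ft q.

Let dE_eq v q a b : is_derive q v (fun q => dot (fx q) (fx q)) a ->
  is_derive q v (fun q => kd q.2 ^+ 2 * dot (ft q) (ft q)) b -> a = b.
Proof.
have -> : (fun q => kd q.2 ^+ 2 * dot (ft q) (ft q)) = (fun q => dot (fx q) (fx q)).
  by apply/funext => p; case: (fE p) => _ -> _ ->.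
by move=> [_ <-] [_ <-].
Qed.

Let d0_eq v q a : is_derive q v (fun q => dot (fx q) (ft q)) a -> a = 0.
Proof.
have -> : (fun q => dot (fx q) (ft q)) = fun=> 0.
  by apply/funext => p; case: (fE p) => _ _ -> _.
by move=> [_ <-]; exact: derive_cst.
Qed.

(** The Laplacian of a conformal map is normal. Against [fx] this combines the [t]-derivative of
    [fx . ft = 0] with the [x]-derivative of [|fx|^2 = kd^2 |ft|^2]; against [ft] the two directions
    are exchanged. *)
Lemma klein_lap_fst q : dot (klein_lap q) (fx q) = 0.
Proof.
have [_ _ H0 _] := fE q.
have H1 := d0_eq (is_derive_dotE q sfx sft (jet_fxt jf) (jet_ftt jf)).
have dk := is_derive_kd_fst q.
have H2 := dE_eq (is_derive_dotE q sfx sfx (jet_fxx jf) (jet_fxx jf))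
  (is_derive_mulf (is_derive_expf 2 dk) (is_derive_dotE q sft sft (jet_ftx jf) (jet_ftx jf))).
rewrite /klein_lap !dotDl !dotZl (dotC (ft q)) H0 mulr0 addr0.
rewrite (dotC (fxx q)) (dotC (ftt q)).
move: H1 H2; rewrite /= !mulr0 addr0.
move: (dot _ _) (dot _ _) (dot (ft q) _) (kd q.2) => A B C k H1 H2; nra.
Qed.

Lemma klein_lap_snd q : dot (klein_lap q) (ft q) = 0.
Proof.
have H1 := d0_eq (is_derive_dotE q sfx sft (jet_fxx jf) (jet_ftx jf)).
have dk := is_derive_kd_snd q.
have H2 := dE_eq (is_derive_dotE q sfx sfx (jet_fxt jf) (jet_fxt jf))
  (is_derive_mulf (is_derive_expf 2 dk) (is_derive_dotE q sft sft (jet_ftt jf) (jet_ftt jf))).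
rewrite /klein_lap !dotDl !dotZl (dotC (fxx q)) (dotC (ftt q)).
move: H1 H2; rewrite /=.
have -> : 2 * kd q.2 ^+ 1 * (2 * kS q.2 * kC q.2 / kd q.2) = 4 * kS q.2 * kC q.2.
  by field; exact: d0.
by move=> H1 H2; lra.
Qed.

Let jet1 q : 'D_e1 f q = fx q. Proof. by rewrite -(jet_fx jf). Qed.
Let jet2 q : 'D_e2 f q = ft q. Proof. by rewrite -(jet_ft jf). Qed.
Let jet11 q : 'D_e1 fx q = fxx q. Proof. by rewrite -(jet_fxx jf). Qed.
Let jet22 q : 'D_e2 ft q = ftt q. Proof. by rewrite -(jet_ftt jf). Qed.

Let metricE q : metric f q = diag_mx (\row_j (if j == 0 then E q else E q / kd q.2 ^+ 2)).
Proof.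
have [_ H1 H0 H2] := fE q.
have H2' : dot (ft q) (ft q) = E q / kd q.2 ^+ 2.
  by rewrite -H2 mulrAC divff ?mul1r // expf_neq0 // d0.
apply/matrixP => i j; rewrite /metric mxE.
have -> : \sum_k Defs.jacobian f q i k * (Defs.jacobian f q)^T k j = dot ('D_(dir R i) f q) ('D_(dir R j) f q).
  by apply: eq_bigr => k _; rewrite !mxE.
rewrite !mxE.
case: i => [[|[|//]] i0]; case: j => [[|[|//]] j0]; rewrite /dir /= ?mulr1n ?mulr0n.
- by rewrite jet1.
- by rewrite jet1 jet2.
- by rewrite jet1 jet2 dotC.
- by rewrite jet2.
Qed.

Let inv_metricE q : invmx (metric f q) =
  diag_mx (\row_j (if j == 0 then (E q)^-1 else kd q.2 ^+ 2 / E q)).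
Proof.
have [E0 _ _ _] := fE q.
rewrite metricE; set D := diag_mx _; set D' := diag_mx _.
have DD : D *m D' = 1%:M.
  rewrite /D /D' mulmx_diag; apply/matrixP => i j; rewrite !mxE; congr (_ *+ _).
  case: ifP => _; first by rewrite divff // gt_eqF.
  by field; rewrite gt_eqF ?d0.
have [uD _] := mulmx1_unit DD.
by rewrite -[LHS]mulmx1 -DD mulKmx.
Qed.

(** The metric is diagonal, so the trace is the normal part of [fxx + kd^2 ftt] divided by [E];
    adding the tangential multiple of [ft] gives the Laplacian, which is already normal. *)
Lemma mean_curvatureE q : mean_curvature f q = (E q)^-1 *: klein_lap q.
Proof.
have [E0 H1 H0 H2] := fE q.
have N1 := klein_lap_fst q; have N2 := klein_lap_snd q.
have projE v : normal_proj f q v = v - (dot v (fx q) / E q) *: fx q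
    - (dot v (ft q) * (kd q.2 ^+ 2 / E q)) *: ft q.
  rewrite /normal_proj inv_metricE -addrA -opprD; congr (_ - _).
  apply/rowP => j; rewrite !mxE !big_ord_recl big_ord0 addr0.
  have J i : \sum_k v 0 k * (Defs.jacobian f q)^T k i = dot v ('D_(dir R i) f q).
    by apply: eq_bigr => k _; rewrite !mxE.
  by rewrite !mul_mx_diag !mxE !J /dir /= !jet1 !jet2.
have -> : mean_curvature f q =
    (E q)^-1 *: second_form f ord0 ord0 q + (kd q.2 ^+ 2 / E q) *: second_form f (lift ord0 ord0) (lift ord0 ord0) q.
  rewrite /mean_curvature inv_metricE; move: (second_form f) => B.
  by rewrite !big_ord_recl !big_ord0 !mxE /= !mulr0n !mulr1n !scale0r !addr0 add0r.
have -> : second_form f ord0 ord0 q = normal_proj f q (fxx q).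
  by rewrite /second_form /dir /= (jet_fx jf) jet11.
have -> : second_form f (lift ord0 ord0) (lift ord0 ord0) q = normal_proj f q (ftt q).
  by rewrite /second_form /dir /= (jet_ft jf) jet22.
rewrite !projE.
move: N1 N2; rewrite /klein_lap !dotDl !dotZl (dotC (ft q) (fx q)) H0 mulr0 addr0 => N1 N2.
have En : E q != 0 by rewrite gt_eqF.
have Dn := d0 q.
have D2 : dot (ft q) (ft q) = E q / kd q.2 ^+ 2.
  by rewrite -H2 mulrAC divff ?mul1r // expf_neq0.
apply/rowP => j; rewrite !mxE.
have -> : dot (fxx q) (fx q) = - (kd q.2 ^+ 2 * dot (ftt q) (fx q)) by lra.
have -> : dot (fxx q) (ft q) = - (kd q.2 ^+ 2 * dot (ftt q) (ft q)) - 2 * kS q.2 * kC q.2 * (E q / kd q.2 ^+ 2).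
  by move: N2; rewrite D2; lra.
by field; rewrite En Dn.
Qed.

Lemma det_metric q : \det (metric f q) = (E q / kd q.2) ^+ 2.
Proof.
rewrite metricE det_diag !big_ord_recl big_ord0 !mxE /= mulr1 expr_div_n.
by rewrite mulrA -expr2.
Qed.

(** [|H|^2] is [|klein_lap|^2 / E^2] and the area density is [E / kd]. *)
Definition willmore_density q : R := dot (klein_lap q) (klein_lap q) / (E q * kd q.2).

Hypothesis cE : continuous E.

Lemma continuous_willmore_density : continuous willmore_density.
Proof.
have En q : E q * kd q.2 != 0 by case: (fE q) => E0 _ _ _; rewrite mulf_neq0 // ?gt_eqF.
have ckd := @continuous_kd2 R.
have ckS : continuous (fun q : R * R => kS q.2).
  by apply: (continuous_compf (@continuous_kS R)) => q; exact: cvg_snd.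
have ckC : continuous (fun q : R * R => kC q.2).
  by apply: (continuous_compf (@continuous_kC R)) => q; exact: cvg_snd.
have c1 i : continuous (fun q => fxx q 0 i).
  by apply: smooth_continuous; apply: smooth_coord; exact: jet_smooth_fxx.
have c2 i : continuous (fun q => ftt q 0 i).
  by apply: smooth_continuous; apply: smooth_coord; exact: jet_smooth_ftt.
have c3 i : continuous (fun q => ft q 0 i).
  by apply: smooth_continuous; apply: smooth_coord; exact: jet_smooth_ft.
have cL i : continuous (fun q => klein_lap q 0 i).
  rewrite (_ : (fun q => _) = fun q => fxx q 0 i + kd q.2 ^+ 2 * ftt q 0 i + 2 * kS q.2 * kC q.2 * ft q 0 i).
    have := c1 i; have := c2 i; have := c3 i => ? ? ?; cont_tac.
  by apply/funext => q; rewrite !mxE.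
have cD : continuous (fun q => dot (klein_lap q) (klein_lap q)).
  by apply: continuous_bigsum => i; have := cL i => ?; cont_tac.
by rewrite /willmore_density; cont_tac.
Qed.

Lemma willmoreE : willmore f = 4^-1 * II willmore_density.
Proof.
have pi0 := pi_gt0 R; have h0 : 0 < pi / 2 by rewrite divr_gt0.
rewrite /willmore; congr (_ * _).
have dens q : dot (mean_curvature f q) (mean_curvature f q) * Num.sqrt (\det (metric f q)) =
    willmore_density q.
  have [E0 _ _ _] := fE q; have k0 := kd_gt0 q.2.
  rewrite mean_curvatureE det_metric sqrtr_sqr ger0_norm; last by rewrite divr_ge0 // ltW.
  rewrite dotZl dotZr /willmore_density; field.
  by rewrite !gt_eqF.
rewrite (II_swap continuous_willmore_density) -Rintegral_prod //.
- by apply: eq_Rintegral => q _; exact: dens.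
- exact: ltW.
- exact: ltW.
- exact: continuous_willmore_density.
move=> q; have [E0 _ _ _] := fE q.
by rewrite /willmore_density divr_ge0 ?dot_ge0 // mulr_ge0 // ltW // kd_gt0.
Qed.

End Conformal.
End Surfaces.

(** * Maps on the Klein bottle and the area of balanced spherical maps *)

Section KleinMaps.
Variable R : realType.
Local Notation pi := (@pi R).
Local Notation kC := (@kC R).
Local Notation kS := (@kS R).
Local Notation kd := (@kd R).
Local Notation kw := (@kw R).
Local Notation II := (@II R).
Local Notation e1 := ((1, 0) : R * R).
Local Notation e2 := ((0, 1) : R * R).

Lemma klein_glide (W : Type) (f : R * R -> W) : on_klein f ->
  forall x t : R, f (x + pi / 2, - t) = f (x, t).
Proof. by move=> kf x t; apply/esym/kf; exists 1, 0; rewrite /= mul1r mulN1r mul0r addr0. Qed.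

Lemma klein_translation (W : Type) (f : R * R -> W) : on_klein f ->
  forall x t : R, f (x, t + pi) = f (x, t).
Proof. by move=> kf x t; apply/esym/kf; exists 0, 1; rewrite /= mul0r addr0 !mul1r. Qed.

Section Coordinate.
Variable n : nat.
Implicit Types f g fx ft : R * R -> 'rV[R]_n.

Lemma derive_subcst f (c : 'rV[R]_n) v : 'D_v (fun q => f q - c) = 'D_v f.
Proof.
apply/funext => q; rewrite /derive.
have -> : (fun h : R => h^-1 *: (((fun q => f q - c) \o shift q) (h *: v) - (f q - c))) =
    fun h => h^-1 *: ((f \o shift q) (h *: v) - f q).
  by apply/funext => h /=; rewrite opprB addrA subrK.
by [].
Qed.

Lemma coord_C1 f fx ft i : smooth f -> 'D_e1 f = fx -> 'D_e2 f = ft ->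
  C1 (fun q => f q 0 i) (fun q => fx q 0 i) (fun q => ft q 0 i).
Proof.
move=> sf <- <-.
have sc v : smooth (fun q => 'D_v f q 0 i) by apply: smooth_coord; exact: smooth_derive.
have E v q : 'D_v f q 0 i = 'D_v (fun q => f q 0 i) q by rewrite derive_coord //; exact: smooth_diff.
split; try by apply: smooth_continuous.
- by apply: smooth_continuous; exact: smooth_coord.
- move=> x t; rewrite E; apply: (is_derive_fst (fun q => f q 0 i) x t _).1.
  by apply: smooth_is_derive; exact: smooth_coord.
move=> x t; rewrite E; apply: (is_derive_snd (fun q => f q 0 i) x t _).1.
by apply: smooth_is_derive; exact: smooth_coord.
Qed.

Lemma klein_derive f fx ft : smooth f -> on_klein f -> 'D_e1 f = fx -> 'D_e2 f = ft ->
  forall x t : R, [/\ fx (x + pi / 2, - t) = fx (x, t), ft (x + pi / 2, - t) = - ft (x, t),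
                      fx (x, t + pi) = fx (x, t) & ft (x, t + pi) = ft (x, t)].
Proof.
move=> sf kf f1 f2 x t.
have H i := coord_C1 i sf f1 f2.
have K1 := klein_glide kf; have K2 := klein_translation kf.
split; apply/rowP => i; have [_ _ _ d1 d2] := H i.
- have D : is_derive x 1 (fun y => f (y, t) 0 i) (fx (x + pi / 2, - t) 0 i).
    rewrite (_ : (fun y => _) = fun y => f (y + pi / 2, - t) 0 i); last by apply/funext => y; rewrite K1.
    have := is_derive_compf (f := fun y => y + pi / 2) (d1 (x + pi / 2) (- t))
      (is_derive_addf (is_derive_id x 1) (is_derive_cstf (pi / 2) x (1 : R))).
    by rewrite addr0 mulr1.
  by case: D => _ <-; case: (d1 x t) => _ <-.
- rewrite mxE.
  have D : is_derive t 1 (fun s => f (x, s) 0 i) (- ft (x + pi / 2, - t) 0 i).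
    rewrite (_ : (fun y => _) = fun s => f (x + pi / 2, - s) 0 i); last by apply/funext => y; rewrite K1.
    have := is_derive_compf (f := fun s => - s) (d2 (x + pi / 2) (- t))
      (is_derive_oppf (is_derive_id t 1)).
    by rewrite mulrN1.
  by case: D => _ E; case: (d2 x t) => _ <-; rewrite E opprK.
- have D : is_derive x 1 (fun y => f (y, t) 0 i) (fx (x, t + pi) 0 i).
    rewrite (_ : (fun y => _) = fun y => f (y, t + pi) 0 i); last by apply/funext => y; rewrite K2.
    exact: d1.
  by case: D => _ <-; case: (d1 x t) => _ <-.
have D : is_derive t 1 (fun s => f (x, s) 0 i) (ft (x, t + pi) 0 i).
  rewrite (_ : (fun y => _) = fun s => f (x, s + pi) 0 i); last by apply/funext => y; rewrite K2.
  have := is_derive_compf (f := fun y => y + pi) (d2 x (t + pi))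
    (is_derive_addf (is_derive_id t 1) (is_derive_cstf pi t (1 : R))).
  by rewrite addr0 mulr1.
by case: D => _ <-; case: (d2 x t) => _ <-.
Qed.

(** The five-dimensional space of eigenfunctions for the eigenvalue 2, in the form in which the
    equality case of [klein_gap] delivers it. *)
Definition first_modes (u : R * R -> R) := exists A B C D E, forall x t,
  u (x, t) = A * (kS t / kd t) + (B * cos (4 * x) + C * sin (4 * x)) / kd t
           + (D * cos (2 * x) + E * sin (2 * x)) * (kC t / kd t).

(* Summing the spectral gap over the coordinates of a conformal map to the unit sphere. *)
Lemma conformal_area_ge (F Fx Ft : R * R -> 'rV[R]_n) (e : R * R -> R) :
  smooth F -> on_klein F -> 'D_e1 F = Fx -> 'D_e2 F = Ft -> continuous e ->
  (forall q, dot (F q) (F q) = 1) -> (forall q, dot (Fx q) (Fx q) = e q) ->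
  (forall q, kd q.2 ^+ 2 * dot (Ft q) (Ft q) = e q) ->
  (forall i, II (fun q => kw q.2 * F q 0 i) = 0) ->
  6 * II (fun q => kw q.2) <= II (fun q => e q / kd q.2) /\
  (II (fun q => e q / kd q.2) = 6 * II (fun q => kw q.2) -> forall i, first_modes (fun q => F q 0 i)).
Proof.
move=> sF kF F1 F2 ce FF eE1 eE2 mean0.
have cd := @continuous_kd2 R; have cw := @continuous_kw2 R.
have d0 (q : R * R) : kd q.2 != 0 by exact: kd_neq0.
have HC i := coord_C1 i sF F1 F2.
have co (v w : 'rV[R]_n) i : v = w -> v 0 i = w 0 i by move=> ->.
have gap i := klein_gap (HC i) (fun x t => co _ _ i (klein_glide kF x t))
  (fun x t => co _ _ i (klein_translation kF x t)) (mean0 i).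
pose form i := klein_form (fun q => F q 0 i) (fun q => Fx q 0 i) (fun q => Ft q 0 i).
have sumE : \sum_i form i = 2 * II (fun q => e q / kd q.2) - 12 * II (fun q => kw q.2).
  rewrite -!IIZ // -?IIB; [|by cont_tac..].
  rewrite /form /klein_form -II_sum; last by move=> i; exact: continuous_rayleigh.
  congr II; apply/funext => q; rewrite /rayleigh.
  rewrite !big_split /= sumrN -mulr_suml -!mulr_sumr.
  have := FF q; have := eE1 q; have := eE2 q; rewrite /dot => H2 H1 H0.
  rewrite H1 H0 mulr1; congr (_ - _).
  by rewrite -H2 in H1 *; field; exact: d0.
have f0 i : 0 <= form i by case: (gap i).
have S0 : 0 <= \sum_i form i by exact: sumr_ge0.
split; first by move: S0; rewrite sumE; lra.
move=> eq6 i; have [_ H] := gap i; apply: H.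
have /eqP : \sum_i form i = 0 by rewrite sumE eq6; ring.
rewrite psumr_eq0 // => /allP /(_ i); rewrite mem_index_enum => /(_ isT).
by move=> /eqP.
Qed.

End Coordinate.
End KleinMaps.

(** * The Li-Yau identity *)

Section LiYau.
Variable R : realType.
Local Notation pi := (@pi R).
Local Notation kC := (@kC R).
Local Notation kS := (@kS R).
Local Notation kd := (@kd R).
Local Notation kw := (@kw R).
Local Notation II := (@II R).
Local Notation e1 := ((1, 0) : R * R).
Local Notation e2 := ((0, 1) : R * R).

(* [X] and [Y] are the components of a vector field on the Klein bottle. *)
Lemma II_divergence (X Y Xx Yt : R * R -> R) : continuous X -> continuous Xx -> continuous Yt ->
  (forall q, is_derive q e1 X (Xx q)) -> (forall q, is_derive q e2 Y (Yt q)) ->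
  (forall x t : R, X (x + pi / 2, - t) = X (x, t)) ->
  (forall x t : R, X (x, t + pi) = X (x, t)) -> (forall x t : R, Y (x, t + pi) = Y (x, t)) ->
  II (fun q => Xx q + Yt q) = 0.
Proof.
move=> cX cXx cYt dX dY X1 X2 Y2.
have dX' (t x : R) : is_derive x 1 (fun x => X (x, t)) (Xx (x, t)) := (is_derive_fst X x t _).1 (dX _).
have dY' (x t : R) : is_derive t 1 (fun t => Y (x, t)) (Yt (x, t)) := (is_derive_snd Y x t _).1 (dY _).
rewrite IID // (II_swap cYt).
have -> : (fun x => itg 0 pi (fun t => Yt (x, t))) = fun=> 0.
  apply/funext => x; rewrite (itgE _ _ (dY' x)).
  by have := Y2 x 0; rewrite add0r => ->; rewrite subrr.
rewrite itg_cst mul0r addr0 /II.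
(* The edges [x = 0] and [x = pi / 2] are glued with [t] reversed, so the flux through them does not
   cancel pointwise; it is odd in [t] and integrates to zero. *)
have -> : (fun t => itg 0 (pi / 2) (fun x => Xx (x, t))) = fun t => X (0, - t) - X (0, t).
  apply/funext => t; rewrite (itgE _ _ (dX' t)).
  by have := X1 0 (- t); rewrite opprK add0r => ->.
have c0 := @continuous_pair1 R X 0 cX.
have c0N : continuous (fun t => X (0, - t)).
  by apply: (continuous_compf c0); move=> t; apply: cvgN; exact: cvg_id.
apply: itg_odd; first exact: pi_gt0.
- cont_tac.
- move=> t; rewrite X2; congr (_ - _).
  by rewrite -(X2 0 (- (t + pi))) opprD subrK.
by move=> t; rewrite opprK opprB.
Qed.

Variable n : nat.
Variables g gx gt gxx gxt gtt : R * R -> 'rV[R]_n.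
Variables (E : R * R -> R) (s : R).
Hypothesis jg : jet g gx gt gxx gxt gtt.
Hypothesis gE : conformal_factor gx gt E.
Hypothesis cE : continuous E.
Hypothesis kg : on_klein g.
Hypothesis s0 : 0 < s.

Let sg := jet_smooth jg.
Let sgx := jet_smooth_fx jg.
Let sgt := jet_smooth_ft jg.
Let sgxx := jet_smooth_fxx jg.
Let sgtt := jet_smooth_ftt jg.
Let d0 (q : R * R) : kd q.2 != 0. Proof. exact: kd_neq0. Qed.
Let E0 q : E q != 0. Proof. by case: (gE q) => /gt_eqF ->. Qed.
Let L q := klein_lap gt gxx gtt q.

Definition conf_den q : R := s + dot (g q) (g q).
Local Notation w := conf_den.
Let A q := dot (g q) (gx q).
Let B q := dot (g q) (gt q).

Lemma conf_den_gt0 q : 0 < w q. Proof. by rewrite ltr_wpDr // dot_ge0. Qed.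
Let w0 q : w q != 0. Proof. by rewrite gt_eqF // conf_den_gt0. Qed.

(** [E] times the component of [g] normal to the surface. *)
Definition conf_normal q : 'rV[R]_n :=
  E q *: g q - A q *: gx q - (kd q.2 ^+ 2 * B q) *: gt q.

(* Vanishes exactly when [g] is, up to scaling, the stereographic projection
   of a minimal surface of the sphere. *)
Definition conf_defect q : 'rV[R]_n := L q + (4 / w q) *: conf_normal q.

(** The conformal factor, relative to dx^2 + dt^2 / kd^2, of the lift of [g] to the unit sphere. *)
Definition conf_area q : R := 4 * s * E q / w q ^+ 2.

(** Completing the square in the Laplacian. The last bracket is half the Laplacian of [ln w], hence
    a divergence. *)
Lemma conf_defectE q : dot (L q) (L q) = dot (conf_defect q) (conf_defect q) + 4 * E q * conf_area q
  - 8 * E q * (E q / w q + dot (g q) (L q) / w q + E q / w q - 2 * (A q ^+ 2 + kd q.2 ^+ 2 * B q ^+ 2) / w q ^+ 2).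
Proof.
have [_ H1 H0 H2] := gE q.
have N1 := klein_lap_fst jg gE q; have N2 := klein_lap_snd jg gE q.
have H2' : dot (gt q) (gt q) = E q / kd q.2 ^+ 2.
  by rewrite -H2 mulrAC divff ?mul1r // expf_neq0 // d0.
rewrite -/(L q) in N1 N2.
have wE : dot (g q) (g q) = w q - s by rewrite /w addrC addKr.
have NE : dot (L q) (conf_normal q) = E q * dot (g q) (L q).
  rewrite (dotC (g q)) /conf_normal; move: (L q) N1 N2 => l N1 N2.
  by rewrite !(dotBr, dotZr) N1 N2; ring.
have NN : dot (conf_normal q) (conf_normal q) =
    E q * (E q * (w q - s) - A q ^+ 2 - kd q.2 ^+ 2 * B q ^+ 2).
  rewrite /conf_normal !(dotBr, dotZr, dotBl, dotZl) (dotC (gx q) (g q)) (dotC (gt q) (g q)).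
  rewrite (dotC (gt q) (gx q)) H0 H1 H2' wE -/(A q) -/(B q).
  by field; exact: d0.
rewrite /conf_defect /conf_area; move: (conf_normal q) (L q) NE NN => v l NE NN.
rewrite !(dotDr, dotDl, dotZr, dotZl) (dotC v l) NE NN.
by field; exact: w0.
Qed.

(** [X] and [Y] are the components of the gradient of [ln w] for dx^2 + dt^2 / kd^2, multiplied by
    the area density [1 / kd]. *)
Let X q := 2 * A q / (w q * kd q.2).
Let Y q := 2 * kd q.2 * B q / w q.
Let Xx q := 2 * (E q + dot (g q) (gxx q)) / (w q * kd q.2) - 4 * A q ^+ 2 / (w q ^+ 2 * kd q.2).
Let Yt q := 2 * kd q.2 * (E q / kd q.2 ^+ 2 + dot (g q) (gtt q)) / w q +
  4 * kS q.2 * kC q.2 / kd q.2 * B q / w q - 4 * kd q.2 * B q ^+ 2 / w q ^+ 2.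

Let sw : smooth w. Proof. by apply: smoothD; [exact: smooth_cst | exact: smooth_dot]. Qed.
Let sA : smooth A. Proof. exact: smooth_dot. Qed.
Let sB : smooth B. Proof. exact: smooth_dot. Qed.

Let dA q : is_derive q e1 A (E q + dot (g q) (gxx q)).
Proof.
have [_ H1 _ _] := gE q.
apply: (is_derive_conv (is_derive_dotE q sg sgx (jet_fx jg) (jet_fxx jg))).
by rewrite H1 addrC.
Qed.

Let dB q : is_derive q e2 B (E q / kd q.2 ^+ 2 + dot (g q) (gtt q)).
Proof.
have [_ _ _ H2] := gE q.
apply: (is_derive_conv (is_derive_dotE q sg sgt (jet_ft jg) (jet_ftt jg))).
by rewrite -H2 mulrAC divff ?expf_neq0 ?d0 // mul1r addrC.
Qed.

Let dw1 q : is_derive q e1 w (2 * A q).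
Proof.
apply: (is_derive_conv (is_derive_addf (is_derive_cstf s q e1) (is_derive_dotE q sg sg (jet_fx jg) (jet_fx jg)))).
by rewrite /A; ring.
Qed.

Let dw2 q : is_derive q e2 w (2 * B q).
Proof.
apply: (is_derive_conv (is_derive_addf (is_derive_cstf s q e2) (is_derive_dotE q sg sg (jet_ft jg) (jet_ft jg)))).
by rewrite /B; ring.
Qed.

Let dX q : is_derive q e1 X (Xx q).
Proof.
have dk := is_derive_kd_fst; have kn := d0 q; have wn := w0 q; have a0 := dA; have b0 := dw1.
have wk : w q * kd q.2 != 0 by rewrite mulf_neq0.
rewrite /X; isd; rewrite /Xx; move: (w q) (kd q.2) wn kn => W k wn kn.
by field; rewrite wn kn.
Qed.

Let dY q : is_derive q e2 Y (Yt q).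
Proof.
have dk := is_derive_kd_snd; have kn := d0 q; have wn := w0 q; have a0 := dB; have b0 := dw2.
rewrite /Y; isd; rewrite /Yt; move: (w q) (kd q.2) wn kn => W k wn kn.
by field; rewrite wn kn.
Qed.

Let ckd := @continuous_kd2 R.
Let ckS : continuous (fun q : R * R => kS q.2).
Proof. by apply: (continuous_compf (@continuous_kS R)) => q; exact: cvg_snd. Qed.
Let ckC : continuous (fun q : R * R => kC q.2).
Proof. by apply: (continuous_compf (@continuous_kC R)) => q; exact: cvg_snd. Qed.

Let cw := smooth_continuous sw.
Let cA := smooth_continuous sA.
Let cB := smooth_continuous sB.
Let cgxx : continuous (fun q => dot (g q) (gxx q)).
Proof. by apply: smooth_continuous; exact: smooth_dot. Qed.
Let cgtt : continuous (fun q => dot (g q) (gtt q)).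
Proof. by apply: smooth_continuous; exact: smooth_dot. Qed.

Let cX : continuous X.
Proof. have h1 := cw; have h2 := cA; have h3 := ckd; have wk q : w q * kd q.2 != 0 by [rewrite mulf_neq0 ?w0 ?d0]. rewrite /X; cont_tac. Qed.

Let cXx : continuous Xx.
Proof.
have h1 := cw; have h2 := cA; have h3 := ckd; have h4 := cgxx; have h5 := cE.
have wk q : w q * kd q.2 != 0 by rewrite mulf_neq0 ?w0 ?d0.
have wk2 q : w q ^+ 2 * kd q.2 != 0 by rewrite mulf_neq0 ?d0 // expf_neq0 // w0.
by rewrite /Xx; cont_tac.
Qed.

Let cYt : continuous Yt.
Proof.
have h1 := cw; have h2 := cB; have h3 := ckd; have h4 := cgtt; have h5 := cE; have h6 := ckS; have h7 := ckC.
have wk := w0; have kk := d0.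
have wk2 q : w q ^+ 2 != 0 by apply: expf_neq0; done.
have kk2 (q : R * R) : kd q.2 ^+ 2 != 0 by apply: expf_neq0; done.
by rewrite /Yt; cont_tac.
Qed.

Lemma continuous_conf_area : continuous conf_area.
Proof.
have h1 := cw; have h5 := cE; have wk2 q : w q ^+ 2 != 0 by apply: expf_neq0; done.
by rewrite /conf_area; cont_tac.
Qed.

Definition conf_defect_density q := dot (conf_defect q) (conf_defect q) / (4 * E q * kd q.2).

Lemma conf_defect_density_ge0 q : 0 <= conf_defect_density q.
Proof.
have [e0 _ _ _] := gE q.
by rewrite /conf_defect_density divr_ge0 ?dot_ge0 // mulr_ge0 ?mulr_ge0 // ltW ?kd_gt0.
Qed.

Let densE q : willmore_density gt gxx gtt E q =
  4 * (conf_defect_density q + conf_area q / kd q.2 - (Xx q + Yt q)).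
Proof.
rewrite /willmore_density -/(L q) conf_defectE /conf_defect_density /Xx /Yt.
have -> : dot (g q) (L q) = dot (g q) (gxx q) + kd q.2 ^+ 2 * dot (g q) (gtt q) + 2 * kS q.2 * kC q.2 * B q.
  by rewrite /L /klein_lap !dotDr !dotZr.
have := E0 q; have := w0 q; have := d0 q.
move: (conf_area q) (dot (conf_defect q) _) (w q) (kd q.2) (E q) => ? ? ? ? ? h1 h2 h3.
by field; rewrite h1 h2 h3.
Qed.

Let defE q : conf_defect_density q = willmore_density gt gxx gtt E q / 4 - conf_area q / kd q.2 + (Xx q + Yt q).
Proof. by rewrite densE; field. Qed.

Lemma continuous_conf_defect_density : continuous conf_defect_density.
Proof.
rewrite (_ : conf_defect_density = fun q => willmore_density gt gxx gtt E q / 4 - conf_area q / kd q.2 + (Xx q + Yt q)); last first.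
  by apply/funext => q; exact: defE.
have h1 := continuous_willmore_density jg gE cE; have h2 := cXx; have h3 := cYt.
have h4 := continuous_conf_area; have h5 := ckd; have h6 := d0.
cont_tac.
Qed.

(** The integrated identity: since [g] descends to the Klein bottle, the divergence of the gradient
    of [ln w] integrates to zero, leaving the defect and the area of the lift. *)
Lemma willmore_split : 4^-1 * II (willmore_density gt gxx gtt E) =
  II conf_defect_density + II (fun q => conf_area q / kd q.2).
Proof.
have h1 := continuous_conf_defect_density; have h2 := cXx; have h3 := cYt.
have h4 := continuous_conf_area; have h5 := ckd; have h6 := d0.
have V0 : II (fun q => Xx q + Yt q) = 0.
  have K1 := klein_glide kg; have K2 := klein_translation kg.
  have K := klein_derive sg kg (jet_fx jg) (jet_ft jg).
  have kN (t : R) : kd (- t) = kd t := kd_even t.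
  have kP (t : R) : kd (t + pi) = kd t := kd_periodic t.
  apply: (II_divergence cX h2 h3 dX dY) => x t; have [k1 k2 k3 k4] := K x t.
  - by rewrite /X /A /w K1 k1 /= kN.
  - by rewrite /X /A /w K2 k3 /= kP.
  - by rewrite /Y /B /w K2 k4 /= kP.
pose D q := conf_defect_density q + conf_area q / kd q.2; pose V q := Xx q + Yt q.
have cAk : continuous (fun q => conf_area q / kd q.2) by cont_tac.
have cD : continuous D by rewrite /D; cont_tac.
have cV : continuous V by rewrite /V; cont_tac.
have cDV : continuous (fun q => D q - V q) by cont_tac.
have -> : willmore_density gt gxx gtt E = fun q => 4 * (D q - V q).
  by apply/funext => q; exact: densE.
rewrite (IIZ _ cDV) (IIB cD cV) V0 subr0 (IID h1 cAk).
by rewrite mulrA mulVf ?mul1r.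
Qed.

End LiYau.

(** * Stereographic lifts *)

Section WillmoreBound.
Variable R : realType.
Local Notation pi := (@pi R).
Local Notation kC := (@kC R).
Local Notation kS := (@kS R).
Local Notation kd := (@kd R).
Local Notation kw := (@kw R).
Local Notation II := (@II R).
Local Notation e1 := ((1, 0) : R * R).
Local Notation e2 := ((0, 1) : R * R).
Variable n : nat.

(* Inverse stereographic projection to the unit sphere, after the dilation by
   [(Num.sqrt s)^-1]. *)
Definition stereo_inv (s : R) (u : 'rV[R]_n) : 'rV[R]_(n + 1) :=
  row_mx ((2 * Num.sqrt s / (s + dot u u)) *: u) (1 - 2 * s / (s + dot u u))%:M.

Lemma dot_row_mx m (a c : 'rV[R]_n) (b d : 'rV[R]_m) :
  dot (row_mx a b) (row_mx c d) = dot a c + dot b d.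
Proof.
rewrite /dot big_split_ord /=; congr (_ + _); apply: eq_bigr => i _.
  by rewrite !row_mxEl.
by rewrite !row_mxEr.
Qed.

Lemma dot_scalar (a b : R) : dot (a%:M : 'rV_1) b%:M = a * b.
Proof. by rewrite /dot big_ord_recl big_ord0 !mxE /= !mulr1n addr0. Qed.

Lemma dot_stereo_inv s u : 0 < s -> dot (stereo_inv s u) (stereo_inv s u) = 1.
Proof.
move=> s0; rewrite /stereo_inv dot_row_mx dot_scalar dotZl dotZr.
have w0 : s + dot u u != 0 by rewrite gt_eqF // ltr_wpDr // dot_ge0.
have sE : Num.sqrt s ^+ 2 = s by rewrite sqr_sqrtr // ltW.
transitivity (4 * Num.sqrt s ^+ 2 * dot u u / (s + dot u u) ^+ 2 + (1 - 2 * s / (s + dot u u)) ^+ 2); first by field.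
by rewrite sE; field.
Qed.

Lemma stereo_inv_scale s u : 0 < s -> stereo_inv s u = stereo_inv 1 ((Num.sqrt s)^-1 *: u).
Proof.
move=> s0; rewrite /stereo_inv dotZl dotZr sqrtr1.
have w0 : s + dot u u != 0 by rewrite gt_eqF // ltr_wpDr // dot_ge0.
have r0 : Num.sqrt s != 0 by rewrite gt_eqF // sqrtr_gt0.
have sE : Num.sqrt s ^+ 2 = s by rewrite sqr_sqrtr // ltW.
have wE : 1 + (Num.sqrt s)^-1 * ((Num.sqrt s)^-1 * dot u u) = (s + dot u u) / s.
  by rewrite mulrA -expr2 exprVn sE; field; rewrite gt_eqF.
rewrite wE scalerA; congr row_mx.
  congr (_ *: _); rewrite -[X in _ / (_ / X)]sE; field.
  by rewrite r0 w0.
by congr (_%:M); field; rewrite w0 gt_eqF.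
Qed.

Lemma stereo_inv_inj s u v : 0 < s -> stereo_inv s u = stereo_inv s v -> u = v.
Proof.
move=> s0 /eq_row_mx[H /(congr1 (fun M : 'M[R]_1 => M 0 0))]; rewrite !mxE /= !mulr1n => H0.
have w0 (x : 'rV[R]_n) : s + dot x x != 0 by rewrite gt_eqF // ltr_wpDr // dot_ge0.
have r0 : Num.sqrt s != 0 by rewrite gt_eqF // sqrtr_gt0.
have E : (s + dot u u)^-1 = (s + dot v v)^-1.
  have s2 : 2 * s != 0 by rewrite gt_eqF // mulr_gt0.
  by apply: (mulfI s2); move/addrI/oppr_inj: H0.
move: H; rewrite E => /scalerI; apply.
by rewrite !mulf_neq0 // invr_neq0.
Qed.

Section Map.
Variables g gx gt : R * R -> 'rV[R]_n.
Variable s : R.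
Hypothesis s0 : 0 < s.
Hypothesis sg : smooth g.
Local Notation w := (conf_den g s).

Let w0 q : w q != 0. Proof. by rewrite gt_eqF // conf_den_gt0. Qed.
Let sw : smooth w. Proof. by apply: smoothD; [exact: smooth_cst | exact: smooth_dot]. Qed.

Let FEl q j : stereo_inv s (g q) 0 (lshift 1 j) = 2 * Num.sqrt s / w q * g q 0 j.
Proof. by rewrite row_mxEl mxE. Qed.

Let FEr q j : stereo_inv s (g q) 0 (rshift n j) = 1 - 2 * s / w q.
Proof. by rewrite row_mxEr ord1 mxE eqxx mulr1n. Qed.

Lemma smooth_stereo_inv : smooth (fun q => stereo_inv s (g q)).
Proof.
apply: smooth_rV => i; have wn := w0; have sw' := sw; have sgi j := smooth_coord j sg.
case: (split_ordP i) => j ->.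
  have -> : (fun q => stereo_inv s (g q) 0 (lshift 1 j)) = fun q => 2 * Num.sqrt s / w q * g q 0 j.
    by apply/funext => q; exact: FEl.
  smooth_tac.
have -> : (fun q => stereo_inv s (g q) 0 (rshift n j)) = fun q => 1 - 2 * s / w q.
  by apply/funext => q; exact: FEr.
smooth_tac.
Qed.

Lemma derive_stereo_inv v gv q : 'D_v g = gv ->
  'D_v (fun q => stereo_inv s (g q)) q =
  row_mx ((2 * Num.sqrt s / w q) *: gv q - (4 * Num.sqrt s * dot (g q) (gv q) / w q ^+ 2) *: g q)
         (4 * s * dot (g q) (gv q) / w q ^+ 2)%:M.
Proof.
move=> dg; have wn := w0 q.
have dw : is_derive q v w (2 * dot (g q) (gv q)).
  apply: (is_derive_conv (is_derive_addf (is_derive_cstf s q v) (is_derive_dotE q sg sg dg dg))).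
  by ring.
apply/rowP => i; rewrite derive_coord; last exact/smooth_diff/smooth_stereo_inv.
case: (split_ordP i) => j ->.
  have dj : is_derive q v (fun q => g q 0 j) (gv q 0 j).
    rewrite -dg derive_coord; last exact: smooth_diff.
    by apply: smooth_is_derive; exact: smooth_coord.
  have -> : (fun q => stereo_inv s (g q) 0 (lshift 1 j)) = fun q => 2 * Num.sqrt s / w q * g q 0 j.
    by apply/funext => p; exact: FEl.
  rewrite row_mxEl !mxE.
  have : is_derive q v (fun q => 2 * Num.sqrt s / w q * g q 0 j)
      (2 * Num.sqrt s / w q * gv q 0 j - 4 * Num.sqrt s * dot (g q) (gv q) / w q ^+ 2 * g q 0 j).
    by isd; field.
  by move=> [_ ->].
have -> : (fun q => stereo_inv s (g q) 0 (rshift n j)) = fun q => 1 - 2 * s / w q.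
  by apply/funext => p; exact: FEr.
rewrite row_mxEr ord1 mxE eqxx mulr1n.
have : is_derive q v (fun q => 1 - 2 * s / w q) (4 * s * dot (g q) (gv q) / w q ^+ 2).
  by isd; field.
by move=> [_ ->].
Qed.

(** Conformality of stereographic projection, with factor [4 s / w^2]. *)
Lemma metric_stereo_inv v v' gv gv' q : 'D_v g = gv -> 'D_v' g = gv' ->
  dot ('D_v (fun q => stereo_inv s (g q)) q) ('D_v' (fun q => stereo_inv s (g q)) q) =
  4 * s * dot (gv q) (gv' q) / w q ^+ 2.
Proof.
move=> dg dg'; rewrite (derive_stereo_inv q dg) (derive_stereo_inv q dg') dot_row_mx dot_scalar.
rewrite !(dotBl, dotBr, dotZl, dotZr) (dotC (gv q) (g q)).
have sE : Num.sqrt s ^+ 2 = s by rewrite sqr_sqrtr // ltW.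
have -> : dot (g q) (g q) = w q - s by rewrite /conf_den addrC addKr.
move: (w q) (w0 q) (Num.sqrt s) sE (dot _ _) (dot _ _) (dot _ _) => W W0 r <- a a' b.
by field.
Qed.

End Map.

(** For the balanced centre and scale, the Willmore energy is at least the area of the lift, and
    this area is at least that of the bipolar surface. Equality makes both steps sharp, in
    particular the spectral gap for every coordinate. *)
Lemma willmore_ge (f fx ft fxx fxt ftt : R * R -> 'rV[R]_n) (E : R * R -> R) :
  jet f fx ft fxx fxt ftt -> conformal_factor fx ft E -> continuous E -> on_klein f ->
  6 * II (fun q => kw q.2) <= willmore f /\
  (willmore f = 6 * II (fun q => kw q.2) -> exists c s, 0 < s /\
     forall i, first_modes (fun q => stereo_inv s (f q - c) 0 i)).
Proof.
move=> jf fE cE kf; have sf := jet_smooth jf.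
have pi0 := pi_gt0 R; have h0 : 0 < pi / 2 by rewrite divr_gt0.
have [F0 F0P] : exists M : R, forall j x t, 0 <= x <= pi / 2 -> 0 <= t <= pi -> `|f (x, t) 0 j| <= M.
  have cK : compact (`[0, pi / 2] `*` `[0, pi] : set (R * R)).
    by apply: compact_setX; exact: segment_compact.
  have cff : continuous (fun q => dot (f q) (f q)) by apply: smooth_continuous; exact: smooth_dot.
  have K0 : (`[0, pi / 2] `*` `[0, pi] : set (R * R)) (0, 0).
    by split; rewrite /= in_itv /= lexx ltW.
  have [q0 _ H] := compact_EVT_max (ex_intro _ _ K0) cK (continuous_subspaceT cff).
  (* A square at most [m] has its root at most [1 + m], which avoids a square root. *)
  exists (1 + dot (f q0) (f q0)) => j x t xI tI.
  have : dot (f (x, t)) (f (x, t)) <= dot (f q0) (f q0).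
    by apply: H; rewrite inE; split; rewrite /= in_itv.
  have : f (x, t) 0 j ^+ 2 <= dot (f (x, t)) (f (x, t)).
    by rewrite /dot (bigD1 j) //= -expr2 lerDl sumr_ge0 // => i _; rewrite -expr2 sqr_ge0.
  move: (f (x, t) 0 j) (dot _ _) (dot _ _) => a b c' H1 H2.
  by rewrite ler_norml; apply/andP; split; nra.
have HC i := coord_C1 i sf (jet_fx jf) (jet_ft jf).
have [||||c [s [s0 bal1 bal2]]] := @balance R n (fun j q => f q 0 j) (fun j q => fx q 0 j) _ _ _ _ F0 F0P.
- by move=> j; case: (HC j).
- by move=> j; case: (HC j).
- by move=> j x t; case: (HC j).
- move=> q; have [e0 H _ _] := fE q; apply: contrapT => /forallNP fx0.
  move: e0; rewrite -H /dot big1 ?ltxx // => i _.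
  by have /negP := fx0 i; rewrite negbK => /eqP ->; rewrite mul0r.
pose g q := f q - c.
have sg : smooth g by apply: smoothB => //; exact: smooth_cst.
have gv v : 'D_v g = 'D_v f by exact: derive_subcst.
have jg : jet g fx ft fxx fxt ftt.
  exact: (Jet sg (etrans (gv _) (jet_fx jf)) (etrans (gv _) (jet_ft jf)) (jet_fxx jf)
    (jet_fxt jf) (jet_ftx jf) (jet_ftt jf)).
have kg : on_klein g by move=> p q pq; rewrite /g (kf _ _ pq).
have dist2E q : dist2 (fun j q => f q 0 j) c q = dot (g q) (g q).
  by apply: eq_bigr => j _; rewrite !mxE expr2.
have wE q : s + dist2 (fun j q => f q 0 j) c q = conf_den g s q by rewrite dist2E.
have w0 q : conf_den g s q != 0 by rewrite gt_eqF // conf_den_gt0.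
have cw : continuous (conf_den g s).
  by apply: smooth_continuous; apply: smoothD; [exact: smooth_cst | exact: smooth_dot].
have ckw := @continuous_kw2 R.
have cgj j : continuous (fun q => g q 0 j) by apply: smooth_continuous; exact: smooth_coord.
have cA := continuous_conf_area jg cE s0.
have cD := continuous_conf_defect_density jg fE cE s0.
have WE := willmoreE jf fE cE.
rewrite (willmore_split jg fE cE kg s0) in WE.
have D0 := II_ge0 cD (conf_defect_density_ge0 g fxx ftt s fE).
pose F q := stereo_inv s (g q).
have sF : smooth F := smooth_stereo_inv s0 sg.
have kF : on_klein F by move=> p q pq; rewrite /F (kg _ _ pq).
have FF q : dot (F q) (F q) = 1 by exact: dot_stereo_inv.
have g1 : 'D_e1 g = fx := jet_fx jg.
have g2 : 'D_e2 g = ft := jet_ft jg.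
have eE1 q : dot ('D_e1 F q) ('D_e1 F q) = conf_area g E s q.
  by rewrite (metric_stereo_inv s0 sg q g1 g1); have [_ -> _ _] := fE q.
have eE2 q : kd q.2 ^+ 2 * dot ('D_e2 F q) ('D_e2 F q) = conf_area g E s q.
  rewrite (metric_stereo_inv s0 sg q g2 g2) /conf_area; have [_ _ _ <-] := fE q.
  by field; exact: w0.
(* The first [n] coordinates are balanced by the choice of the centre, the last one by that of the
   scale. *)
have mean0 i : II (fun q => kw q.2 * F q 0 i) = 0.
  case: (split_ordP i) => j ->.
    rewrite (_ : (fun q => _) = fun q => (2 * Num.sqrt s) * (kw q.2 * ((f q 0 j - c 0 j) / (s + dist2 (fun j q => f q 0 j) c q)))).
      rewrite IIZ ?bal1 ?mulr0 //.
      rewrite (_ : (fun q => _) = fun q => kw q.2 * (g q 0 j / conf_den g s q)); first cont_tac.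
      by apply/funext => q; rewrite wE !mxE.
    apply/funext => q; rewrite /F row_mxEl !mxE wE /conf_den.
    have := w0 q; rewrite /conf_den => wn; by field.
  rewrite (_ : (fun q => _) = fun q => kw q.2 - 2 * (kw q.2 * (s / conf_den g s q))).
    have c1 : continuous (fun q => kw q.2 * (s / conf_den g s q)) by cont_tac.
    have c2 : continuous (fun q => 2 * (kw q.2 * (s / conf_den g s q))) by cont_tac.
    rewrite (IIB ckw c2) (IIZ _ c1).
    rewrite (_ : (fun q => kw q.2 * (s / conf_den g s q)) = fun q => kw q.2 * (s / (s + dist2 (fun j q => f q 0 j) c q))).
      by rewrite bal2; field.
    by apply/funext => q; rewrite wE.
  apply/funext => q; rewrite /F row_mxEr ord1 mxE eqxx mulr1n /conf_den.
  by have := w0 q; rewrite /conf_den => wn; field.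
have [ge6 eq6] := conformal_area_ge sF kF erefl erefl cA FF eE1 eE2 mean0.
split; first by rewrite WE; lra.
move=> We; exists c, s; split => //; apply: eq6.
by move: We; rewrite WE; lra.
Qed.

End WillmoreBound.

(** * First eigenfunctions *)

(* The first hypothesis leaves a one-parameter family of diagonal forms; the
   second one, which comes from conformality at a single point, fixes it. *)
Lemma quad_coeffs (R : realType) (b00 b01 b02 b03 b04 b11 b12 b13 b14 b22 b23 b24 b33 b34 b44 : R) :
  (forall S C c s : R, S ^+ 2 + C ^+ 2 = 1 -> c ^+ 2 + s ^+ 2 = 1 ->
    let x := c ^+ 2 - s ^+ 2 in let y := 2 * s * c in
    b00 * S ^+ 2 + b11 * x ^+ 2 + b22 * y ^+ 2 + b33 * (C * c) ^+ 2 + b44 * (C * s) ^+ 2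
    + 2 * (b01 * (S * x) + b02 * (S * y) + b03 * (S * (C * c)) + b04 * (S * (C * s))
         + b12 * (x * y) + b13 * (x * (C * c)) + b14 * (x * (C * s))
         + b23 * (y * (C * c)) + b24 * (y * (C * s)) + b34 * (C * c * (C * s))) = 4 - C ^+ 2) ->
  b22 = b33 ->
  [/\ b00 = 5 / 2, [/\ b11 = 3 / 2, b22 = 3 / 2, b33 = 3 / 2 & b44 = 3 / 2],
      [/\ b01 = 0, b02 = 0, b03 = 0 & b04 = 0], [/\ b12 = 0, b13 = 0 & b14 = 0] &
      [/\ b23 = 0, b24 = 0 & b34 = 0]].
Proof.
move=> P e.
(* The identity is evaluated at rational points of the circle, the last two from the triple 3, 4, 5;
   each value is a linear equation in the coefficients. *)
have u1 : 1 ^+ 2 + 0 ^+ 2 = 1 :> R by ring.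
have u2 : (-1) ^+ 2 + 0 ^+ 2 = 1 :> R by ring.
have u3 : 0 ^+ 2 + 1 ^+ 2 = 1 :> R by ring.
have u4 : 0 ^+ 2 + (-1) ^+ 2 = 1 :> R by ring.
have u5 : (3 / 5) ^+ 2 + (4 / 5) ^+ 2 = 1 :> R by field.
have u6 : (3 / 5) ^+ 2 + (- 4 / 5) ^+ 2 = 1 :> R by field.
have a1 := P _ _ _ _ u1 u1; have a2 := P _ _ _ _ u2 u1.
have a3 := P _ _ _ _ u1 u5; have a4 := P _ _ _ _ u2 u5.
have a5 := P _ _ _ _ u1 u6.
have h01 : b01 = 0 by move: a1 a2 => /=; lra.
have h02 : b02 = 0 by move: a3 a4; rewrite h01 /=; lra.
have h11 : b11 = 4 - b00 by move: a1; rewrite h01 /=; lra.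
have h12 : b12 = 0 by move: a3 a5; rewrite h01 h02 h11 /=; lra.
have h22 : b22 = 4 - b00 by move: a3; rewrite h01 h02 h11 h12 /=; lra.
have c1 := P _ _ _ _ u3 u1; have c2' := P _ _ _ _ u4 u1.
have c3 := P _ _ _ _ u3 u3; have c4' := P _ _ _ _ u4 u3.
have c5 := P _ _ _ _ u3 u5; have c6 := P _ _ _ _ u4 u5.
have c7 := P _ _ _ _ u3 u6; have c8 := P _ _ _ _ u4 u6.
move: c1 c2' c3 c4' c5 c6 c7 c8; rewrite h11 h22 h12 h01 h02 /= => c1 c2' c3 c4' c5 c6 c7 c8.
have h13 : b13 = 0 by clear - c1 c2'; lra.
have h14 : b14 = 0 by clear - c3 c4'; lra.
have h33 : b33 = b00 - 1 by rewrite h13 in c1; clear - c1; lra.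
have h44 : b44 = b00 - 1 by rewrite h14 in c3; clear - c3; lra.
move: c5 c6 c7 c8; rewrite h13 h14 h33 h44 => c5 c6 c7 c8.
have h34 : b34 = 0 by clear - c5 c6 c7 c8; lra.
have h23 : b23 = 0 by rewrite h34 in c5 c6 c7 c8; clear - c5 c6 c7 c8; lra.
have h24 : b24 = 0 by rewrite h34 h23 in c5 c6 c7 c8; clear - c5 c6 c7 c8; lra.
have d1 := P _ _ _ _ u5 u1; have d3 := P _ _ _ _ u5 u3.
move: d1 d3; rewrite h01 h02 h11 h12 h13 h14 h22 h33 h44 h23 h24 h34 /= => d1 d3.
have h03 : b03 = 0 by clear - d1; lra.
have h04 : b04 = 0 by clear - d3; lra.
have b0 : b00 = 5 / 2 by rewrite h22 h33 in e; clear - e; lra.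
by split=> //; split=> //; rewrite ?h11 ?h22 ?h33 ?h44 b0; clear; field.
Qed.

Section FirstModes.
Variable R : realType.
Local Notation pi := (@pi R).
Local Notation kC := (@kC R).
Local Notation kS := (@kS R).
Local Notation kd := (@kd R).
Local Notation kw := (@kw R).
Local Notation e1 := ((1, 0) : R * R).
Local Notation e2 := ((0, 1) : R * R).

Lemma ord5P (P : 'I_5 -> Prop) : P (inord 0) -> P (inord 1) -> P (inord 2) -> P (inord 3) -> P (inord 4) ->
  forall i, P i.
Proof.
move=> h0 h1 h2 h3 h4 [[|[|[|[|[|//]]]]] i];
  by [rewrite (_ : Ordinal i = inord 0) //; apply: val_inj; rewrite /= inordK
     |rewrite (_ : Ordinal i = inord 1) //; apply: val_inj; rewrite /= inordK
     |rewrite (_ : Ordinal i = inord 2) //; apply: val_inj; rewrite /= inordK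
     |rewrite (_ : Ordinal i = inord 3) //; apply: val_inj; rewrite /= inordK
     |rewrite (_ : Ordinal i = inord 4) //; apply: val_inj; rewrite /= inordK].
Qed.

Lemma sum5 (F : 'I_5 -> R) :
  \sum_i F i = F (inord 0) + F (inord 1) + F (inord 2) + F (inord 3) + F (inord 4).
Proof.
rewrite !big_ord_recl big_ord0 addr0 !addrA.
by do !congr (_ + _); congr F; apply: val_inj; rewrite /= inordK.
Qed.

Section Vec5.
Variables a0 a1 a2 a3 a4 : R * R -> R.
Let V q : 'rV[R]_5 := vec 5 [:: a0 q; a1 q; a2 q; a3 q; a4 q].

Let coordE k : (k < 5)%N -> (fun q => V q 0 (inord k)) = nth (fun=> 0) [:: a0; a1; a2; a3; a4] k.
Proof.
move=> k5; apply/funext => q; rewrite mxE inordK //.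
by move: k k5 => [|[|[|[|[|//]]]]].
Qed.

Lemma smooth_vec5 : smooth a0 -> smooth a1 -> smooth a2 -> smooth a3 -> smooth a4 -> smooth V.
Proof.
by move=> s0 s1 s2 s3 s4; apply: smooth_rV; apply: ord5P; rewrite coordE.
Qed.

Lemma derive_vec5 v q b0 b1 b2 b3 b4 : smooth V ->
  is_derive q v a0 b0 -> is_derive q v a1 b1 -> is_derive q v a2 b2 ->
  is_derive q v a3 b3 -> is_derive q v a4 b4 -> 'D_v V q = vec 5 [:: b0; b1; b2; b3; b4].
Proof.
move=> sV D0 D1 D2 D3 D4; apply/rowP.
have dV : differentiable V q by exact: smooth_diff.
apply: ord5P; rewrite derive_coord // coordE // mxE inordK //=.
- by case: D0.
- by case: D1.
- by case: D2.
- by case: D3.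
by case: D4.
Qed.

End Vec5.


Definition separated (a0 a1 a2 b0 b1 b2 b3 b4 : R -> R) (q : R * R) : 'rV[R]_5 :=
  vec 5 [:: a0 q.2 * b0 q.1; a1 q.2 * b1 q.1; a1 q.2 * b2 q.1; a2 q.2 * b3 q.1; a2 q.2 * b4 q.1].

Section Separated.
Variables a0 a1 a2 b0 b1 b2 b3 b4 : R -> R.
Local Notation V := (separated a0 a1 a2 b0 b1 b2 b3 b4).

Lemma smooth_separated :
  smooth (fun q : R * R => a0 q.2) -> smooth (fun q : R * R => a1 q.2) ->
  smooth (fun q : R * R => a2 q.2) -> smooth (fun q : R * R => b0 q.1) ->
  smooth (fun q : R * R => b1 q.1) -> smooth (fun q : R * R => b2 q.1) ->
  smooth (fun q : R * R => b3 q.1) -> smooth (fun q : R * R => b4 q.1) -> smooth V.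
Proof. by move=> *; apply: smooth_vec5; apply: smoothM. Qed.

Let sep1 (a b : R -> R) l (q : R * R) : is_derive q.1 1 b l ->
  is_derive q e1 (fun q => a q.2 * b q.1) (a q.2 * l).
Proof.
case: q => x t db; apply: (is_derive_fst (fun q => a q.2 * b q.1) x t _).2 => /=.
by isd; rewrite mulr0 addr0.
Qed.

Let sep2 (a b : R -> R) l (q : R * R) : is_derive q.2 1 a l ->
  is_derive q e2 (fun q => a q.2 * b q.1) (l * b q.1).
Proof.
case: q => x t da; apply: (is_derive_snd (fun q => a q.2 * b q.1) x t _).2 => /=.
by isd; rewrite mulr0 add0r mulrC.
Qed.

Lemma derive_separated1 (b0' b1' b2' b3' b4' : R -> R) : smooth V ->
  (forall x : R, is_derive x 1 b0 (b0' x)) -> (forall x : R, is_derive x 1 b1 (b1' x)) ->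
  (forall x : R, is_derive x 1 b2 (b2' x)) -> (forall x : R, is_derive x 1 b3 (b3' x)) ->
  (forall x : R, is_derive x 1 b4 (b4' x)) ->
  'D_e1 V = separated a0 a1 a2 b0' b1' b2' b3' b4'.
Proof.
by move=> sV d0 d1 d2 d3 d4; apply/funext => q; apply: derive_vec5 => //; apply: sep1.
Qed.

Lemma derive_separated2 (a0' a1' a2' : R -> R) : smooth V ->
  (forall x : R, is_derive x 1 a0 (a0' x)) -> (forall x : R, is_derive x 1 a1 (a1' x)) ->
  (forall x : R, is_derive x 1 a2 (a2' x)) ->
  'D_e2 V = separated a0' a1' a2' b0 b1 b2 b3 b4.
Proof.
by move=> sV d0 d1 d2; apply/funext => q; apply: derive_vec5 => //; apply: sep2.
Qed.

End Separated.

Let d0 t : kd t != 0. Proof. exact: kd_neq0. Qed.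

(** Twice the conformal factor [6 kw kd] of the bipolar metric, the 2 being its first eigenvalue. *)
Definition mode_mu t : R := 12 * (4 + kC t ^+ 2) / kd t ^+ 2.
Definition a_0 t : R := kS t / kd t.
Definition a_1 t : R := (kd t)^-1.
Definition a_2 t : R := kC t / kd t.
Definition a_0' t : R := 6 * kC t / kd t ^+ 3.
Definition a_1' t : R := - (2 * kS t * kC t / kd t ^+ 3).
Definition a_2' t : R := - (8 * kS t / kd t ^+ 3).
(** The second derivative as prescribed by [kd (kd a')' = (k - mode_mu) a], with
    [kd kd' = 2 kS kC]. *)
Definition a_'' (k : R) (a a' : R -> R) t : R :=
  ((k - mode_mu t) * a t - 2 * kS t * kC t * a' t) / kd t ^+ 2.

Lemma is_derive_a_0' (t : R) : is_derive t 1 a_0' (a_'' 0 a_0 a_0' t).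
Proof.
have h := d0 t; have dC := is_derive_kC t; have dd := is_derive_kd t.
rewrite /a_0'; isd; rewrite ?expf_neq0 // /a_'' /mode_mu /a_0 /a_0'.
by field: (kd2 t) (kS2 t).
Qed.

Lemma is_derive_a_1' (t : R) : is_derive t 1 a_1' (a_'' 16 a_1 a_1' t).
Proof.
have h := d0 t; have dC := is_derive_kC t; have dS := is_derive_kS t; have dd := is_derive_kd t.
rewrite /a_1'; isd; rewrite ?expf_neq0 // /a_'' /mode_mu /a_1 /a_1'.
by field: (kd2 t) (kS2 t).
Qed.

Lemma is_derive_a_2' (t : R) : is_derive t 1 a_2' (a_'' 4 a_2 a_2' t).
Proof.
have h := d0 t; have dC := is_derive_kC t; have dS := is_derive_kS t; have dd := is_derive_kd t.
rewrite /a_2'; isd; rewrite ?expf_neq0 // /a_'' /mode_mu /a_2 /a_2'.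
by field: (kd2 t) (kS2 t).
Qed.

Let cst0 (x : R) : R := 0.
Let cst1 (x : R) : R := 1.
Let c4 (x : R) := cos (4 * x).
Let s4 (x : R) := sin (4 * x).
Let c2 (x : R) := cos (2 * x).
Let s2 (x : R) := sin (2 * x).

Definition modes := separated a_0 a_1 a_2 cst1 c4 s4 c2 s2.
Definition modes_x := separated a_0 a_1 a_2 cst0
  (fun x => - (4 * s4 x)) (fun x => 4 * c4 x) (fun x => - (2 * s2 x)) (fun x => 2 * c2 x).
Definition modes_t := separated a_0' a_1' a_2' cst1 c4 s4 c2 s2.
Definition modes_xx := separated a_0 a_1 a_2 cst0
  (fun x => - (16 * c4 x)) (fun x => - (16 * s4 x)) (fun x => - (4 * c2 x)) (fun x => - (4 * s2 x)).
Definition modes_tt := separated (a_'' 0 a_0 a_0') (a_'' 16 a_1 a_1') (a_'' 4 a_2 a_2') cst1 c4 s4 c2 s2.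

Let skC : smooth (fun q : R * R => kC q.2).
Proof. rewrite /kC; smooth_tac. Qed.
Let skS : smooth (fun q : R * R => kS q.2).
Proof. rewrite /kS; smooth_tac. Qed.
Let skd : smooth (fun q : R * R => kd q.2).
Proof.
have h := skC; have h0 (q : R * R) : 0 < 4 - kC q.2 ^+ 2 by exact: kdom_gt0.
rewrite /kd; smooth_tac.
Qed.

Lemma smooth_modes : smooth modes.
Proof.
have h1 := skC; have h2 := skS; have h3 := skd; have h4 (q : R * R) := d0 q.2.
by apply: smooth_separated; rewrite /a_0 /a_1 /a_2 /cst1 /c4 /s4 /c2 /s2; smooth_tac.
Qed.

Lemma modes_jet : [/\ 'D_e1 modes = modes_x, 'D_e2 modes = modes_t,
  'D_e1 modes_x = modes_xx & 'D_e2 modes_t = modes_tt].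
Proof.
have s1 := smooth_modes.
have E1 : 'D_e1 modes = modes_x.
  by apply: derive_separated1 => // x; rewrite /cst1 /cst0 /c4 /s4 /c2 /s2; isd; ring.
have E2 : 'D_e2 modes = modes_t.
  exact: (derive_separated2 s1 (@is_derive_Sd R) (@is_derive_invd R) (@is_derive_Cd R)).
have sx : smooth modes_x by rewrite -E1; exact: smooth_derive.
have st : smooth modes_t by rewrite -E2; exact: smooth_derive.
split; [exact: E1 | exact: E2 | |].
  by apply: derive_separated1 => // x; rewrite /cst1 /cst0 /c4 /s4 /c2 /s2; isd; ring.
exact: (derive_separated2 st is_derive_a_0' is_derive_a_1' is_derive_a_2').
Qed.

(** In each component the frequency squared produced by [modes_xx] cancels the constant [k] in the
    equation of the profile. *)
Lemma modes_lap q : klein_lap modes_t modes_xx modes_tt q = - mode_mu q.2 *: modes q.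
Proof.
have h := d0 q.2.
apply/rowP; apply: ord5P; rewrite !mxE !inordK //= /a_'' /cst0 /cst1; field; exact: h.
Qed.

(** The weights for which the modes have unit norm: [5/2 kS^2 + 3/2 (1 + kC^2) = 4 - kC^2 =
    kd^2]. *)
Definition frame_gram : 'M[R]_5 := diag_mx (vec 5 [:: 5 / 2; 3 / 2; 3 / 2; 3 / 2; 3 / 2]).

Section Frame.
Variable m : nat.
Implicit Types (A : 'M[R]_(5, m)) (u v : 'rV[R]_5).

Lemma dot_mulmx A u v : dot (u *m A) (v *m A) = (u *m (A *m A^T) *m v^T) 0 0.
Proof. by rewrite dotE trmx_mul !mulmxA. Qed.

Lemma dot_frame A u v : A *m A^T = frame_gram ->
  dot (u *m A) (v *m A) = 5 / 2 * (u 0 (inord 0) * v 0 (inord 0)) + 3 / 2 *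
    (u 0 (inord 1) * v 0 (inord 1) + u 0 (inord 2) * v 0 (inord 2) +
     u 0 (inord 3) * v 0 (inord 3) + u 0 (inord 4) * v 0 (inord 4)).
Proof.
move=> G; rewrite dot_mulmx G /frame_gram mul_mx_diag mxE sum5 !mxE !inordK //=.
by ring.
Qed.

Lemma frame_metric A q : A *m A^T = frame_gram ->
  [/\ dot (modes q *m A) (modes q *m A) = 1,
      dot (modes_x q *m A) (modes_x q *m A) = mode_mu q.2 / 2,
      dot (modes_x q *m A) (modes_t q *m A) = 0 &
      kd q.2 ^+ 2 * dot (modes_t q *m A) (modes_t q *m A) = mode_mu q.2 / 2].
Proof.
move=> G; have h := d0 q.2.
have H4 := cos2Dsin2 (4 * q.1); have H2 := cos2Dsin2 (2 * q.1).
split; rewrite (dot_frame _ _ G) /= !mxE !inordK //= /a_0 /a_1 /a_2 /a_0' /a_1' /a_2' /mode_mu /cst0 /cst1 /c4 /s4 /c2 /s2;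
  move: (cos (4 * q.1)) (sin (4 * q.1)) (cos (2 * q.1)) (sin (2 * q.1)) H4 H2 => C4 S4 C2 S2 H4 H2.
- transitivity (5 / 2 * kS q.2 ^+ 2 / kd q.2 ^+ 2 + 3 / 2 * ((C4 ^+ 2 + S4 ^+ 2) / kd q.2 ^+ 2 + kC q.2 ^+ 2 / kd q.2 ^+ 2 * (C2 ^+ 2 + S2 ^+ 2))).
    by field.
  by rewrite H4 H2; field: (kd2 q.2) (kS2 q.2).
- transitivity (3 / 2 * (16 * (C4 ^+ 2 + S4 ^+ 2) / kd q.2 ^+ 2 + 4 * kC q.2 ^+ 2 / kd q.2 ^+ 2 * (C2 ^+ 2 + S2 ^+ 2))).
    by field.
  by rewrite H4 H2; field.
- by ring.
transitivity (kd q.2 ^+ 2 * (5 / 2 * (6 * kC q.2 / kd q.2 ^+ 3) ^+ 2 + 3 / 2 *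
   ((2 * kS q.2 * kC q.2 / kd q.2 ^+ 3) ^+ 2 * (C4 ^+ 2 + S4 ^+ 2) + (8 * kS q.2 / kd q.2 ^+ 3) ^+ 2 * (C2 ^+ 2 + S2 ^+ 2)))).
  by ring.
by rewrite H4 H2; field: (kd2 q.2) (kS2 q.2).
Qed.

Lemma first_modes_mulmx (F : R * R -> 'rV[R]_m) : (forall i, first_modes (fun q => F q 0 i)) ->
  exists A, forall q, F q = modes q *m A.
Proof.
move=> H; have : forall i, exists a : 'cV[R]_5, forall q, F q 0 i = (modes q *m a) 0 0.
  move=> i; have [A [B [C [D [E HF]]]]] := H i.
  exists (\col_k [:: A; B; C; D; E]`_k) => -[x t].
  rewrite HF mxE sum5 !mxE !inordK //= /a_0 /a_1 /a_2 /cst1 /c4 /s4 /c2 /s2.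
  by ring.
move=> /choice[a aP]; exists (\matrix_(k, i) a i k 0) => q.
by apply/rowP => i; rewrite aP mxE [RHS]mxE; apply: eq_bigr => k _; congr (_ * _); rewrite mxE.
Qed.

Lemma cos_sin_surj (c s : R) : c ^+ 2 + s ^+ 2 = 1 -> exists t, cos t = c /\ sin t = s.
Proof.
move=> cs; have c1 : -1 <= c <= 1 by apply/andP; split; nra.
have sE : sin (acos c) = `|s|.
  rewrite sin_acos //; have -> : 1 - c ^+ 2 = s ^+ 2 by rewrite -cs addrC addKr.
  by rewrite sqrtr_sqr.
have [s0|s0] := leP 0 s.
  by exists (acos c); rewrite acosK // sE ger0_norm.
by exists (- acos c); rewrite cosN sinN acosK // sE ltr0_norm // opprK.
Qed.

Lemma derive_mulmx n (e : R * R) (f df : R * R -> 'rV[R]_n) (A : 'M[R]_(n, m)) : smooth f -> 'D_e f = df ->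
  'D_e (fun q => f q *m A) = fun q => df q *m A.
Proof.
move=> sf <-.
have E i : (fun q => (f q *m A) 0 i) = fun q => \sum_k f q 0 k * A k i by apply/funext => q; rewrite mxE.
have sfA : smooth (fun q => f q *m A).
  apply: smooth_rV => i; rewrite E; apply: smooth_sum => k; apply: smoothM; last exact: smooth_cst.
  exact: smooth_coord.
apply/funext => q; apply/rowP => i; rewrite derive_coord; last exact: smooth_diff.
rewrite E mxE.
have dk k : is_derive q e (fun q => f q 0 k * A k i) ('D_e f q 0 k * A k i).
  rewrite derive_coord; last exact: smooth_diff.
  have := is_derive_mulf (smooth_is_derive e q (smooth_coord k sf)) (is_derive_cstf (A k i) q e).
  by rewrite mulr0 add0r mulrC.
by case: (is_derive_sumf (index_enum 'I_n) dk).
Qed.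

Lemma smooth_mulmx n (f : R * R -> 'rV[R]_n) (A : 'M[R]_(n, m)) : smooth f -> smooth (fun q => f q *m A).
Proof.
move=> sf; apply: smooth_rV => i.
rewrite (_ : (fun q => _) = fun q => \sum_k f q 0 k * A k i); last by apply/funext => q; rewrite mxE.
apply: smooth_sum => k; apply: smoothM; last exact: smooth_cst.
exact: smooth_coord.
Qed.


(** Multiplied by [kd^2], the unit norm becomes a quadratic identity between trigonometric
    polynomials with coefficients [A *m A^T]. The metric at the origin supplies the missing equation
    between two diagonal entries. *)
Lemma frame_unique A : (forall q, dot (modes q *m A) (modes q *m A) = 1) ->
  dot (modes_x (0, 0) *m A) (modes_x (0, 0) *m A) =
    kd 0 ^+ 2 * dot (modes_t (0, 0) *m A) (modes_t (0, 0) *m A) ->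
  A *m A^T = frame_gram.
Proof.
set B := A *m A^T => H1 H0.
have Bsym i j : B j i = B i j by rewrite -[in LHS](trmxK B) mxE /B trmx_mul trmxK.
have quad u : dot (u *m A) (u *m A) = \sum_i \sum_j u 0 j * B j i * u 0 i.
  rewrite dot_mulmx -/B mxE; apply: eq_bigr => i _; rewrite !mxE mulr_suml.
  by apply: eq_bigr => j _; rewrite !mxE.
have K2 : kd 0 ^+ 2 = 4 by rewrite kd2 /kC mulr0 sin0; ring.
have P (S C c s : R) : S ^+ 2 + C ^+ 2 = 1 -> c ^+ 2 + s ^+ 2 = 1 ->
  let u : 'rV[R]_5 := vec 5 [:: S; c ^+ 2 - s ^+ 2; 2 * s * c; C * c; C * s] in
  \sum_i \sum_j u 0 j * B j i * u 0 i = 4 - C ^+ 2.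
  move=> SC cs; have [a [aS aC]] := cos_sin_surj SC; have [b [bc bs]] := cos_sin_surj cs.
  (* At this point [kS = cos a = S], [kC = sin a = C], and the doubled [x] is [b]; every pair of
     points on the two circles is reached. *)
  move=> u; have := H1 (b / 2, - a / 2).
  have k : kS (- a / 2) = S by rewrite /kS mulrC divfK // cosN.
  have k' : kC (- a / 2) = C by rewrite /kC mulrC divfK // sinN opprK.
  have x2 : 2 * (b / 2) = b by field.
  have x4 : 4 * (b / 2) = b + b by field.
  have c4E : c4 (b / 2) = c ^+ 2 - s ^+ 2 by rewrite /c4 x4 cosD bc bs; ring.
  have s4E : s4 (b / 2) = 2 * s * c by rewrite /s4 x4 sinD bc bs; ring.
  have c2E : c2 (b / 2) = c by rewrite /c2 x2.
  have s2E : s2 (b / 2) = s by rewrite /s2 x2.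
  have E : modes (b / 2, - a / 2) = (kd (- a / 2))^-1 *: u.
    rewrite /modes /separated /fst /snd c4E s4E c2E s2E /a_0 /a_1 /a_2 k k' /cst1.
    by apply/rowP; apply: ord5P; rewrite !mxE !inordK //=; ring.
  rewrite E -scalemxAl dotZl dotZr quad mulrA -expr2 exprVn kd2 k' => /(canRL (mulKf _)) ->.
    by rewrite invrK mulr1.
  by rewrite invr_neq0 // gt_eqF // -k' kdom_gt0.
have D i : dot (row i A) (row i A) = B i i by rewrite -mulmx_dot /B mxE [RHS]mxE; apply: eq_bigr => k _; rewrite mxE.
have kC0' : kC 0 = 0 by rewrite /kC mulr0 sin0 oppr0.
have kS0' : kS 0 = 1 by rewrite /kS mulr0 cos0.
(* At the origin each partial derivative has a single nonzero component. As [kd 0 = 2], both sides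
   of the metric condition carry the factor 4, so two diagonal entries coincide. *)
have X : modes_x (0, 0) = (4 / kd 0) *: delta_mx 0 (inord 2).
  by apply/rowP; apply: ord5P; rewrite !mxE !inordK //= /a_0 /a_1 /a_2 /cst0 /s4 /c4 /s2 /c2 ?kC0' ?kS0'
    ?mulr0 ?sin0 ?cos0 -val_eqE /= !inordK //= ?mulr0n ?mulr1n; ring.
have T : modes_t (0, 0) = (- 8 / kd 0 ^+ 3) *: delta_mx 0 (inord 3).
  by apply/rowP; apply: ord5P; rewrite !mxE !inordK //= /a_0' /a_1' /a_2' /cst1 /s4 /c4 /s2 /c2 ?kC0' ?kS0'
    ?mulr0 ?sin0 ?cos0 -val_eqE /= !inordK //= ?mulr0n ?mulr1n; ring.
have b23 : B (inord 2) (inord 2) = B (inord 3) (inord 3).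
  move: H0; rewrite X T -!scalemxAl !(dotZl, dotZr) -!rowE !D.
  have -> : 4 / kd 0 * (4 / kd 0 * B (inord 2) (inord 2)) = 16 / kd 0 ^+ 2 * B (inord 2) (inord 2) by move: (B _ _) (kd 0) (d0 0) => z k kn; field.
  have -> : kd 0 ^+ 2 * (- 8 / kd 0 ^+ 3 * (- 8 / kd 0 ^+ 3 * B (inord 3) (inord 3))) =
      64 / (kd 0 ^+ 2) ^+ 2 * B (inord 3) (inord 3) by move: (B _ _) (kd 0) (d0 0) => z k kn; field.
  by rewrite K2; lra.
move: b23; rewrite /frame_gram.
have P' (S C c s : R) : S ^+ 2 + C ^+ 2 = 1 -> c ^+ 2 + s ^+ 2 = 1 ->
    let b i j := B (inord i) (inord j) in let x := c ^+ 2 - s ^+ 2 in let y := 2 * s * c in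
    b 0%N 0%N * S ^+ 2 + b 1%N 1%N * x ^+ 2 + b 2%N 2%N * y ^+ 2 + b 3%N 3%N * (C * c) ^+ 2 + b 4%N 4%N * (C * s) ^+ 2
    + 2 * (b 0%N 1%N * (S * x) + b 0%N 2%N * (S * y) + b 0%N 3%N * (S * (C * c)) + b 0%N 4%N * (S * (C * s))
         + b 1%N 2%N * (x * y) + b 1%N 3%N * (x * (C * c)) + b 1%N 4%N * (x * (C * s))
         + b 2%N 3%N * (y * (C * c)) + b 2%N 4%N * (y * (C * s)) + b 3%N 4%N * (C * c * (C * s))) = 4 - C ^+ 2.
  move=> SC cs /=; rewrite -(P S C c s SC cs) sum5 !(sum5 (fun j => _ * B j _ * _)).
  rewrite (Bsym (inord 0) (inord 1)) (Bsym (inord 0) (inord 2)) (Bsym (inord 0) (inord 3)) (Bsym (inord 0) (inord 4)).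
  rewrite (Bsym (inord 1) (inord 2)) (Bsym (inord 1) (inord 3)) (Bsym (inord 1) (inord 4)).
  rewrite (Bsym (inord 2) (inord 3)) (Bsym (inord 2) (inord 4)) (Bsym (inord 3) (inord 4)).
  rewrite !mxE !inordK //=; ring.
clearbody B => b23.
have [h00 [h11 h22 h33 h44] [h01 h02 h03 h04] [h12 h13 h14] [h23 h24 h34]] := quad_coeffs P' b23.
apply/matrixP; apply: ord5P; apply: ord5P;
  rewrite !mxE ?inordK //= -?val_eqE /= ?inordK //= ?mulr1n ?mulr0n //; by rewrite Bsym.
Qed.

End Frame.
End FirstModes.

(** * The bipolar surface *)

Section ModelSurface.
Variable R : realType.
Local Notation pi := (@pi R).
Local Notation kC := (@kC R).
Local Notation kS := (@kS R).
Local Notation kd := (@kd R).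
Local Notation kw := (@kw R).
Local Notation II := (@II R).
Local Notation e1 := ((1, 0) : R * R).
Local Notation e2 := ((0, 1) : R * R).
Let d0 t : kd t != 0. Proof. exact: kd_neq0. Qed.

Lemma is_derive_coord n (f fv : R * R -> 'rV[R]_n) v i q : smooth f -> 'D_v f = fv ->
  is_derive q v (fun q => f q 0 i) (fv q 0 i).
Proof.
move=> sf <-; rewrite derive_coord; last exact: smooth_diff.
by apply: smooth_is_derive; exact: smooth_coord.
Qed.

Lemma is_derive_unique (u : R * R -> R) (v q : R * R) a b : is_derive q v u a -> is_derive q v u b -> a = b.
Proof. by move=> [_ <-] [_ <-]. Qed.

Lemma metric_entry n (f : R * R -> 'rV[R]_n) q i j :
  metric f q i j = dot ('D_(dir R i) f q) ('D_(dir R j) f q).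
Proof. by rewrite mxE; apply: eq_bigr => k _; rewrite !mxE. Qed.

Lemma conformal_rank n (f fx ft fxx fxt ftt : R * R -> 'rV[R]_n) E q :
  jet f fx ft fxx fxt ftt -> conformal_factor fx ft E -> \rank (Defs.jacobian f q) = 2%N.
Proof.
move=> jf fE; have [E0 _ _ _] := fE q.
have u : metric f q \in unitmx.
  rewrite unitmxE unitfE (det_metric jf fE); apply: expf_neq0; apply: mulf_neq0; first by rewrite gt_eqF.
  by rewrite invr_neq0.
have := mxrankM_maxl (Defs.jacobian f q) (Defs.jacobian f q)^T.
rewrite -/(metric f q) mxrank_unit //; move: (rank_leq_row (Defs.jacobian f q)) => r1 r2.
by apply/eqP; rewrite eqn_leq; apply/andP; split.
Qed.

Section FramedSurface.
Variable n : nat.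
Variables h hx ht hxx hxt htt : R * R -> 'rV[R]_n.
Variable H : 'M[R]_(5, n + 1).
Hypothesis jh : jet h hx ht hxx hxt htt.
Hypothesis HH : H *m H^T = frame_gram R.
Hypothesis hH : forall q, stereo_inv 1 (h q) = modes q *m H.
Let sh := jet_smooth jh.
Local Notation w := (conf_den h 1).
Let l01 : (0 : R) < 1. Proof. exact: ltr01. Qed.
Let w0 q : w q != 0. Proof. by rewrite gt_eqF // conf_den_gt0. Qed.

Let F q : 'rV[R]_(n + 1) := modes q *m H.
Let Fx q : 'rV[R]_(n + 1) := modes_x q *m H.
Let Ft q : 'rV[R]_(n + 1) := modes_t q *m H.
Let Fxx q : 'rV[R]_(n + 1) := modes_xx q *m H.
Let Ftt q : 'rV[R]_(n + 1) := modes_tt q *m H.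

Let sm := @smooth_modes R.
Let FE : (fun q => stereo_inv 1 (h q)) = F. Proof. by apply/funext => q; exact: hH. Qed.

Let F_jet : [/\ smooth F, 'D_e1 F = Fx, 'D_e2 F = Ft, 'D_e1 Fx = Fxx & 'D_e2 Ft = Ftt].
Proof.
have [m1 m2 m3 m4] := modes_jet R.
have sx : smooth (@modes_x R) by rewrite -m1; exact: smooth_derive.
have st : smooth (@modes_t R) by rewrite -m2; exact: smooth_derive.
by split; [exact: smooth_mulmx | exact: derive_mulmx..].
Qed.

(** Solves [4 E / w^2 = mode_mu / 2], the metric of the lift computed from [h] and from the
    modes. *)
Definition frame_factor q : R := mode_mu q.2 / 8 * w q ^+ 2.

Lemma frame_conformal : conformal_factor hx ht frame_factor.
Proof.
move=> q; have [sF F1 F2 _ _] := F_jet.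
have [_ M11 M12 M22] := frame_metric q HH.
have G v v' gv gv' : 'D_v h = gv -> 'D_v' h = gv' ->
    dot (gv q) (gv' q) = w q ^+ 2 / 4 * dot ('D_v F q) ('D_v' F q).
  move=> a b; rewrite -FE (metric_stereo_inv l01 sh q a b).
  by field; exact: w0.
have D1 : 'D_e1 F q = Fx q by rewrite -F1.
have D2 : 'D_e2 F q = Ft q by rewrite -F2.
rewrite (G _ _ _ _ (jet_fx jh) (jet_fx jh)) (G _ _ _ _ (jet_fx jh) (jet_ft jh)).
rewrite (G _ _ _ _ (jet_ft jh) (jet_ft jh)) D1 D2 /Fx /Ft M11 M12 mulr0 [kd q.2 ^+ 2 * (_ * _)]mulrCA M22 /frame_factor.
have mu0 : 0 < mode_mu q.2.
  rewrite /mode_mu divr_gt0 ?exprn_gt0 ?kd_gt0 // mulr_gt0 //.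
  by have := sqr_ge0 (kC q.2); lra.
split; [|by field|by []|by field].
by apply: mulr_gt0; [exact: divr_gt0 | apply: exprn_gt0; exact: conf_den_gt0].
Qed.

Lemma continuous_frame_factor : continuous frame_factor.
Proof.
rewrite (_ : frame_factor = fun q => dot (hx q) (hx q)).
  by apply: smooth_continuous; apply: smooth_dot; exact: (jet_smooth_fx jh).
by apply/funext => q; have [_ -> _ _] := frame_conformal q.
Qed.

Let rho q := 1 - F q 0 (rshift n 0).
Let rhoE q : rho q = 2 / w q.
Proof.
rewrite /rho /F -hH /stereo_inv row_mxEr mxE eqxx mulr1n /conf_den; have := w0 q; rewrite /conf_den => ?.
by field.
Qed.

Let coordE j : (fun q => F q 0 (lshift 1 j)) = fun q => rho q * h q 0 j.
Proof.
apply/funext => q; rewrite rhoE /F -hH /stereo_inv row_mxEl mxE sqrtr1 mulr1.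
by [].
Qed.

(* [h] is the stereographic projection of a minimal surface: compare the
   Laplacians of [F] and of [rho *: h]. *)
Lemma frame_defect q : conf_defect h hx ht hxx htt frame_factor 1 q = 0.
Proof.
have [sF F1 F2 F11 F22] := F_jet.
have sx : smooth Fx by rewrite -F1; exact: smooth_derive.
have st : smooth Ft by rewrite -F2; exact: smooth_derive.
have shx := jet_smooth_fx jh; have sht := jet_smooth_ft jh.
pose l := rshift n (0 : 'I_1).
have dr v (G G' : R * R -> 'rV[R]_(n + 1)) (c : R) p : smooth G -> 'D_v G = G' ->
    is_derive p v (fun q => c - G q 0 l) (- G' p 0 l).
  move=> sG GG'.
  have := is_derive_addf (is_derive_cstf c p v) (is_derive_oppf (is_derive_coord l p sG GG')).
  by rewrite add0r.
have rf : (fun q => 1 - F q 0 l) = fun q => 2 / w q by apply/funext => p; exact: rhoE.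
have A1 p : - Fx p 0 l = - (4 * dot (h p) (hx p) / w p ^+ 2).
  apply: (is_derive_unique (dr e1 F Fx 1 p sF F1)).
  rewrite rf.
  have dw := is_derive_addf (is_derive_cstf 1 p e1) (is_derive_dotE p sh sh (jet_fx jh) (jet_fx jh)).
  have := is_derive_mulf (is_derive_cstf 2 p e1) (is_derive_invf (w0 p) dw).
  by move/is_derive_conv; apply; rewrite mulr0 addr0 /conf_den; have := w0 p; rewrite /conf_den => ?; field.
have A2 p : - Ft p 0 l = - (4 * dot (h p) (ht p) / w p ^+ 2).
  apply: (is_derive_unique (dr e2 F Ft 1 p sF F2)).
  rewrite rf.
  have dw := is_derive_addf (is_derive_cstf 1 p e2) (is_derive_dotE p sh sh (jet_ft jh) (jet_ft jh)).
  have := is_derive_mulf (is_derive_cstf 2 p e2) (is_derive_invf (w0 p) dw).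
  by move/is_derive_conv; apply; rewrite mulr0 addr0 /conf_den; have := w0 p; rewrite /conf_den => ?; field.
have dx j p : Fx p 0 (lshift 1 j) = rho p * hx p 0 j - h p 0 j * Fx p 0 l.
  apply: (is_derive_unique (is_derive_coord (lshift 1 j) p sF F1)); rewrite coordE -mulrN.
  exact: (is_derive_mulf (dr e1 F Fx 1 p sF F1) (is_derive_coord j p sh (jet_fx jh))).
have dt j p : Ft p 0 (lshift 1 j) = rho p * ht p 0 j - h p 0 j * Ft p 0 l.
  apply: (is_derive_unique (is_derive_coord (lshift 1 j) p sF F2)); rewrite coordE -mulrN.
  exact: (is_derive_mulf (dr e2 F Ft 1 p sF F2) (is_derive_coord j p sh (jet_ft jh))).
have dxx j p : Fxx p 0 (lshift 1 j) = rho p * hxx p 0 j - 2 * Fx p 0 l * hx p 0 j - h p 0 j * Fxx p 0 l.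
  have := is_derive_coord (lshift 1 j) p sx F11.
  rewrite (_ : (fun q => _) = fun q => rho q * hx q 0 j + h q 0 j * (0 - Fx q 0 l)); last first.
    by apply/funext => p'; rewrite dx sub0r mulrN.
  move/is_derive_unique; apply.
  have D1 := is_derive_mulf (dr e1 F Fx 1 p sF F1) (is_derive_coord j p shx (jet_fxx jh)).
  have D2 := is_derive_mulf (is_derive_coord j p sh (jet_fx jh)) (dr e1 Fx Fxx 0 p sx F11).
  apply: (is_derive_conv (is_derive_addf D1 D2)); rewrite /rho.
  by move: (F p 0 _) (Fx p 0 _) (Fxx p 0 _) => a b c; ring.
have dtt j p : Ftt p 0 (lshift 1 j) = rho p * htt p 0 j - 2 * Ft p 0 l * ht p 0 j - h p 0 j * Ftt p 0 l.
  have := is_derive_coord (lshift 1 j) p st F22.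
  rewrite (_ : (fun q => _) = fun q => rho q * ht q 0 j + h q 0 j * (0 - Ft q 0 l)); last first.
    by apply/funext => p'; rewrite dt sub0r mulrN.
  move/is_derive_unique; apply.
  have D1 := is_derive_mulf (dr e2 F Ft 1 p sF F2) (is_derive_coord j p sht (jet_ftt jh)).
  have D2 := is_derive_mulf (is_derive_coord j p sh (jet_ft jh)) (dr e2 Ft Ftt 0 p st F22).
  apply: (is_derive_conv (is_derive_addf D1 D2)); rewrite /rho.
  by move: (F p 0 _) (Ft p 0 _) (Ftt p 0 _) => a b c; ring.
have LF i : Fxx q 0 i + kd q.2 ^+ 2 * Ftt q 0 i + 2 * kS q.2 * kC q.2 * Ft q 0 i = - mode_mu q.2 * F q 0 i.
  have := congr1 (fun u => (u *m H) 0 i) (modes_lap q).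
  by rewrite /klein_lap !mulmxDl -!scalemxAl !mxE.
have LFl := LF l; have R1 := rhoE q; have A1q := A1 q; have A2q := A2 q.
apply/rowP => j; have LFj := LF (lshift 1 j).
move: LFj; rewrite dxx dtt dt (congr1 (fun u => u q) (coordE j)) => LFj.
rewrite /conf_defect /klein_lap /conf_normal !mxE /frame_factor.
have Fl : F q 0 l = 1 - rho q by rewrite /rho opprB addrCA subrr addr0.
move: A1q A2q => /oppr_inj A1q /oppr_inj A2q.
move: LFj LFl; rewrite Fl R1 A1q A2q.
move: (dot (h q) (hx q)) (dot (h q) (ht q)) (hx q 0 j) (ht q 0 j) (hxx q 0 j) (htt q 0 j) (h q 0 j).
move: (Fxx q 0 l) (Ftt q 0 l) (mode_mu q.2) (kS q.2) (kC q.2) (kd q.2) (w q) (w0 q).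
move=> zx zt mu S C d W Wn a b x1 t1 xx1 tt1 h1 LFj LFl.
have -> : xx1 = W / 2 * (2 / W * xx1) by field.
have -> : 2 / W * xx1 = - mu * (2 / W * h1) + 2 * (4 * a / W ^+ 2) * x1 + h1 * zx
   - d ^+ 2 * (2 / W * tt1 - 2 * (4 * b / W ^+ 2) * t1 - h1 * zt)
   - 2 * S * C * (2 / W * t1 - h1 * (4 * b / W ^+ 2)) by lra.
have -> : zx = - mu * (1 - 2 / W) - d ^+ 2 * zt - 2 * S * C * (4 * b / W ^+ 2) by lra.
by field.
Qed.

(** The defect vanishes, so the Willmore energy is the area of the lift, whose density is
    [mode_mu / (2 kd) = 6 kw]. *)
Lemma frame_willmore : on_klein h -> willmore h = 6 * II (fun q => kw q.2).
Proof.
move=> kh; have fE := frame_conformal; have cE := continuous_frame_factor.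
rewrite (willmoreE jh fE cE) (willmore_split jh fE cE kh l01).
have -> : conf_defect_density h hx ht hxx htt frame_factor 1 = fun=> 0 * 1.
  by apply/funext => q; rewrite /conf_defect_density frame_defect dot0l !mul0r.
rewrite IIZ; last by move=> x; exact: cvg_cst.
rewrite mul0r add0r -IIZ; last exact: continuous_kw2.
congr II; apply/funext => q; rewrite /conf_area /frame_factor /mode_mu /kw.
by have := w0 q; have := d0 q.2 => ? ?; field; apply/andP.
Qed.


End FramedSurface.
End ModelSurface.

(** * Moebius transformations *)

Section Moebius.
Variable R : realType.
Variable n : nat.
Local Notation V := 'rV[R]_n.
Local Notation W := 'rV[R]_(n + 1).
Implicit Types (u c : V) (z : option V) (x y v : W).

Definition sphere_point z : W := if z is Some u then stereo_inv 1 u else row_mx 0 1%:M.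

Let w0 u : 1 + dot u u != 0. Proof. by rewrite gt_eqF // ltr_pwDl // dot_ge0. Qed.

Lemma sphere_point_inj z z' : sphere_point z = sphere_point z' -> z = z'.
Proof.
have absurd_None u : stereo_inv 1 u = row_mx 0 1%:M -> False.
  move=> /eq_row_mx[_ /(congr1 (fun M : 'M[R]_1 => M 0 0))]; rewrite !mxE /= !mulr1n => /eqP.
  rewrite -subr_eq0 addrC addKr oppr_eq0 mulr1 mulf_eq0 pnatr_eq0 invr_eq0 /=.
  by rewrite (negPf (w0 u)).
case: z z' => [u|] [u'|] //= H.
- by rewrite (stereo_inv_inj ltr01 H).
- by case: (absurd_None _ H).
by case: (absurd_None _ (esym H)).
Qed.

Lemma moebius_translation c : moebius (omap (fun u => u + c)).
Proof.
have -> : omap (fun u => u + c) = omap (fun u => 1 *: (u *m 1%:M) + c).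
  by congr omap; apply/funext => u; rewrite mulmx1 scale1r.
by apply: moebius_similarity; [exact: ltr01 | rewrite trmx1 mulmx1].
Qed.

Lemma moebius_homothety (a : R) c : 0 < a -> moebius (omap (fun u => a *: u + c)).
Proof.
move=> a0; have -> : omap (fun u => a *: u + c) = omap (fun u => a *: (u *m 1%:M) + c).
  by congr omap; apply/funext => u; rewrite mulmx1.
by apply: moebius_similarity; [exact: a0 | rewrite trmx1 mulmx1].
Qed.

Lemma dot_mulmx_orthogonal k (Q : 'M[R]_k) (a b : 'rV[R]_k) : Q *m Q^T = 1%:M ->
  dot (a *m Q) (b *m Q) = dot a b.
Proof. by move=> QQ; rewrite !dotE trmx_mul !mulmxA -(mulmxA a) QQ mulmx1. Qed.

Definition reflection k (v a : 'rV[R]_k) : 'rV[R]_k := a - (2 * dot a v / dot v v) *: v.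
Definition reflection_mx k (v : 'rV[R]_k) : 'M[R]_k := 1%:M - (2 / dot v v) *: (v^T *m v).

Lemma reflectionE k (v a : 'rV[R]_k) : reflection v a = a *m reflection_mx v.
Proof.
rewrite /reflection_mx mulmxBr mulmx1 -scalemxAr mulmxA /reflection; congr (_ - _).
have -> : a *m v^T = (dot a v)%:M by rewrite [LHS]mx11_scalar dotE.
by rewrite mul_scalar_mx scalerA mulrAC.
Qed.

Lemma reflection_mx_orthogonal k (v : 'rV[R]_k) : v != 0 -> reflection_mx v *m (reflection_mx v)^T = 1%:M.
Proof.
move=> v0; have d0 : dot v v != 0 by apply: contra_neq v0 => /dot_eq0.
have -> : (reflection_mx v)^T = reflection_mx v.
  by rewrite /reflection_mx linearB /= trmx1 linearZ /= trmx_mul trmxK.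
apply/row_matrixP => i; rewrite !rowE mulmxA mulmx1 -!reflectionE /reflection.
rewrite !(dotBl, dotZl); set a := delta_mx 0 i.
have -> : 2 * (dot a v - 2 * dot a v / dot v v * dot v v) / dot v v = - (2 * dot a v / dot v v) by field.
by rewrite scaleNr opprK subrK.
Qed.

(* A reflection of the sphere corresponds to a linear reflection when its
   mirror contains the north pole, and to an inversion otherwise. *)
Lemma reflection_moebius v : v != 0 ->
  exists2 m, moebius m & forall z, sphere_point (m z) = reflection v (sphere_point z).
Proof.
move=> v0; have dv : dot v v != 0 by apply: contra_neq v0 => /dot_eq0.
rewrite -(hsubmxK v) in v0 dv *; move: (lsubmx v) (rsubmx v) => v' r in v0 dv *.
rewrite (mx11_scalar r) in v0 dv *; move: (r 0 0) => b in v0 dv *.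
(* [b] is the last coordinate of [v], so it vanishes exactly when the mirror contains the north
   pole. *)
have [b0|b0] := eqVneq b 0.
  have v'0 : v' != 0.
    by apply: contra_neq v0 => ->; rewrite b0 raddf0 row_mx0.
  exists (omap (fun u => 1 *: (u *m reflection_mx v') + 0)).
    by apply: moebius_similarity; [exact: ltr01 | exact: reflection_mx_orthogonal].
  have E u t : reflection (row_mx v' b%:M) (row_mx u t%:M) = row_mx (reflection v' u) t%:M.
    rewrite b0 raddf0 /reflection !dot_row_mx (dotC t%:M 0) !dot0l !addr0 scale_row_mx scaler0.
    by rewrite opp_row_mx add_row_mx subr0.
  case=> [u|] /=.
    rewrite addr0 scale1r /stereo_inv dot_mulmx_orthogonal ?reflection_mx_orthogonal // E.
    by rewrite !reflectionE -scalemxAl.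
  by rewrite E /reflection dot0l mulr0 mul0r scale0r subr0.
have [c {v0}v'E] : exists c, v' = b *: c by exists (b^-1 *: v'); rewrite scalerA divff // scale1r.
(* The mirror projects to the sphere of centre [- c] and squared radius [1 + |c|^2]; [m] is the
   inversion in that sphere. *)
pose r2 := 1 + dot c c.
have r0 : 0 < r2 by rewrite ltr_pwDl // dot_ge0.
have rn : r2 != 0 by rewrite gt_eqF.
pose m := omap (fun u => r2 *: u + - c) \o (@inversion R n \o omap (fun u => u + c)).
exists m.
  apply: moebius_comp; first exact: moebius_homothety.
  by apply: moebius_comp; [exact: moebius_inversion | exact: moebius_translation].
have E u t : reflection (row_mx v' b%:M) (row_mx u t%:M) =
    row_mx (u - (2 * (dot u c + t) / r2) *: c) (t - 2 * (dot u c + t) / r2)%:M.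
  rewrite v'E /reflection !dot_row_mx !dot_scalar !(dotZl, dotZr) scale_row_mx opp_row_mx add_row_mx.
  rewrite scale_scalar_mx -raddfB /=.
  have -> : 2 * (b * dot u c + t * b) / (b * (b * dot c c) + b * b) = 2 * (dot u c + t) / r2 / b.
    rewrite /r2; field; rewrite b0 /= -/r2 rn /=.
    by rewrite (_ : _ + _ = b * b * r2) ?mulf_neq0 // /r2; ring.
  by rewrite scalerA divfK.
case=> [u|] /=; last first.
  rewrite /m /= E dot0l !add0r /stereo_inv scaler0 add0r sqrtr1 !mulr1 dotNl dotNr opprK -/r2.
  by rewrite scalerN.
rewrite {1}/stereo_inv sqrtr1 mulr1 E.
have D : dot (u + c) (u + c) = dot u u + 2 * dot u c + dot c c.
  by rewrite !(dotDl, dotDr) (dotC c u); ring.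
have ww := w0 u.
have uE : 2 * dot u c = dot (u + c) (u + c) - (1 + dot u u) + 2 - r2 by rewrite D /r2; ring.
have -> : 2 * (dot (2 / (1 + dot u u) *: u) c + (1 - 2 / (1 + dot u u))) / r2 =
    2 * (dot (u + c) (u + c) / r2 - 1) / (1 + dot u u).
  rewrite dotZl; apply: (@mulIf _ (1 + dot u u)) => //.
  transitivity (2 * (2 * dot u c + (1 + dot u u) - 2) / r2).
    by move: (dot u u) (dot u c) ww => a b' ww; field; rewrite rn ww.
  rewrite uE; move: (dot (u + c) _) (1 + dot u u) ww => a b' ww.
  by field; rewrite rn ww.
rewrite /m /=; case: ifPn => [/eqP uc|uc] /=.
  rewrite uc dot0l mul0r sub0r mulrN1 mulNr scaleNr opprK -scalerDr uc scaler0.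
  by congr (row_mx _ _%:M); ring.
set d := dot (u + c) (u + c).
have d0 : d != 0 by apply: contra_neq uc => /dot_eq0.
have wE : 1 + dot (r2 *: (d^-1 *: (u + c)) - c) (r2 *: (d^-1 *: (u + c)) - c) = r2 * (1 + dot u u) / d.
  rewrite !(dotBl, dotBr, dotZl, dotZr) -/d (dotC c) dotDl.
  transitivity (1 + dot c c + r2 / d * (r2 - 2 * dot u c - 2 * dot c c)); first by field.
  rewrite uE -/d -/r2; move: (dot u u) => a.
  rewrite (_ : dot c c = r2 - 1); last by rewrite /r2 addrC addKr.
  by field.
rewrite /stereo_inv wE sqrtr1 mulr1; congr row_mx.
  rewrite scalerBr !scalerA; apply/rowP => j; rewrite !mxE.
  by move: (1 + dot u u) ww => b' ww; field; rewrite d0 rn ww.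
by congr (_%:M); move: (1 + dot u u) ww => b' ww; field; rewrite d0 rn ww.
Qed.

Lemma moebius_id : moebius (@id (option V)).
Proof.
have -> : @id (option V) = omap (fun u => u + 0).
  by apply/funext => -[u|] //=; rewrite addr0.
exact: moebius_translation.
Qed.

Lemma gramE k l (A : 'M[R]_(k, l)) i i' : (A *m A^T) i i' = dot (row i A) (row i' A).
Proof. by rewrite mxE; apply: eq_bigr => j _; rewrite !mxE. Qed.

(* A reflection takes the next row of [H *m Q] to that of [A] and fixes the previous ones. *)
Lemma frames_moebius k (H A : 'M[R]_(k, n + 1)) : H *m H^T = A *m A^T ->
  exists m (Q : 'M[R]_(n + 1)), [/\ moebius m, Q *m Q^T = 1%:M,
    forall z, sphere_point (m z) = sphere_point z *m Q & H *m Q = A].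
Proof.
move=> HA.
suff /(_ k (leqnn k))[m [Q [mm QQ mQ HQ]]] : forall j, (j <= k)%N -> exists m (Q : 'M[R]_(n + 1)),
    [/\ moebius m, Q *m Q^T = 1%:M, forall z, sphere_point (m z) = sphere_point z *m Q &
    forall i : 'I_k, (i < j)%N -> row i (H *m Q) = row i A].
  by exists m, Q; split => //; apply/row_matrixP => i; exact: HQ.
elim=> [_|j IH jk].
  exists id, 1%:M; split => //; first exact: moebius_id.
  - by rewrite trmx1 mulmx1.
  by move=> z; rewrite mulmx1.
have [m [Q [mm QQ mQ HQ]]] := IH (ltnW jk).
pose oj := Ordinal jk; pose v := row oj (H *m Q) - row oj A.
have gram i i' : dot (row i (H *m Q)) (row i' (H *m Q)) = dot (row i A) (row i' A).
  by rewrite !row_mul dot_mulmx_orthogonal // -!gramE HA.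
have [v0|v0] := eqVneq v 0.
  exists m, Q; split => // i; rewrite ltnS leq_eqVlt => /predU1P[ij|]; last exact: HQ.
  have -> : i = oj by apply: val_inj.
  by apply/eqP; rewrite -subr_eq0 -/v v0.
have [m' mm' m'E] := reflection_moebius v0.
have vv : dot v v != 0 by apply: contra_neq v0 => /dot_eq0.
exists (m' \o m), (Q *m reflection_mx v); split.
- exact: moebius_comp.
- by rewrite trmx_mul mulmxA -(mulmxA Q) reflection_mx_orthogonal // mulmx1.
- by move=> z; rewrite /= m'E mQ reflectionE mulmxA.
move=> i; rewrite mulmxA row_mul -reflectionE ltnS leq_eqVlt => /predU1P[ij|ij].
  have -> : i = oj by apply: val_inj.
  have vE : dot v v = 2 * dot (row oj (H *m Q)) v.
    rewrite /v !(dotBl, dotBr) !gram (dotC (row oj A)); ring.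
  by rewrite /reflection -vE divff // scale1r /v opprB addrC subrK.
rewrite /reflection (_ : dot _ v = 0) ?mulr0 ?mul0r ?scale0r ?subr0 ?HQ //.
by rewrite -[X in dot X _](HQ _ ij) /v dotBr gram HQ // subrr.
Qed.

End Moebius.

(** * The bipolar surface and its projections as frames of first modes *)

Section BipolarFrame.
Variable R : realType.
Local Notation s3 := (Num.sqrt 3 : R).

Definition tau_frame : 'M[R]_(5, 6) := \matrix_(i < 5, j < 6) ((nth [::]
  [:: [:: - 1 / 2; 0; 0; 0; 0; 3 / 2];
      [:: 0; 0; s3 / 2; s3 / 2; 0; 0];
      [:: 0; - (s3 / 2); 0; 0; s3 / 2; 0];
      [:: 0; 0; s3 / 2; - (s3 / 2); 0; 0];
      [:: 0; s3 / 2; 0; 0; s3 / 2; 0]] i)`_j).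

Lemma tau31_frame (q : R * R) : tau31 q = modes q *m tau_frame.
Proof.
have d0 : kd q.2 != 0 := kd_neq0 q.2.
rewrite tau31E -/(kC q.2) -/(kS q.2) -/(kd q.2).
apply/rowP => j; rewrite [RHS]mxE sum5 !mxE !inordK //= /a_0 /a_1 /a_2.
case: j => [[|[|[|[|[|[|//]]]]]] j6] /=; field; exact: d0.
Qed.

Lemma tau_frame_gram : tau_frame *m tau_frame^T = frame_gram R.
Proof.
have ss : s3 / 2 * (s3 / 2) = 3 / 4.
  by rewrite mulrACA -expr2 sqr_sqrtr ?ler0n // -invfM -natrM.
apply/matrixP; apply: ord5P; apply: ord5P; rewrite mxE !big_ord_recl big_ord0 !mxE !inordK //=;
  rewrite -?val_eqE /= ?inordK //= ?mulr1n ?mulr0n ?(mul0r, mulr0, mulrNN, mulrN, mulNr, addr0, add0r) ?ss //; lra.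
Qed.

Lemma tau_frame_normal : tau_frame *m (hyperplane_normal R)^T = 0.
Proof.
apply/colP; apply: ord5P; rewrite mxE !big_ord_recl big_ord0 !mxE !inordK //= ?(mul0r, mulr0, addr0, add0r) //; lra.
Qed.

Section Stereographic.
Variable n : nat.
Hypothesis n4 : (4 <= n)%N.
Variables (p : 'rV[R]_6) (J : 'M[R]_(6, 4)).
Hypothesis Sp : sphere4 p.
Hypothesis JJ : J^T *m J = 1%:M.
Hypothesis nJ : hyperplane_normal R *m J = 0.
Hypothesis pJ : p *m J = 0.

(** Coordinates in which the pole [p] becomes the last basis vector and [J] followed by the padding
    gives the first [n] coordinates. *)
Definition stereo_mx : 'M[R]_(6, n + 1) := row_mx (J *m (pid_mx 4 : 'M[R]_(4, n))) p^T.

(** The columns of [J], [p] and the normalised hyperplane normal, whose squared length is 10, form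
    an orthonormal basis of R^6. The product is thus the orthogonal projection onto the
    hyperplane. *)
Lemma stereo_mx_gram : stereo_mx *m stereo_mx^T =
  1%:M - 10^-1 *: ((hyperplane_normal R)^T *m hyperplane_normal R).
Proof.
have [p1 pn] := Sp; have nJ' := nJ; set nu := hyperplane_normal R in nJ' pn *.
have nn : nu *m nu^T = 10%:M.
  apply/rowP => i; rewrite ord1 mxE !big_ord_recl big_ord0 !mxE /=; ring.
have pp : p *m p^T = 1%:M by rewrite [LHS]mx11_scalar -dotE p1.
have np : nu *m p^T = 0 by rewrite [LHS]mx11_scalar -dotE pn raddf0.
(* Putting the whole factor [1 / 10] on one side avoids the square root of 10; a one-sided inverse
   of a square matrix is two-sided. *)
pose O1 : 'M[R]_(4 + 1 + 1, 6) := col_mx (col_mx J^T p) nu.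
pose O2 : 'M[R]_(4 + 1 + 1, 6) := col_mx (col_mx J^T p) (10^-1 *: nu).
have O : O1 *m O2^T = 1%:M.
  have jn : J^T *m nu^T = 0 by rewrite -trmx_mul nJ' trmx0.
  have jp : J^T *m p^T = 0 by rewrite -trmx_mul pJ trmx0.
  have pn' : p *m nu^T = 0 by rewrite -[p]trmxK -trmx_mul np trmx0.
  rewrite /O1 /O2 !tr_col_mx trmxK mul_col_row mul_col_row mul_col_mx mul_mx_row.
  rewrite linearZ /= -!scalemxAr JJ jp pJ pp jn pn' nJ' np nn !scaler0 col_mx0 row_mx0.
  rewrite scale_scalar_mx mulVf ?pnatr_eq0 // -!scalar_mx_block.
  by [].
have := mulmx1C O; rewrite /O1 /O2 !tr_col_mx trmxK !mul_row_col linearZ /= -scalemxAl => JE.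
rewrite /stereo_mx tr_row_mx mul_row_col trmxK trmx_mul tr_pid_mx -JE addrK.
rewrite -!mulmxA; congr (_ + _); rewrite [pid_mx 4 *m _]mulmxA mul_pid_mx.
by rewrite minnn (minn_idPr n4) pid_mx_1 mul1mx.
Qed.

Variable phi : 'rV[R]_6 -> 'rV[R]_4.
Hypothesis phiE : forall v, sphere4 v -> v != p -> phi v = (1 - dot v p)^-1 *: (v *m J).
Hypothesis tau_p : forall q : R * R, tau31 q <> p.

Definition model_surface (q : R * R) : 'rV[R]_n := pad4 n (phi (tau31 q)).
Definition model_frame : 'M[R]_(5, n + 1) := tau_frame *m stereo_mx.

Lemma model_frame_gram : model_frame *m model_frame^T = frame_gram R.
Proof.
rewrite /model_frame trmx_mul -mulmxA (mulmxA stereo_mx) stereo_mx_gram mulmxBl mul1mx mulmxBr.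
by rewrite tau_frame_gram -scalemxAl -scalemxAr !mulmxA tau_frame_normal !mul0mx scaler0 subr0.
Qed.

(** Inverse stereographic projection recovers the point of the sphere, here in the coordinates
    [stereo_mx]. Unit vectors with inner product 1 are equal, so [tau31 q <> p] makes the
    denominator nonzero. *)
Lemma model_surfaceE q :
  [/\ dot (tau31 q) p != 1, model_surface q = (1 - dot (tau31 q) p)^-1 *: (tau31 q *m (J *m (pid_mx 4 : 'M[R]_(4, n)))) &
      stereo_inv 1 (model_surface q) = modes q *m model_frame].
Proof.
have [p1 pn] := Sp; have St := tau31_sphere4 q; have [t1 _] := St.
have z1 : dot (tau31 q) p != 1.
  apply/eqP => z; apply: (@tau_p q); apply/eqP; rewrite -subr_eq0; apply/eqP/dot_eq0.
  by rewrite !(dotBl, dotBr) (dotC p) z t1 p1; ring.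
have E : model_surface q = (1 - dot (tau31 q) p)^-1 *: (tau31 q *m (J *m (pid_mx 4 : 'M[R]_(4, n)))).
  by rewrite /model_surface /pad4 phiE //; [rewrite -scalemxAl mulmxA | apply/eqP].
have FE : modes q *m model_frame = row_mx (tau31 q *m (J *m (pid_mx 4 : 'M[R]_(4, n)))) (dot (tau31 q) p)%:M.
  rewrite /model_frame mulmxA -tau31_frame /stereo_mx mul_mx_row; congr row_mx.
  by rewrite [LHS]mx11_scalar -dotE.
split => //.
have [F1 _ _ _] := frame_metric q model_frame_gram.
move: F1; rewrite FE dot_row_mx dot_scalar E /stereo_inv.
move: (dot (tau31 q) p) (tau31 q *m _) z1 => z X z1 XX.
have z1' : 1 - z != 0 by rewrite subr_eq0 eq_sym.
have XE : dot X X = (1 - z) * (1 + z) by rewrite (_ : dot X X = 1 - z * z); [ring | rewrite -XX addrK].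
rewrite dotZl dotZr XE sqrtr1 !mulr1.
have -> : 1 + (1 - z)^-1 * ((1 - z)^-1 * ((1 - z) * (1 + z))) = 2 / (1 - z) by field.
have -> : 1 - 2 / (2 / (1 - z)) = z by field.
by rewrite scalerA (_ : 2 / (2 / (1 - z)) / (1 - z) = 1) ?scale1r //; field.
Qed.

Lemma smooth_model_surface : smooth model_surface.
Proof.
pose X (q : R * R) := modes q *m (tau_frame *m (J *m (pid_mx 4 : 'M[R]_(4, n)))).
pose z (q : R * R) := modes q *m (tau_frame *m p^T).
have sX : smooth X by apply: smooth_mulmx; exact: smooth_modes.
have sz : smooth z by apply: smooth_mulmx; exact: smooth_modes.
have zE q : z q 0 0 = dot (tau31 q) p by rewrite /z mulmxA -tau31_frame dotE.
have z1 q : 1 - z q 0 0 != 0.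
  by rewrite zE subr_eq0 eq_sym; case: (model_surfaceE q).
apply: smooth_rV => i.
rewrite (_ : (fun q => _) = fun q => (1 - z q 0 0)^-1 * X q 0 i).
  have h1 := smooth_coord i sX; have h2 := smooth_coord 0 sz.
  smooth_tac.
apply/funext => q; have [_ -> _] := model_surfaceE q.
by rewrite [LHS]mxE zE /X (mulmxA (modes q)) -tau31_frame.
Qed.

Lemma on_klein_model_surface : on_klein model_surface.
Proof. by move=> q q' /tau31_eq E; rewrite /model_surface E. Qed.

End Stereographic.
End BipolarFrame.

(** * Conformal immersions and the conclusion *)

Lemma conformal_factor_of (R : realType) n (f fx ft : R * R -> 'rV[R]_n) (h hx ht : R * R -> 'rV[R]_n)
    (E : R * R -> R) : 'D_((1, 0) : R * R) f = fx -> 'D_((0, 1) : R * R) f = ft ->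
  'D_((1, 0) : R * R) h = hx -> 'D_((0, 1) : R * R) h = ht ->
  conformal_to f h -> conformal_factor hx ht E -> conformal_factor fx ft (fun q => dot (fx q) (fx q)).
Proof.
move=> f1 f2 h1 h2 [u [_ _ mE]] hE q.
have [E0 H11 H12 H22] := hE q.
pose i0 : 'I_2 := 0; pose i1 : 'I_2 := 1.
have M i j : metric f q i j = expR (2 * u q) * metric h q i j by rewrite mE mxE.
have D (g gx gt : R * R -> 'rV[R]_n) : 'D_((1, 0) : R * R) g = gx -> 'D_((0, 1) : R * R) g = gt ->
    [/\ metric g q i0 i0 = dot (gx q) (gx q), metric g q i0 i1 = dot (gx q) (gt q) &
        metric g q i1 i1 = dot (gt q) (gt q)].
  by move=> <- <-; split; rewrite metric_entry.
have [D11 D12 D22] := D _ _ _ f1 f2; have [D11' D12' D22'] := D _ _ _ h1 h2.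
have tr i j a b : metric f q i j = a -> metric h q i j = b -> a = expR (2 * u q) * b.
  by move=> <- <-.
have M11 := tr _ _ _ _ D11 (etrans D11' H11); have M12 := tr _ _ _ _ D12 (etrans D12' H12).
have M22 := tr _ _ _ _ D22 D22'; rewrite mulr0 in M12.
split=> //; first by rewrite M11 mulr_gt0 ?expR_gt0.
by rewrite M11 M22 mulrCA H22.
Qed.

Theorem theorem1p1 (R : realType) (n : nat) (hn : (4 <= n)%N)
    (p : 'rV[R]_6) (phi : 'rV[R]_6 -> 'rV[R]_4)
    (hphi : stereographic p phi) (hp : forall q : R * R, tau31 q <> p) :
  let h : R * R -> 'rV[R]_n := fun q => pad4 n (phi (tau31 q)) in
  let E0 : R := 6 * pi * ellipticE (2 * Num.sqrt 2 / 3) in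
  [/\ klein_immersion h,
      willmore h = E0,
      (forall f : R * R -> 'rV[R]_n,
         klein_immersion f -> conformal_to f h -> E0 <= willmore f)
    & (forall f : R * R -> 'rV[R]_n,
         klein_immersion f -> conformal_to f h -> willmore f = E0 ->
         exists2 m : option 'rV[R]_n -> option 'rV[R]_n,
           moebius m & forall q, Some (f q) = m (Some (h q)))].
Proof.
move=> h E0; have [Sp [J [JJ nJ pJ phiE]]] := hphi.
(* The factor is [6 * (pi / 2) * 2]: the length of the [x]-interval times the two complete elliptic
   integrals. *)
have E0E : E0 = 6 * II (fun q => kw q.2).
  rewrite /II (_ : (fun t => itg 0 (pi / 2) _) = fun t => pi / 2 * kw t).
    by rewrite itgZ ?itg_kw; [rewrite /E0; field | exact: continuous_kw].
  by apply/funext => t /=; rewrite itg_cst subr0 mulrC.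
have hH q : stereo_inv 1 (h q) = modes q *m model_frame n p J.
  by have [_ _] := model_surfaceE hn Sp JJ nJ pJ phiE hp q.
have HH := model_frame_gram hn Sp JJ nJ pJ.
have sh : smooth h := smooth_model_surface hn Sp JJ nJ pJ phiE hp.
have kh : on_klein h := on_klein_model_surface n phi.
have [hx [ht [hxx [hxt [htt jh]]]]] := smooth_jet sh.
have hE := frame_conformal jh HH hH.
have reg (f fx ft : R * R -> 'rV[R]_n) : 'D_((1, 0) : R * R) f = fx -> 'D_((0, 1) : R * R) f = ft -> smooth f -> conformal_to f h ->
    conformal_factor fx ft (fun q => dot (fx q) (fx q)) /\ continuous (fun q => dot (fx q) (fx q)).
  move=> f1 f2 sf fh; split; first exact: (conformal_factor_of f1 f2 (jet_fx jh) (jet_ft jh) fh hE).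
  by apply: smooth_continuous; apply: smooth_dot; rewrite -f1; exact: smooth_derive.
split.
- by split=> // q; exact: conformal_rank jh hE.
- by rewrite E0E; exact: (frame_willmore jh HH hH kh).
- move=> f [sf kf _] fh; have [fx [ft [fxx [fxt [ftt jf]]]]] := smooth_jet sf.
  have [fE cE] := reg _ _ _ (jet_fx jf) (jet_ft jf) sf fh.
  by have [H _] := willmore_ge jf fE cE kf; rewrite E0E.
move=> f [sf kf _] fh We; have [fx [ft [fxx [fxt [ftt jf]]]]] := smooth_jet sf.
have [fE cE] := reg _ _ _ (jet_fx jf) (jet_ft jf) sf fh.
have [_ H] := willmore_ge jf fE cE kf.
rewrite E0E in We; have [c [s [s0 Fm]]] := H We.
have [A AE] := first_modes_mulmx Fm.
pose g q := f q - c.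
have sg : smooth g by apply: smoothB => //; exact: smooth_cst.
have g1 : 'D_((1, 0) : R * R) g = fx by rewrite /g derive_subcst; exact: (jet_fx jf).
have g2 : 'D_((0, 1) : R * R) g = ft by rewrite /g derive_subcst; exact: (jet_ft jf).
have FA : (fun q => stereo_inv s (g q)) = fun q => modes q *m A by apply/funext => q; exact: AE.
have [m1 m2 _ _] := modes_jet R.
have sm := @smooth_modes R.
have D1 : 'D_((1, 0) : R * R) (fun q => stereo_inv s (g q)) = fun q => modes_x q *m A.
  by rewrite FA; exact: derive_mulmx.
have D2 : 'D_((0, 1) : R * R) (fun q => stereo_inv s (g q)) = fun q => modes_t q *m A.
  by rewrite FA; exact: derive_mulmx.
have AA : A *m A^T = frame_gram R.
  apply: frame_unique => [q|]; first by rewrite -AE; exact: dot_stereo_inv.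
  have [_ _ _ H22] := fE (0, 0).
  have := metric_stereo_inv s0 sg (0, 0) g1 g1; have := metric_stereo_inv s0 sg (0, 0) g2 g2.
  have -> : 'D_((1, 0) : R * R) (fun q => stereo_inv s (g q)) (0, 0) = modes_x (0, 0) *m A by rewrite -[RHS](congr1 (fun F => F (0, 0)) D1).
  have -> : 'D_((0, 1) : R * R) (fun q => stereo_inv s (g q)) (0, 0) = modes_t (0, 0) *m A by rewrite -[RHS](congr1 (fun F => F (0, 0)) D2).
  by move=> -> ->; rewrite -H22 /=; ring.
(* The frames of the two lifts have the same Gram matrix, so a Moebius map acting on the sphere by
   an orthogonal matrix carries one to the other. *)
have [m [Q [mm QQ mQ HQ]]] := frames_moebius (etrans HH (esym AA)).
have r0 : 0 < Num.sqrt s by rewrite sqrtr_gt0.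
(* [m] sends [h q] to [(f q - c) / sqrt s]; the similarity undoes this normalisation. *)
exists (omap (fun u => Num.sqrt s *: u + c) \o m).
  by apply: moebius_comp mm; exact: moebius_homothety.
move=> q /=; have -> : m (Some (h q)) = Some ((Num.sqrt s)^-1 *: (f q - c)).
  apply: sphere_point_inj; rewrite mQ /sphere_point hH -stereo_inv_scale //.
  by rewrite -mulmxA HQ -AE.
by rewrite /= scalerA divff ?gt_eqF // scale1r subrK.
Qed.
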